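(* Let $E$ be an elliptic curve over $k$ with an automorphism $\xi$ of order $\ell\in\{2,3,4,6\}$ that fixes the origin, and for a positive integer $m$ let $\psi_\ell(m)$ denote the number of $\xi$-stable subgroups of $E$ of order $m$. Then: (1) $\psi_\ell$ is multiplicative; that is, if $a,b\in\mathbb{N}$ are coprime then $\psi_\ell(ab)=\psi_\ell(a)\psi_\ell(b)$. (2) If $\ell=2$, then $\psi_2(m)=\sigma(m)$, where $\sigma(m)$ is the sum of all positive divisors of $m$. (3) If $\ell\in\{3,6\}$, $p$ is prime and $\alpha\geq1$, then (a) $\psi_\ell(3^\alpha)=1$; (b) $\psi_\ell(p^\alpha)=\alpha+1$ if $p\equiv1\pmod 3$; (c) $\psi_\ell(p^\alpha)=2\lfloor\frac{\alpha}{2}\rfloor-\alpha+1$ if $p\equiv2\pmod 3$. (4) If $\ell=4$, $p$ is prime and $\alpha\geq1$, then (a) $\psi_4(2^\alpha)=1$; (b) $\psi_4(p^\alpha)=\alpha+1$ if $p^\alpha\equiv1\pmod 4$; (c) $\psi_4(p^\alpha)=0$ if $p^\alpha\equiv3\pmod 4$.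
   Context: $k$ is an algebraically closed field of characteristic $0$. A subgroup $H\leq E$ is $\xi$-stable if $\xi H=H$.
   Formalization: In (4)(b), $\psi_4(p^\alpha)=\alpha+1$ is asserted only for $p\equiv1\pmod 4$; when $p\equiv3\pmod 4$ and $p^\alpha\equiv1\pmod 4$ (so $\alpha$ is even) the printed value is false (e.g. $\psi_4(9)=1$, not $3$) and is corrected to $1$. *)

(* Defs.v *)
From mathcomp Require Import all_boot all_order all_algebra.
From mathcomp Require Import finmap boolp classical_sets functions cardinality.
From mathcomp Require Import mpoly ring.

Set Implicit Arguments.
Unset Strict Implicit.
Unset Printing Implicit Defensive.

Import GRing.Theory.
Local Open Scope classical_set_scope.
Local Open Scope ring_scope.

(* Over an algebraically closed field a variety is identified with its set of  *)
(* rational points.  Elliptic curves are smooth projective plane cubics in     *)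
(* (long) Weierstrass form                                                     *)
(*   Y^2 Z + a1 XYZ + a3 Y Z^2 = X^3 + a2 X^2 Z + a4 X Z^2 + a6 Z^3            *)
(* with origin [0 : 1 : 0].                                                    *)

Record weierstrass (k : Type) :=
  Weierstrass { a1 : k; a2 : k; a3 : k; a4 : k; a6 : k }.

Section EllipticCurve.
Variable k : fieldType.
Implicit Type W : weierstrass k.

Definition cubic W : {mpoly k[3]} :=
  let X := 'X_(@Ordinal 3 0 isT) in
  let Y := 'X_(@Ordinal 3 1 isT) in
  let Z := 'X_(@Ordinal 3 2 isT) in
  Y ^+ 2 * Z + a1 W *: (X * Y * Z) + a3 W *: (Y * Z ^+ 2)
  - (X ^+ 3 + a2 W *: (X ^+ 2 * Z) + a4 W *: (X * Z ^+ 2) + a6 W *: Z ^+ 3).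

Definition smooth W :=
  forall v : 'I_3 -> k, (exists i, v i != 0) -> (cubic W).@[v] = 0 ->
  exists i, ((cubic W)^`M(i)).@[v] != 0.

(* The only point of a Weierstrass cubic at infinity is [0 : 1 : 0], encoded  *)
(* by None; Some (x, y) stands for [x : y : 1].                                *)
Definition hcoord (P : option (k * k)) : 'I_3 -> k :=
  if P is Some (x, y) then tnth [tuple x; y; 1] else tnth [tuple 0; 1; 0].

Definition on_curve W (P : option (k * k)) := (cubic W).@[hcoord P] == 0.

Definition points W := {P : option (k * k) | on_curve W P}.

(* Chord-tangent law: - (x, y) is the second point with abscissa x, and       *)
(* P1 + P2 is the opposite of the third intersection point of the cubic with  *)
(* the line through P1 and P2 (the tangent if P1 = P2), of slope l.           *)
Definition raw_opp W (P : option (k * k)) :=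
  if P is Some (x, y) then Some (x, - y - a1 W * x - a3 W) else None.

Definition raw_add W (P Q : option (k * k)) :=
  match P, Q with
  | None, _ => Q
  | _, None => P
  | Some (x1, y1), Some (x2, y2) =>
    if (x1 == x2) && (y1 == - y2 - a1 W * x2 - a3 W) then None else
    let l := if x1 == x2
      then (3 * x1 ^+ 2 + 2 * a2 W * x1 + a4 W - a1 W * y1)
             / (2 * y1 + a1 W * x1 + a3 W)
      else (y2 - y1) / (x2 - x1) in
    let x3 := l ^+ 2 + a1 W * l - a2 W - x1 - x2 in
    raw_opp W (Some (x3, l * (x3 - x1) + y1))
  end.

Lemma on_curveE W x y : on_curve W (Some (x, y)) =
  (y ^+ 2 + a1 W * x * y + a3 W * y
     == x ^+ 3 + a2 W * x ^+ 2 + a4 W * x + a6 W).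
Proof.
rewrite /on_curve /cubic -[RHS]subr_eq0 !(mevalB, mevalD, mevalZ, rmorphM, rmorphXn) /=.
by rewrite !mevalXU !(tnth_nth 0) /=; congr (_ == _); ring.
Qed.

Lemma on_curve0 W : on_curve W None.
Proof.
rewrite /on_curve /cubic !(mevalB, mevalD, mevalZ, rmorphM, rmorphXn) /=.
by rewrite !mevalXU !(tnth_nth 0) /=; apply/eqP; ring.
Qed.

Lemma on_curve_opp W P : on_curve W P -> on_curve W (raw_opp W P).
Proof.
case: P => [[x y]|] //=; rewrite !on_curveE => /eqP <-.
by apply/eqP; ring.
Qed.

Lemma on_curve_add W P Q :
  on_curve W P -> on_curve W Q -> on_curve W (raw_add W P Q).
Proof.
case: P Q => [[x1 y1]|] [[x2 y2]|] //=.
case: W => a1 a2 a3 a4 a6; rewrite !on_curveE /= => /eqP h1 /eqP h2.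
case: ifP => [_|]; first exact: on_curve0.
have -> : a6 = y1 ^+ 2 + a1 * x1 * y1 + a3 * y1
               - (x1 ^+ 3 + a2 * x1 ^+ 2 + a4 * x1) by rewrite h1; ring.
case: eqP => [ex /= ney | /eqP nex _].
  have ey : y2 = y1.
    have : (y1 - y2) * (y1 - (- y2 - a1 * x2 - a3)) = 0.
      have -> : (y1 - y2) * (y1 - (- y2 - a1 * x2 - a3)) =
        (y1 ^+ 2 + a1 * x1 * y1 + a3 * y1)
        - (y2 ^+ 2 + a1 * x2 * y2 + a3 * y2) by rewrite ex; ring.
      by rewrite h1 h2 ex; ring.
    by move/eqP; rewrite mulf_eq0 !subr_eq0 ney orbF => /eqP.
  have nz : 2 * y1 + a1 * x1 + a3 != 0.
    move: ney; rewrite -ex ey => /negbT; apply: contraNneq => e.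
    by rewrite -subr_eq0; apply/eqP; rewrite -e; ring.
  rewrite -ex on_curveE /=; apply/eqP; field.
  exact: nz.
have nx : x2 - x1 != 0 by rewrite subr_eq0 eq_sym.
have -> : a4 = (y2 ^+ 2 + a1 * x2 * y2 + a3 * y2
  - (y1 ^+ 2 + a1 * x1 * y1 + a3 * y1)
  - (x2 ^+ 3 + a2 * x2 ^+ 2 - (x1 ^+ 3 + a2 * x1 ^+ 2))) / (x2 - x1).
  by rewrite h1 h2; field.
by rewrite on_curveE /=; apply/eqP; field.
Qed.

Variable W : weierstrass k.

Definition origin : points W := exist _ None (on_curve0 W).
Definition ec_opp (P : points W) : points W :=
  exist _ (raw_opp W (val P)) (on_curve_opp (valP P)).
Definition ec_add (P Q : points W) : points W :=
  exist _ (raw_add W (val P) (val Q)) (on_curve_add (valP P) (valP Q)).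

Definition subgroup (H : set (points W)) :=
  [/\ H origin,
      forall P, H P -> H (ec_opp P) &
      forall P Q, H P -> H Q -> H (ec_add P Q)].

(* Near every point P, f is given by forms F 0, F 1, F 2 of the same degree   *)
(* without common zero at P.                                                  *)
Definition morphism (f : points W -> points W) :=
  forall P : points W, exists (d : nat) (F : 'I_3 -> {mpoly k[3]}),
  [/\ forall i, F i \is d.-homog,
      exists i, (F i).@[hcoord (val P)] != 0 &
      forall Q : points W, (exists i, (F i).@[hcoord (val Q)] != 0) ->
        exists2 c : k, c != 0 &
          forall i, (F i).@[hcoord (val Q)] = c * hcoord (val (f Q)) i].

Definition automorphism (f : points W -> points W) :=
  morphism f /\ exists g, [/\ morphism g, cancel f g & cancel g f].

Definition has_order (f : points W -> points W) (n : nat) :=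
  [/\ (0 < n)%N, iter n f =1 id &
      forall i : nat, (0 < i < n)%N -> ~ (iter i f =1 id)].

Definition stable_subgroups (xi : points W -> points W) (m : nat)
    : set (set (points W)) :=
  [set H | [/\ subgroup H, (H #= `I_m)%card & xi @` H = H]].

(* fset_set is the empty set on infinite sets, so this is the number of       *)
(* xi-stable subgroups of order m only when there are finitely many.           *)
Definition psi (xi : points W -> points W) (m : nat) : nat :=
  #|` fset_set (stable_subgroups xi m)|.

End EllipticCurve.

(* Main.v *)
From HB Require Import structures.
From mathcomp Require Import finmap boolp classical_sets functions cardinality.
From mathcomp Require Import all_boot all_order all_algebra.
From mathcomp Require Import all_fingroup all_solvable separable.
From mathcomp Require Import mpoly ring zify.
Require Import Defs.

(** Write A for the group of points of E.  Three facts about A give everything.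

    (i) A is an abelian group with exactly n^2 points killed by n, for all n > 0
    (ec_addA, torsion_count).  Associativity is one identity of rational
    functions, because a configuration of two chords is parametrized rationally
    by the three abscissas and the two slopes; a formal argument on partially
    associative operations covers the degenerate positions.  For the torsion,
    the abscissa of nP is a rational function N(x)/M(x) of the abscissa of P.
    The pair of abscissas of P + Q and P - Q is a pair of quadratic forms
    without common zero in the abscissas of P and Q, so the degree of N/M obeys
    d(n+1) + d(n-1) = 2 d(n) + 2 and equals n^2 (mul_rep_ex).  The fibre of [n]
    over a generic point, which is a translate of the kernel, then has n^2
    points since the characteristic is 0.

    (ii) In short Weierstrass coordinates xi is (x, y) |-> (w^2 x, w^3 y)
    (automorphism_scaling): x o xi and y o xi are everywhere defined functions on
    the affine curve, hence polynomials in x and y (regular_poly), and comparing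
    pole orders at infinity leaves only this form (rigid).  So w has
    multiplicative order l, xi is additive, and xi^2 + e xi + 1 = 0 on A with
    e = 0 for l = 4 and e = 1 for l = 3; for l = 6 the automorphism - xi has
    order 3 and the same stable subgroups; for l = 2, xi = - 1.

    (iii) For l > 2, xi is not multiplication by an integer prime to p on the
    p-torsion (tau_not_scalar): x(cP) = w^2 x(P) is an equation of degree about c^2 in x(P),
    and one may take c <= p/2, so it has too few solutions to hold on p^2 points.

    What remains is about finite abelian groups.  Multiplicativity is the
    splitting into parts of coprime order.  For p-power order, a subgroup either
    contains the p-torsion, and is then the preimage under multiplication by p of
    a subgroup of order p^(k-2), or is cyclic; hence
    psi(p^k) = psi(p^(k-2)) + #{stable cyclic subgroups of order p^k}
    (stable_count_rec).  If xi = - 1 there are p^k + p^(k-1) of the latter, which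
    gives the divisor sum.  Otherwise a generator of a stable cyclic subgroup is
    multiplied by a root c of c^2 + e c + 1 modulo p^k.  There is no root when p
    is inert, one for k = 1 and none for k >= 2 when p is ramified, and when p splits there are two
    roots, each with an eigengroup that is cyclic of order p^k by (iii). *)

Set Implicit Arguments.
Unset Strict Implicit.
Unset Printing Implicit Defensive.

Import GRing.Theory.
Local Open Scope ring_scope.

(** * Associativity of the chord-tangent law *)

(** Turns an equation c = d into u = v when u - v = c - d is a ring identity. *)
Lemma eq_of_diff (V : zmodType) (c d u v : V) : c = d -> u - v = c - d -> u = v.
Proof. by move=> ->; rewrite subrr => /eqP; rewrite subr_eq0 => /eqP. Qed.

Section ShortCurve.
Variables (k : fieldType) (a b : k).
Hypotheses (two_neq0 : (2 : k) != 0) (disc_neq0 : 4 * a ^+ 3 + 27 * b ^+ 2 != 0).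

Notation W := (Weierstrass 0 0 0 a b).
Notation add := (raw_add W).
Notation opp := (raw_opp W).
Notation on := (on_curve W).
Implicit Types P Q R : option (k * k).

Definition short x := x ^+ 3 + a * x + b.

(** l is the slope of the line through two points of the curve: the first equation
    determines it when the abscissas differ, the second one, which follows from
    the first by dividing y2^2 - y1^2 by x2 - x1, when the points coincide.  Both
    together treat chords and tangents alike. *)
Definition chord (l x1 y1 x2 y2 : k) :=
  y2 - y1 = l * (x2 - x1)
  /\ l * (y1 + y2) = x1 ^+ 2 + x1 * x2 + x2 ^+ 2 + a.

Lemma on_short x y : on (Some (x, y)) = (y ^+ 2 == short x).
Proof. by rewrite on_curveE /= /short !(mul0r, addr0). Qed.

(** A common root of x^3 + ax + b and of its derivative annihilates the
    discriminant. *)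
Lemma short_smooth x : short x = 0 -> 3 * x ^+ 2 + a = 0 -> False.
Proof.
rewrite /short => /eqP h1 /eqP; rewrite addrC addr_eq0 => /eqP ha.
case/eqP: disc_neq0; move: h1; rewrite addrC addr_eq0 => /eqP ->.
by rewrite ha; ring.
Qed.

Lemma short_opp x y : opp (Some (x, y)) = Some (x, - y).
Proof. by rewrite /= mul0r !subr0. Qed.

Lemma short_oppK P : opp (opp P) = P.
Proof. by case: P => [[x y]|//]; rewrite !short_opp opprK. Qed.

Lemma addNP P : add (opp P) P = None.
Proof. by case: P => [[x y]|//] /=; rewrite !eqxx. Qed.

Lemma chord_sym l x1 y1 x2 y2 : chord l x1 y1 x2 y2 -> chord l x2 y2 x1 y1.
Proof.
move=> [h1 h2]; split; last by rewrite addrC h2; ring.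
by rewrite -opprB h1; ring.
Qed.

Lemma chord_ex x1 y1 x2 y2 : on (Some (x1, y1)) -> on (Some (x2, y2)) ->
  Some (x1, y1) <> opp (Some (x2, y2)) -> exists l, chord l x1 y1 x2 y2.
Proof.
rewrite !on_short short_opp => /eqP h1 /eqP h2 ne.
case: (eqVneq x1 x2) => [ex|nex].
  have ny : y1 + y2 != 0.
    by apply/eqP => /eqP; rewrite addr_eq0 => /eqP ey; apply: ne; rewrite ex ey.
  have ey : y2 = y1.
    apply/eqP; rewrite -subr_eq0; have /eqP : (y2 - y1) * (y1 + y2) = 0.
      by apply: (@etrans _ _ (y2 ^+ 2 - y1 ^+ 2)); [ring | rewrite h1 h2 ex subrr].
    by rewrite mulf_eq0 (negbTE ny) orbF.
  exists ((x1 ^+ 2 + x1 * x2 + x2 ^+ 2 + a) / (y1 + y2)); split.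
    by rewrite ex ey !subrr mulr0.
  by rewrite mulfVK.
have nx : x2 - x1 != 0 by rewrite subr_eq0 eq_sym.
exists ((y2 - y1) / (x2 - x1)); split; first by rewrite mulfVK.
apply: (mulfI nx); apply: (@etrans _ _ (y2 ^+ 2 - y1 ^+ 2)); first by field.
by rewrite h1 h2 /short; ring.
Qed.

Lemma chord_neq_opp l x1 y1 x2 y2 : on (Some (x2, y2)) ->
  chord l x1 y1 x2 y2 -> Some (x1, y1) <> opp (Some (x2, y2)).
Proof.
rewrite on_short short_opp => /eqP h2 [c1 c2] [ex ey]; move: c1 c2.
rewrite ex ey subrr mulr0 opprK => y0; rewrite addNr mulr0 => e.
have {}y0 : y2 = 0.
  by apply/eqP; have /eqP := y0; rewrite -mulr2n -mulr_natl mulf_eq0 (negbTE two_neq0).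
apply: (@short_smooth x2); first by rewrite -h2 y0 expr0n.
by rewrite [RHS]e; ring.
Qed.

Lemma chord_uniq l m x1 y1 x2 y2 : on (Some (x2, y2)) ->
  chord l x1 y1 x2 y2 -> chord m x1 y1 x2 y2 -> l = m.
Proof.
move=> on2 c1 c2; have ne := chord_neq_opp on2 c1.
case: c1 c2 => [l1 l2] [m1 m2]; apply/eqP; rewrite -subr_eq0.
case: (eqVneq x1 x2) => [ex|nx].
  have ny : y1 + y2 != 0.
    apply/eqP => /eqP; rewrite addr_eq0 => /eqP ey; apply: ne.
    by rewrite short_opp ex ey.
  by rewrite -(mulIr_eq0 _ (mulIf ny)) mulrBl l2 m2 subrr.
have {}nx : x2 - x1 != 0 by rewrite subr_eq0 eq_sym.
by rewrite -(mulIr_eq0 _ (mulIf nx)) mulrBl -l1 -m1 subrr.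
Qed.

Lemma add_chord l x1 y1 x2 y2 :
  on (Some (x1, y1)) -> on (Some (x2, y2)) -> chord l x1 y1 x2 y2 ->
  let x3 := l ^+ 2 - x1 - x2 in
  add (Some (x1, y1)) (Some (x2, y2)) = Some (x3, l * (x1 - x3) - y1).
Proof.
move=> on1 on2 c /=; have ne := chord_neq_opp on2 c.
case: ifP => [/andP[/eqP ex /eqP ey]|nn]; first by case: ne; rewrite /= -ex ey -ex.
set s := (if _ then _ else _).
suff -> : s = l by congr (Some (_, _)); ring.
apply: (chord_uniq on2) c; rewrite /s; case: ifP nn => [/eqP ex /= ny|nx _].
  have {}ny : y1 + y2 != 0.
    apply: contraFneq ny => /eqP; rewrite addr_eq0 => /eqP ->.
    by rewrite mul0r !subr0.
  have ey : y2 = y1.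
    apply/eqP; rewrite -subr_eq0; have /eqP : (y2 - y1) * (y1 + y2) = 0.
      apply: (@etrans _ _ (y2 ^+ 2 - y1 ^+ 2)); first by ring.
      by move: on1 on2; rewrite !on_short ex => /eqP-> /eqP ->; rewrite subrr.
    by rewrite mulf_eq0 (negbTE ny) orbF.
  rewrite -ex ey in ny *; split; first by rewrite !subrr mulr0.
  by field; rewrite two_neq0 andbT; apply: contraNneq ny => ->; rewrite addr0.
have {}nx : x2 - x1 != 0 by rewrite subr_eq0 eq_sym nx.
split; first by rewrite mulfVK.
apply: (mulfI nx); apply: (@etrans _ _ (y2 ^+ 2 - y1 ^+ 2)); first by field.
by move: on1 on2; rewrite !on_short => /eqP -> /eqP ->; rewrite /short; ring.
Qed.

Lemma addPN P : add P (opp P) = None.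
Proof. by rewrite -{1}[P]short_oppK addNP. Qed.

Lemma short_addC P Q : on P -> on Q -> add P Q = add Q P.
Proof.
case: P Q => [[x1 y1]|] [[x2 y2]|] // on1 on2.
case: (pselect (Some (x1, y1) = opp (Some (x2, y2)))) => [e|ne].
  by rewrite [in LHS]e addNP e addPN.
have [l c] := chord_ex on1 on2 ne.
rewrite (add_chord on1 on2 c) (add_chord on2 on1 (chord_sym c)).
case: c => c1 _; congr (Some (_, _)); first by ring.
by apply: (eq_of_diff c1); ring.
Qed.

(** The line through P and R, reflected in the axis, passes through - P and P + R
    with slope - l. *)
Lemma short_addK P R : on P -> on R -> add (opp P) (add P R) = R.
Proof.
move=> on1 on2; have onS := on_curve_add on1 on2; have on1' := on_curve_opp on1.
case: P R on1 on2 onS on1' => [[x1 y1]|] [[x2 y2]|] // on1 on2; last by rewrite /= !eqxx.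
case: (pselect (Some (x1, y1) = opp (Some (x2, y2)))) => [->|ne].
  by rewrite addNP short_oppK.
have [l c] := chord_ex on1 on2 ne.
rewrite (add_chord on1 on2 c) short_opp => onS on1'.
rewrite (@add_chord (- l) x1 (- y1)) //; last first.
  case: c => c1 c2; split; first by ring.
  have e : y2 = y1 + l * (x2 - x1) by rewrite -c1; ring.
  by rewrite e in c2; apply: (eq_of_diff c2); ring.
case: c => c1 _; congr (Some (_, _)); first by ring.
by apply: (eq_of_diff (esym c1)); ring.
Qed.

(** Once the ordinates and the coefficient a are expressed by the abscissas and the
    slopes l, m of the lines PQ and QR, no relation is left between these five
    parameters, and associativity is an identity of rational functions.  The
    abscissas of P and Q may coincide, so P = Q is included. *)
Lemma generic_addA (x1 y1 x2 y2 x3 y3 l m : k) :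
  let x4 := l ^+ 2 - x1 - x2 in let y4 := l * (x1 - x4) - y1 in
  let x6 := m ^+ 2 - x2 - x3 in let y6 := m * (x2 - x6) - y2 in
  let p := (y3 - y4) / (x3 - x4) in let q := (y6 - y1) / (x6 - x1) in
  chord l x1 y1 x2 y2 -> chord m x2 y2 x3 y3 ->
  l != m -> x3 - x4 != 0 -> x6 - x1 != 0 ->
  p ^+ 2 - x4 - x3 = q ^+ 2 - x1 - x6 /\
  p * (x4 - (p ^+ 2 - x4 - x3)) - y4 = q * (x1 - (q ^+ 2 - x1 - x6)) - y1.
Proof.
move=> x4 y4 x6 y6 p q [l1 l2] [m1 m2]; rewrite -subr_eq0 => lm n34 n61.
have ey1 : y1 = y2 + l * (x1 - x2) by apply: (eq_of_diff (esym l1)); ring.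
have ey3 : y3 = y2 + m * (x3 - x2) by apply: (eq_of_diff m1); ring.
(* eliminating a between the two chords leaves an equation linear in y2 *)
have ey2 : y2 = (m ^+ 2 * (x3 - x2) - l ^+ 2 * (x1 - x2)
                 + (x1 - x3) * (x1 + x2 + x3)) / (2 * (l - m)).
  have n2lm : 2 * (l - m) != 0 by rewrite mulf_neq0.
  apply: (mulfI n2lm); rewrite [RHS]mulrC mulfVK //.
  have e : l * (y1 + y2) - m * (y2 + y3)
      = x1 ^+ 2 + x1 * x2 - x2 * x3 - x3 ^+ 2 by rewrite l2 m2; ring.
  by rewrite ey1 ey3 in e; apply: (eq_of_diff e); ring.
have n43 : x4 - x3 != 0 by rewrite -opprB oppr_eq0.
rewrite {}/p {}/q {}/y4 {}/y6 {}/x4 {}/x6 in n34 n61 n43 *.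
rewrite {}ey1 {}ey3 {}ey2 {l1 l2 m1 m2}.
by split; field; rewrite ?lm ?two_neq0 ?n34 ?n61 ?n43.
Qed.

(** What the generic identity gives: the excluded positions are those where one of
    the four sums is the origin, or where one of the outer sums is a doubling. *)
Lemma partial_addA x1 y1 x2 y2 x3 y3 (P := Some (x1, y1)) (Q := Some (x2, y2))
    (R := Some (x3, y3)) : on P -> on Q -> on R ->
  P <> opp Q -> Q <> opp R -> add P Q <> opp R -> P <> opp (add Q R) ->
  add P Q <> R -> P <> add Q R -> add (add P Q) R = add P (add Q R).
Proof.
move=> onP onQ onR nPQ nQR nS nT neS neT.
have onS := on_curve_add onP onQ; have onT := on_curve_add onQ onR.
have [l cl] := chord_ex onP onQ nPQ; have [m cm] := chord_ex onQ onR nQR.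
have eS := add_chord onP onQ cl; have eT := add_chord onQ onR cm.
rewrite /P /Q /R in onS onT nS nT neS neT *.
rewrite eS eT in onS onT nS nT neS neT *.
set x4 := l ^+ 2 - _ - _ in onS nS neS *.
set y4 := l * _ - _ in onS nS neS *.
set x6 := m ^+ 2 - _ - _ in onT nT neT *.
set y6 := m * _ - _ in onT nT neT *.
have dx u v u' v' : on (Some (u, v)) -> on (Some (u', v')) ->
   Some (u, v) <> Some (u', v') -> Some (u, v) <> opp (Some (u', v')) ->
   u' - u != 0.
  rewrite !on_short short_opp => /eqP h /eqP h' n1 n2; apply/eqP => /eqP.
  rewrite subr_eq0 => /eqP e; rewrite e in h' n1 n2.
  have : v ^+ 2 == v' ^+ 2 by rewrite h h'.
  by rewrite eqf_sqr => /orP[] /eqP ev; rewrite ev in n1 n2.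
have n34 := dx _ _ _ _ onS onR neS nS.
have n61 := dx _ _ _ _ onP onT neT nT.
(* collinear points: R lies on the line PQ, so R = P or R = - (P + Q) *)
case: (eqVneq l m) => [elm|nlm].
  subst m.
  have /eqP : (x3 - x1) * (x3 - x4) = 0.
    case: cl cm => l1 l2 [m1 m2].
    have e : l * (y2 + y3) - l * (y1 + y2)
      = (x3 - x1) * (x1 + x2 + x3) by rewrite l2 m2; ring.
    have e1 : y1 = y2 - l * (x2 - x1) by apply: (eq_of_diff (esym l1)); ring.
    have e3 : y3 = y2 + l * (x3 - x2) by apply: (eq_of_diff m1); ring.
    by rewrite e1 e3 in e; rewrite /x4; apply: (eq_of_diff (esym e)); ring.
  rewrite mulf_eq0 (negbTE n34) orbF subr_eq0 => /eqP e31.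
  have e13 : y3 = y1.
    by case: cl cm => l1 l2 [m1 m2]; rewrite e31 in m1; apply: (eq_of_diff (congr2 +%R l1 m1)); ring.
  rewrite -eS -eT e31 e13 (short_addC onQ) ?(short_addC onP) //.
    by rewrite short_addC // ?on_curve_add.
have [] := generic_addA cl cm nlm n34 n61.
rewrite -/x4 -/y4 -/x6 -/y6.
have mk u v u' v' : on (Some (u, v)) -> on (Some (u', v')) -> u' - u != 0 ->
    chord ((v' - v) / (u' - u)) u v u' v'.
  rewrite !on_short => /eqP h /eqP h' n; split; first by rewrite mulfVK.
  apply: (mulfI n); apply: (@etrans _ _ (v' ^+ 2 - v ^+ 2)); first by field.
  by rewrite h h' /short; ring.
rewrite (add_chord onS onR (mk _ _ _ _ onS onR n34)).
rewrite (add_chord onP onT (mk _ _ _ _ onP onT n61)).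
by move=> -> ->.
Qed.

End ShortCurve.

(** Commutativity, cancellation and associativity in general position force
    associativity.  If the outer sum on the left is a doubling, x + y = t, then
    t + t = x + (y + t) follows from the triple (- x, t, t), which is in general
    position unless t + t = - x; that case reduces to 3t + t = 2t + 2t. *)
Lemma group_chunk (T : Type) (z : T) (o : T -> T) (s : T -> T -> T) :
  commutative s -> left_id z s -> involutive o -> left_inverse z o s ->
  (forall x y, s (o x) (s x y) = y) ->
  (forall x y t, x <> z -> y <> z -> t <> z -> x <> o y -> y <> o t ->
    s x y <> o t -> x <> o (s y t) -> s x y <> t -> x <> s y t ->
    s (s x y) t = s x (s y t)) ->
  forall x y t, s (s x y) t = s x (s y t).
Proof.
move=> sC s0 oK sN sK gen.
have sr0 x : s x z = x by rewrite sC s0.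
have o0 : o z = z by rewrite -[LHS]sr0 sN.
have rot x y t : s x y = o t -> s y t = o x.
  move=> e; rewrite -(sK x y) e -{2}[t]oK sC.
  by rewrite (sC (o x)) sK.
have half x y t : s x y <> t -> x <> s y t -> s (s x y) t = s x (s y t).
  move=> n1 n2.
  case: (pselect (x = z)) => [->|x0]; first by rewrite !s0.
  case: (pselect (y = z)) => [->|y0]; first by rewrite sr0 s0.
  case: (pselect (t = z)) => [->|t0]; first by rewrite !sr0.
  case: (pselect (x = o y)) => [->|xy]; first by rewrite sN s0 sK.
  case: (pselect (y = o t)) => [->|yt].
    by rewrite sN sr0 sC [s x _]sC -{1}[t]oK sK.
  case: (pselect (s x y = o t)) => [e|xyt].
    by rewrite e (rot _ _ _ e) sN sC sN.
  apply: gen => // e; apply: xyt.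
  by rewrite sC; apply: rot; rewrite sC e oK.
have sI x y t : s x y = s x t -> y = t by move=> e; rewrite -(sK x y) e sK.
have idz x y : s x y = x -> y = z by rewrite -{2}[x]sr0 => /sI.
have four x : s (s (s x x) x) x = s (s x x) (s x x).
  case: (pselect (x = z)) => [->|x0]; first by rewrite !s0.
  case: (pselect (s (s x x) (s x x) = o x)) => [e|n].
    by rewrite e (rot _ _ _ e) sC; apply: rot; rewrite oK.
  rewrite -[RHS](sK (o x)) oK -(half (o x)); last by move=> e; apply: n.
    by rewrite sK [s x (s x x)]sC sC.
  by rewrite sK => /esym/idz.
have left x y t : s x y = t -> s (s x y) t = s x (s y t).
  move=> e; case: (pselect (y = t)) => [eyt|nyt].
    by move: e; rewrite -eyt sC => /idz ->; rewrite sr0 s0.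
  rewrite e; have ey : y = s (o x) t by rewrite -e sK.
  case: (pselect (o x = s t t)) => [ex|nx].
    by rewrite ey ex four -[in RHS](oK x) ex sK.
  by rewrite -[LHS](sK (o x)) oK -(half (o x)) // -ey.
move=> x y t; case: (pselect (s x y = t)) => [e|ne]; first by rewrite left.
case: (pselect (s y t = x)) => [e|nf]; last by rewrite half // => /esym.
by rewrite sC (sC y t) (sC x y) -left ?(sC t y) // sC (sC t y) e.
Qed.

(** * The short Weierstrass form of a smooth curve *)

Section ShortForm.
Variables (k : fieldType) (W : weierstrass k).
Hypotheses (two_neq0 : (2 : k) != 0) (three_neq0 : (3 : k) != 0).

(** In terms of the classical quantities b2, b4, b6 of the curve, shift_x is b2/12
    and the short form arises by completing the square in y and the cube in x. *)
Definition shift_x : k := (a1 W ^+ 2 + 4 * a2 W) / 12.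
Definition short_a : k := (2 * a4 W + a1 W * a3 W) / 2 - 3 * shift_x ^+ 2.
Definition short_b : k := 2 * shift_x ^+ 3
  - shift_x * (2 * a4 W + a1 W * a3 W) / 2 + (a3 W ^+ 2 + 4 * a6 W) / 4.

Notation V := (Weierstrass 0 0 0 short_a short_b).

Definition to_short (P : option (k * k)) :=
  if P is Some (x, y) then Some (x + shift_x, y + (a1 W * x + a3 W) / 2) else None.

Definition of_short (P : option (k * k)) :=
  if P is Some (x, y)
  then Some (x - shift_x, y - (a1 W * (x - shift_x) + a3 W) / 2) else None.

Lemma to_shortK : cancel to_short of_short.
Proof. by case=> [[x y]|] //=; rewrite !addrK. Qed.

Lemma of_shortK : cancel of_short to_short.
Proof. by case=> [[x y]|] //=; rewrite subrK addrC subrKC. Qed.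

Lemma four_neq0 : (4 : k) != 0.
Proof. by rewrite (_ : 4 = 2 * 2); [rewrite mulf_neq0 | ring]. Qed.

Lemma twelve_neq0 : (12 : k) != 0.
Proof.
have -> : (12 : k) = 2 * 2 * 3 by ring.
by rewrite !mulf_neq0.
Qed.

Lemma on_to_short P : on_curve V (to_short P) = on_curve W P.
Proof.
case: P => [[x y]|]; last by rewrite !on_curve0.
rewrite [LHS]on_short on_curveE /short -subr_eq0 -[RHS]subr_eq0.
congr (_ == 0); rewrite /short_a /short_b /shift_x.
field.
by rewrite two_neq0 twelve_neq0 four_neq0.
Qed.

Lemma to_short_opp P : to_short (raw_opp W P) = raw_opp V (to_short P).
Proof.
case: P => [[x y]|] //=; congr (Some (_, _)); field; by rewrite two_neq0.
Qed.

Lemma to_short_add P Q : on_curve W P -> on_curve W Q ->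
  to_short (raw_add W P Q) = raw_add V (to_short P) (to_short Q).
Proof.
case: P Q => [[x1 y1]|] [[x2 y2]|] // on1 on2.
rewrite /raw_add /= (inj_eq (addIr _)) !mul0r !subr0 !addr0.
have -> : (y1 + (a1 W * x1 + a3 W) / 2 == - (y2 + (a1 W * x2 + a3 W) / 2))
   = (y1 == - y2 - a1 W * ((x1 + x2) / 2) - a3 W).
  by rewrite -subr_eq0 -[RHS]subr_eq0; congr (_ == 0); field; rewrite two_neq0.
case: (eqVneq x1 x2) => [ex|nx] /=; last first.
  have {}nx : x2 - x1 != 0 by rewrite subr_eq0 eq_sym.
  have -> : x2 + shift_x - (x1 + shift_x) = x2 - x1 by ring.
  by congr (Some (_, _)); rewrite /shift_x; field;
     rewrite nx two_neq0 ?twelve_neq0 ?four_neq0.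
rewrite -ex; have -> : (x1 + x1) / 2 = x1 by field; rewrite two_neq0.
case: ifP => //= ny.
rewrite !(mulr0, mul0r, addr0, subr0).
have ny1 : y1 + y2 + a1 W * x1 + a3 W != 0.
  by apply: contraFneq ny => e; rewrite -subr_eq0; apply/eqP; rewrite -e; ring.
have ey : y2 = y1.
  have /eqP : (y1 - y2) * (y1 + y2 + a1 W * x1 + a3 W) = 0.
    move: on1 on2; rewrite !on_curveE -ex => /eqP h1 /eqP h2.
    by apply: (eq_of_diff (etrans h1 (esym h2))); ring.
  by rewrite mulf_eq0 (negbTE ny1) orbF subr_eq0 => /eqP.
rewrite ey in ny1 *.
have ny2 : 2 * y1 + a1 W * x1 + a3 W != 0.
  by apply: contra_neq ny1 => e; rewrite -[RHS]e; ring.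
have ny3 : 2 * (y1 + (a1 W * x1 + a3 W) / 2) != 0.
  by apply: contra_neq ny2 => e; rewrite -[RHS]e; field.
congr (Some (_, _)); rewrite /short_a /shift_x; field;
  by rewrite two_neq0 ?twelve_neq0 ?four_neq0 //= mulrC addrA.
Qed.

Lemma mderivU n (i j : 'I_n) : ('X_i : {mpoly k[n]})^`M(j) = (i == j)%:R.
Proof.
rewrite mderivX mnm1E; case: eqVneq => [->|_]; last by rewrite scale0r.
by rewrite -{1}[U_(j)%MM]add0m addmK mpolyX0 scale1r.
Qed.

(** For the Z-derivative, Euler's relation 3F = X F_X + Y F_Y + Z F_Z is used. *)
Lemma cubic_partial x y (v := hcoord (Some (x, y))) i :
  2 * y + a1 W * x + a3 W = 0 ->
  a1 W * y = 3 * x ^+ 2 + 2 * a2 W * x + a4 W -> on_curve W (Some (x, y)) ->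
  ((cubic W)^`M(i)).@[v] = 0.
Proof.
move=> h1 h2 onP; rewrite /cubic /v !(mderivB, mderivD, mderivZ, expr2, exprS, expr0, mulr1, mderivM, mderivU).
rewrite !(mevalB, mevalD, mevalZ, mevalM, rmorph_nat) !mevalXU /= !(tnth_nth 0) /=.
case: i => [[|[|[|//]]] ?]; rewrite /eq_op /= ?mulr0n ?mulr1n.
- by apply: (eq_of_diff h2); ring.
- by rewrite -[RHS]h1; ring.
move: onP; rewrite on_curveE => /eqP h3.
have : 3 * (y ^+ 2 + a1 W * x * y + a3 W * y) - y * (2 * y + a1 W * x + a3 W)
  = 3 * (x ^+ 3 + a2 W * x ^+ 2 + a4 W * x + a6 W) - x * (3 * x ^+ 2 + 2 * a2 W * x + a4 W - a1 W * y).
  by rewrite h3 h1 h2; ring.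
by move=> h4; apply: (eq_of_diff h4); ring.
Qed.

(** If the discriminant vanishes, the double root of x^3 + ax + b is the abscissa
    of a singular point. *)
Lemma smooth_disc : smooth W -> 4 * short_a ^+ 3 + 27 * short_b ^+ 2 != 0.
Proof.
move=> smW; apply/eqP => disc0.
have [x0 sx0 dx0] : exists2 x, short short_a short_b x = 0 & 3 * x ^+ 2 + short_a = 0.
  case: (eqVneq short_a 0) => [A0|A0].
    exists 0; last by rewrite A0; ring.
    have /eqP : 27 * short_b ^+ 2 = 0 by rewrite -[RHS]disc0 A0; ring.
    rewrite (_ : 27 = 3 * 3 * 3); last by ring.
    rewrite !mulf_eq0 (negbTE three_neq0) /= orbb => /eqP B0.
    by rewrite /short A0 B0; ring.
  (* x = -3B/2A is the double root of a singular cubic *)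
  have e : 3 * (- 3 * short_b / (2 * short_a)) ^+ 2 + short_a = 0.
    apply: (@etrans _ _ ((4 * short_a ^+ 3 + 27 * short_b ^+ 2) / (4 * short_a ^+ 2))).
      by field; rewrite A0 two_neq0 four_neq0.
    by rewrite disc0 mul0r.
  exists (- 3 * short_b / (2 * short_a)) => //.
  move: e; set z := _ / _ => e.
  have ez : z * (2 * short_a) = - 3 * short_b by rewrite mulfVK // mulf_neq0.
  apply: (mulfI three_neq0); rewrite mulr0 /short.
  have : z * (3 * z ^+ 2 + short_a) + (z * (2 * short_a) + 3 * short_b) = 0.
    by rewrite e ez; ring.
  by move=> <-; ring.
(* the point (x0, 0) of the short form *)
pose x := x0 - shift_x; pose y := - (a1 W * x + a3 W) / 2.
have onP : on_curve W (Some (x, y)).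
  rewrite -on_to_short /= subrK /y -mulrDl addNr mul0r on_short sx0.
  by rewrite expr0n.
have [||i] := smW (hcoord (Some (x, y))).
- by exists (@Ordinal 3 2 isT); rewrite /= (tnth_nth 0) /= oner_neq0.
- exact/eqP.
rewrite cubic_partial ?eqxx //; first by rewrite /y; field; rewrite two_neq0.
have ex0 : x0 = x + shift_x by rewrite subrK.
by apply: (eq_of_diff (esym dx0)); rewrite ex0 /short_a /y /shift_x; field; rewrite ?two_neq0 twelve_neq0.
Qed.

End ShortForm.

Section PointGroup.
Variables (k : fieldType) (W : weierstrass k).
Hypotheses (two_neq0 : (2 : k) != 0) (three_neq0 : (3 : k) != 0).
Hypothesis smW : smooth W.

Notation V := (Weierstrass 0 0 0 (short_a W) (short_b W)).

Definition short_pt (P : points W) := to_short W (val P).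

Lemma short_pt_on P : on_curve V (short_pt P).
Proof. by rewrite on_to_short // (valP P). Qed.

Lemma short_pt_inj : injective short_pt.
Proof. by move=> P Q /(can_inj (@to_shortK k W)) /val_inj. Qed.

Lemma short_pt_surj R : on_curve V R -> exists P, short_pt P = R.
Proof.
move=> onR; have onP : on_curve W (of_short W R) by rewrite -on_to_short // of_shortK.
by exists (exist (on_curve W) _ onP); rewrite /short_pt /= of_shortK.
Qed.

Lemma short_pt_opp P : short_pt (ec_opp P) = raw_opp V (short_pt P).
Proof. exact: to_short_opp. Qed.

Lemma short_pt_add P Q : short_pt (ec_add P Q) = raw_add V (short_pt P) (short_pt Q).
Proof. exact: to_short_add (valP P) (valP Q). Qed.

Lemma ec_add0 : left_id (origin W) (@ec_add k W).
Proof. by move=> P; apply: val_inj. Qed.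

Lemma ec_addN : left_inverse (origin W) (@ec_opp k W) (@ec_add k W).
Proof. by move=> P; apply: short_pt_inj; rewrite short_pt_add short_pt_opp addNP. Qed.

Lemma ec_addC : commutative (@ec_add k W).
Proof.
move=> P Q; apply: short_pt_inj.
by rewrite !short_pt_add (short_addC two_neq0 (smooth_disc _ _ smW)) ?short_pt_on.
Qed.

Lemma ec_addA : associative (@ec_add k W).
Proof.
have d := smooth_disc two_neq0 three_neq0 smW.
have inj P Q : P <> Q -> short_pt P <> short_pt Q by move=> n /short_pt_inj.
move=> P Q R; symmetry; move: P Q R.
apply: (@group_chunk _ (origin W) (@ec_opp k W)).
- exact: ec_addC.
- exact: ec_add0.
- by move=> P; apply: short_pt_inj; rewrite !short_pt_opp short_oppK.
- exact: ec_addN.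
- move=> P Q; apply: short_pt_inj.
  by rewrite !(short_pt_add, short_pt_opp) short_addK ?short_pt_on.
move=> P Q R /inj nP /inj nQ /inj nR /inj + /inj + /inj + /inj + /inj + /inj +.
move: (short_pt_on P) (short_pt_on Q) (short_pt_on R).
rewrite !(short_pt_add, short_pt_opp) => onP onQ onR n1 n2 n3 n4 n5 n6.
apply: short_pt_inj; rewrite !short_pt_add.
case: (short_pt P) nP onP n1 n3 n4 n5 n6 => [[x1 y1]|//] _ onP n1 n3 n4 n5 n6.
case: (short_pt Q) nQ onQ n1 n2 n3 n4 n5 n6 => [[x2 y2]|//] _ onQ n1 n2 n3 n4 n5 n6.
case: (short_pt R) nR onR n2 n3 n4 n5 n6 => [[x3 y3]|//] _ onR n2 n3 n4 n5 n6.
exact: partial_addA.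
Qed.

(** The hypotheses are arguments of the type so that the group structure can be
    attached to it. *)
Definition ec_group of (2 : k) != 0 & (3 : k) != 0 & smooth W := points W.
Notation G := (ec_group two_neq0 three_neq0 smW).

HB.instance Definition _ := Choice.on G.
HB.instance Definition _ :=
  GRing.isZmodule.Build G ec_addA ec_addC ec_add0 ec_addN.

End PointGroup.

(** * The parallelogram law for abscissas *)

Section Parallelogram.
Variables (k : fieldType) (a b : k).
Hypotheses (two_neq0 : (2 : k) != 0) (disc_neq0 : 4 * a ^+ 3 + 27 * b ^+ 2 != 0).
Notation W := (Weierstrass 0 0 0 a b).
Variables (A : zmodType) (co : A -> option (k * k)).
Hypotheses (co_on : forall P, on_curve W (co P)) (co0 : co 0 = None)
  (coN : forall P, co (- P) = raw_opp W (co P))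
  (coD : forall P Q, co (P + Q) = raw_add W (co P) (co Q))
  (co_inj : injective co).

(** The abscissa of P is (n : m) in projective coordinates on the line, the origin
    having abscissa (1 : 0). *)
Definition x_is P (n m : k) : Prop :=
  if co P is Some (x, y) then m != 0 /\ n = x * m else m = 0 /\ n != 0.

Lemma x_is_ex P : exists n m, x_is P n m.
Proof.
rewrite /x_is; case: (co P) => [[x y]|]; last by exists 1, 0; split=> //; apply: oner_neq0.
by exists x, 1; rewrite mulr1 oner_neq0.
Qed.

Lemma x_is_scale P n m e : e != 0 -> x_is P n m -> x_is P (e * n) (e * m).
Proof.
rewrite /x_is; case: (co P) => [[x y]|] e0 [h1 h2].
  by rewrite mulf_neq0 // h2; split=> //; ring.
by rewrite h1 mulr0 mulf_neq0.
Qed.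

Lemma x_is_neq0 P n m : x_is P n m -> ~ (n = 0 /\ m = 0).
Proof.
rewrite /x_is; case: (co P) => [[x y]|] [h1 h2] [e1 e2]; move: h1 h2.
  by rewrite e2 eqxx.
by rewrite e1 eqxx.
Qed.

(** For points with abscissas (n : m) and (x : 1), the symmetric functions of the
    abscissas of their sum and difference are (parA : parB : parC). *)
Definition parA (x n m : k) := (n - x * m) ^+ 2.
Definition parB (x n m : k) := 2 * ((n + x * m) * (a * m + x * n) + 2 * b * m ^+ 2).
Definition parC (x n m : k) := (x * n - a * m) ^+ 2 - 4 * b * (n + x * m) * m.

(** u is proportional to the coefficients of the binary quadratic form with zeros
    (np : mp) and (nm : mm). *)
Definition par_triple (u : k * k * k) (np mp nm mm : k) :=
  exists2 c : k, c != 0 &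
  [/\ u.1.1 = c * (mp * mm), u.1.2 = c * (np * mm + nm * mp) & u.2 = c * (np * nm)].

Lemma par_triple_sym u np mp nm mm : par_triple u np mp nm mm -> par_triple u nm mm np mp.
Proof.
by case=> c c0 [h1 h2 h3]; exists c => //; rewrite h1 h2 h3; split; ring.
Qed.

(** The numerator and the denominator of x(2P) have no common zero on a smooth
    curve: modulo x^3 + ax + b this numerator is the square of the derivative. *)
Lemma double_neq0 x : short a b x = 0 -> (x ^+ 2 - a) ^+ 2 - 8 * b * x != 0.
Proof.
move=> h; have -> : (x ^+ 2 - a) ^+ 2 - 8 * b * x = (3 * x ^+ 2 + a) ^+ 2.
  by apply: (eq_of_diff (congr1 ( *%R (- 8 * x)) h)); rewrite /short; ring.
by rewrite expf_neq0 //; apply/eqP => /(short_smooth disc_neq0 h).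
Qed.

Lemma co_none P : co P = None -> P = 0.
Proof. by rewrite -co0 => /co_inj. Qed.

(** The case P = - Q, where one of the two sums is the origin and the other one is
    - 2Q. *)
Lemma xparN Q x y np mp nm mm : co Q = Some (x, y) ->
  x_is (- Q + Q) np mp -> x_is (- Q - Q) nm mm ->
  par_triple (parA x x 1, parB x x 1, parC x x 1) np mp nm mm.
Proof.
move=> cQ; rewrite addNr /x_is co0 coD coN cQ short_opp => -[-> np0].
have onQ := co_on Q; have onN := co_on (- Q).
rewrite cQ in onQ; rewrite coN cQ short_opp in onN.
case: (eqVneq y 0) => [y0|y0].
  have e0 : Some (x, - y) = raw_opp W (Some (x, - y)) by rewrite short_opp y0 !oppr0.
  rewrite {1}e0 addNP => -[-> nm0].
  rewrite on_short y0 expr0n /= eq_sym in onQ; move/eqP: onQ => sx.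
  have C0 := double_neq0 sx.
  exists (parC x x 1 / (np * nm)) => /=.
    rewrite mulf_neq0 ?invr_neq0 ?mulf_neq0 //.
    by apply: contra_neq C0 => <-; rewrite /parC; ring.
  rewrite /parA /parB; split; first by ring.
    by apply: (eq_of_diff (congr1 ( *%R 4) sx)); rewrite /short; ring.
  by rewrite mulfVK // mulf_neq0.
have y20 : 2 * y != 0 by rewrite mulf_neq0.
have ch : chord a (- (3 * x ^+ 2 + a) / (2 * y)) x (- y) x (- y).
  by split; [ring | field; rewrite y0 two_neq0].
rewrite (add_chord two_neq0 disc_neq0 onN onN ch) => -[mm0 enm].
have ey : y ^+ 2 = short a b x by apply/eqP; rewrite -(on_short a b).
exists (4 * y ^+ 2 / (np * mm)) => /=.
  rewrite !mulf_neq0 ?invr_neq0 ?mulf_neq0 ?expf_neq0 //.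
  by rewrite (_ : (4 : k) = 2 * 2) ?mulf_neq0 //; ring.
rewrite /parA /parB /parC; split; first by ring.
  by rewrite mulr0 addr0 mulfVK ?mulf_neq0 // ey /short; ring.
rewrite enm.
have -> : b = y ^+ 2 - x ^+ 3 - a * x by rewrite ey /short; ring.
by field; rewrite y0 mm0 np0 two_neq0.
Qed.

Lemma xparG P Q x1 y1 x y np mp nm mm : x1 != x ->
  co P = Some (x1, y1) -> co Q = Some (x, y) ->
  x_is (P + Q) np mp -> x_is (P - Q) nm mm ->
  par_triple (parA x x1 1, parB x x1 1, parC x x1 1) np mp nm mm.
Proof.
move=> nx cP cQ; rewrite /x_is !coD coN cP cQ short_opp.
have onQ := co_on Q; have onN := co_on (- Q); have onP := co_on P.
rewrite cQ in onQ; rewrite coN cQ short_opp in onN; rewrite cP in onP.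
have {}nx : x - x1 != 0 by rewrite subr_eq0 eq_sym.
have ey : y ^+ 2 = short a b x by apply/eqP; rewrite -(on_short a b).
have ey1 : y1 ^+ 2 = short a b x1 by apply/eqP; rewrite -(on_short a b).
have mk v : v ^+ 2 = short a b x -> chord a ((v - y1) / (x - x1)) x1 y1 x v.
  move=> ev; split; first by rewrite mulfVK.
  apply: (mulfI nx); apply: (@etrans _ _ (v ^+ 2 - y1 ^+ 2)); first by field.
  by rewrite ev ey1 /short; ring.
rewrite (add_chord two_neq0 disc_neq0 onP onQ (mk _ ey)).
rewrite (add_chord two_neq0 disc_neq0 onP onN (mk (- y) _)) ?sqrrN //.
move=> -[mp0 enp] [mm0 enm].
have eb : b = y ^+ 2 - x ^+ 3 - a * x by rewrite ey /short; ring.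
have ea : a = (y1 ^+ 2 - y ^+ 2 - x1 ^+ 3 + x ^+ 3) / (x1 - x).
  rewrite ey ey1 /short; field; by rewrite -opprB oppr_eq0.
have nx' : x1 - x != 0 by rewrite -opprB oppr_eq0.
exists ((x1 - x) ^+ 2 / (mp * mm)) => /=.
  by rewrite mulf_neq0 ?invr_neq0 ?mulf_neq0 ?expf_neq0.
rewrite /parA /parB /parC enp enm eb ea.
by split; field; rewrite ?mp0 ?mm0 ?nx ?nx'.
Qed.

Lemma par_scale x n m e : (parA x (e * n) (e * m), parB x (e * n) (e * m), parC x (e * n) (e * m))
  = (e ^+ 2 * parA x n m, e ^+ 2 * parB x n m, e ^+ 2 * parC x n m).
Proof. by congr (_, _, _); rewrite /parA /parB /parC; ring. Qed.

(** Valid for all positions of P, including P = Q, P = - Q and the origin, because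
    projective abscissas are used. *)
Lemma xpar P Q x y n m np mp nm mm : co Q = Some (x, y) ->
  x_is P n m -> x_is (P + Q) np mp -> x_is (P - Q) nm mm ->
  par_triple (parA x n m, parB x n m, parC x n m) np mp nm mm.
Proof.
move=> cQ; rewrite {1}/x_is; case cP: (co P) => [[x1 y1]|]; last first.
  rewrite (co_none cP) add0r sub0r /x_is coN cQ short_opp => -[-> n0].
  case=> mp0 -> [mm0 ->]; exists (n ^+ 2 / (mp * mm)) => /=.
    by rewrite mulf_neq0 ?expf_neq0 ?invr_neq0 ?mulf_neq0.
  by rewrite /parA /parB /parC; split; field; rewrite mp0 mm0.
move=> [m0 ->] hp hm.
rewrite -[x1 * m]mulrC -{2 4 6}[m]mulr1 par_scale.
suff [c c0 [h1 h2 h3]] : par_triple (parA x x1 1, parB x x1 1, parC x x1 1) np mp nm mm.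
  exists (m ^+ 2 * c); first by rewrite mulf_neq0 ?expf_neq0.
  by move: h1 h2 h3 => /= -> -> ->; split; ring.
case: (eqVneq x1 x) => [ex|nx]; last exact: xparG nx cP cQ hp hm.
have onQ := co_on Q; have onP := co_on P; rewrite cQ in onQ; rewrite cP in onP.
have : y1 ^+ 2 == y ^+ 2.
  by move: onP onQ; rewrite !on_short ex => /eqP -> /eqP ->.
rewrite ex in cP *; rewrite eqf_sqr => /orP[] /eqP ey; rewrite ey in cP.
  have eP : P = Q by apply: co_inj; rewrite cP.
  rewrite eP in hp hm; apply: par_triple_sym; apply: (@xparN (- Q) x (- y)).
  - by rewrite coN cQ short_opp.
  - by rewrite opprK.
  - by rewrite !opprK.
have eP : P = - Q by apply: co_inj; rewrite cP coN cQ short_opp.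
by rewrite eP in hp hm; apply: xparN cQ hp hm.
Qed.

End Parallelogram.

(** * Pairs of polynomials and their heights *)

Section PolyFacts.
Variable k : closedFieldType.
Implicit Types p q r : {poly k}.

Lemma poly_ext p q : (forall x, p.[x] = q.[x]) -> p = q.
Proof.
move=> h; apply/eqP; rewrite -subr_eq0; apply: contraT => /closed_nonrootP[x].
by rewrite /root hornerD hornerN h subrr eqxx.
Qed.

(** Over an algebraically closed field a nonconstant gcd has a root. *)
Lemma coprimep_noroot p q :
  (forall x, p.[x] = 0 -> q.[x] = 0 -> False) -> coprimep p q.
Proof.
move=> h; rewrite coprimep_def; apply: contraT => /closed_rootP[x].
by rewrite root_gcd => /andP[/eqP/h + /eqP] => /[apply].
Qed.

Lemma coprimep_root2 p q x : coprimep p q -> p.[x] = 0 -> q.[x] = 0 -> False.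
Proof.
by move=> /coprimep_root h /eqP/h /[swap] -> /eqP.
Qed.

(** Two proportional triples of polynomials, each without common zero, differ by a
    constant: A divides A R, B R and C R, hence R times the gcd of A, B, C, and
    symmetrically R divides A. *)
Lemma proportional_poly (A B C R S T : {poly k}) : A != 0 ->
  A * S = B * R -> A * T = C * R ->
  (forall x, A.[x] = 0 -> B.[x] = 0 -> C.[x] = 0 -> False) ->
  (forall x, R.[x] = 0 -> S.[x] = 0 -> T.[x] = 0 -> False) ->
  exists2 c : k, c != 0 & [/\ A = c *: R, B = c *: S & C = c *: T].
Proof.
have cop U V Z : (forall x, U.[x] = 0 -> V.[x] = 0 -> Z.[x] = 0 -> False) ->
    forall D E : {poly k}, E %| U * D -> E %| V * D -> E %| Z * D -> E %| D.
  move=> h D E h1 h2 h3.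
  have : gcdp U (gcdp V Z) %= 1.
    rewrite -size_poly_eq1; apply: contraT => /closed_rootP[x].
    by rewrite !root_gcd => /and3P[/eqP + /eqP + /eqP] => /h/[apply]/[apply].
  move=> e; have : E %| gcdp (U * D) (gcdp (V * D) (Z * D)) by rewrite !dvdp_gcd h1 h2 h3.
  have e1 : gcdp (V * D) (Z * D) %= gcdp V Z * D by apply: gcdp_mul2r.
  rewrite (eqp_dvdr _ (eqp_gcdr _ e1)) (eqp_dvdr _ (gcdp_mul2r _ _ _)).
  by rewrite (eqp_dvdr _ (eqp_mulr _ e)) mul1r.
move=> A0 e1 e2 nABC nRST.
have d1 : A %| R.
  by apply: (cop _ _ _ nABC); [apply: dvdp_mulr | rewrite -e1 dvdp_mulr | rewrite -e2 dvdp_mulr].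
have d2 : R %| A.
  apply: (cop _ _ _ nRST); first exact: dvdp_mulr.
    by rewrite mulrC e1 dvdp_mull.
  by rewrite mulrC e2 dvdp_mull.
have /eqpf_eq[c c0 eA] : A %= R by rewrite /eqp d1 d2.
have R0 : R != 0 by apply: contraNneq A0 => R0; rewrite eA R0 scaler0.
exists c => //; split=> //; apply: (mulIf R0).
  by rewrite -e1 eA -!scalerAl mulrC.
by rewrite -e2 eA -!scalerAl mulrC.
Qed.

(** The degree of the rational function p/q, for coprime p and q. *)
Definition height (d : nat) p q :=
  [/\ (size p <= d.+1)%N, (size q <= d.+1)%N & (p`_d != 0) || (q`_d != 0)].

Lemma coefM_top d e p q : (size p <= d.+1)%N -> (size q <= e.+1)%N ->
  (p * q)`_(d + e)%N = p`_d * q`_e /\ (size (p * q)%R <= (d + e).+1)%N.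
Proof.
move=> hp hq; split.
  rewrite coefM (bigD1 (inord d)) //= inordK ?ltnS ?leq_addr // addKn.
  rewrite big1 ?addr0 // => i; rewrite -val_eqE /= inordK ?ltnS ?leq_addr // => ni.
  case: (ltnP d i) => hi.
    by rewrite nth_default ?mul0r //; apply: leq_trans hp _.
  by rewrite [q`_ _]nth_default ?mulr0 //; apply: leq_trans hq _; lia.
by apply: leq_trans (size_polyMleq _ _) _; lia.
Qed.

Lemma height_uniq d e (A B C R S T : {poly k}) (c : k) :
  c != 0 -> A = c *: R -> B = c *: S -> C = c *: T ->
  (size A <= d.+1)%N -> (size B <= d.+1)%N -> (size C <= d.+1)%N ->
  [|| A`_d != 0, B`_d != 0 | C`_d != 0] ->
  (size R <= e.+1)%N -> (size S <= e.+1)%N -> (size T <= e.+1)%N ->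
  [|| R`_e != 0, S`_e != 0 | T`_e != 0] -> d = e.
Proof.
move=> c0 -> -> ->; rewrite !size_scale // !coefZ !mulf_eq0 !(negbTE c0) /=.
move=> h1 h2 h3 n1 g1 g2 g3 n2; apply/eqP; rewrite eqn_leq; apply/andP; split.
  by rewrite leqNgt; apply/negP => lt; move: n1; rewrite !nth_default ?eqxx //; apply: leq_trans lt.
by rewrite leqNgt; apply/negP => lt; move: n2; rewrite !nth_default ?eqxx //; apply: leq_trans lt.
Qed.

(** Top coefficients of the product of two linear forms, a kind of Gauss lemma at
    infinity: they cannot all vanish. *)
Lemma height_mul d e p q r s : height d p q -> height e r s ->
  [/\ (size (q * s)%R <= (d + e).+1)%N, (size (p * s + r * q)%R <= (d + e).+1)%N,
      (size (p * r)%R <= (d + e).+1)%N &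
      [|| (q * s)`_(d + e)%N != 0, (p * s + r * q)`_(d + e)%N != 0
        | (p * r)`_(d + e)%N != 0]].
Proof.
move=> [hp hq n1] [hr hs n2].
have [c1 s1] := coefM_top hq hs; have [c2 s2] := coefM_top hp hs.
have [c3 s3] := coefM_top hq hr; have [c4 s4] := coefM_top hp hr.
split=> //.
  apply: leq_trans (size_polyD _ _) _.
  by rewrite geq_max s2 mulrC s3.
rewrite coefD (mulrC r) c1 c2 c3 c4.
case: (eqVneq p`_d 0) n1 => [->|np]; case: (eqVneq q`_d 0) => [->|nq] //= _;
  case: (eqVneq r`_e 0) n2 => [->|nr]; case: (eqVneq s`_e 0) => [->|ns] //= _;
  by rewrite ?(mulf_neq0 np nr) ?(mulf_neq0 nq ns) ?(mulf_neq0 np ns) ?(mulf_neq0 nq nr)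
   ?(mul0r, mulr0, add0r, addr0) ?(mulf_neq0 np ns) ?(mulf_neq0 nq nr) ?orbT.
Qed.

Variables (a b : k).
(** The forms parA, parB, parC with the abscissa itself as a variable, for
    Q = P. *)
Definition polA (N M : {poly k}) := (N - 'X * M) ^+ 2.
Definition polB (N M : {poly k}) :=
  2%:P * ((N + 'X * M) * (a%:P * M + 'X * N) + (2 * b)%:P * M ^+ 2).
Definition polC (N M : {poly k}) := ('X * N - a%:P * M) ^+ 2 - (4 * b)%:P * ((N + 'X * M) * M).

Lemma pol_eval N M x : [/\ (polA N M).[x] = parA x N.[x] M.[x],
  (polB N M).[x] = parB a b x N.[x] M.[x] & (polC N M).[x] = parC a b x N.[x] M.[x]].
Proof.
rewrite /polA /polB /polC /parA /parB /parC.
by split; rewrite !(hornerE, horner_exp) //; ring.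
Qed.

(** If n0, m0 are the coefficients of degree d of N and M, those of degree 2d + 2 of
    the three polynomials are m0^2, 2 m0 n0 and n0^2. *)
Lemma pol_height d N M : (2 : k) != 0 -> height d N M ->
  [/\ (size (polA N M) <= (d.+1 + d.+1).+1)%N, (size (polB N M) <= (d.+1 + d.+1).+1)%N,
      (size (polC N M) <= (d.+1 + d.+1).+1)%N &
      [|| (polA N M)`_(d.+1 + d.+1)%N != 0, (polB N M)`_(d.+1 + d.+1)%N != 0
        | (polC N M)`_(d.+1 + d.+1)%N != 0]].
Proof.
move=> two [hN hM n].
have topD e p q : (size p <= e.+1)%N -> (size q <= e.+1)%N ->
    (size (p + q)%R <= e.+1)%N.
  by move=> hp hq; apply: leq_trans (size_polyD _ _) _; rewrite geq_max hp.
have topC e (c : k) p : (size p <= e.+1)%N -> (size (c%:P * p)%R <= e.+1)%N.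
  by move=> hp; rewrite mul_polyC; apply: leq_trans (size_scale_leq _ _) _.
have hX : (size ('X : {poly k}) <= 2)%N by rewrite size_polyX.
have w p : (size p <= d.+1)%N -> (size p <= d.+2)%N by move/leq_trans; apply.
have [cN sN] := coefM_top hX hN; have [cM sM] := coefM_top hX hM.
rewrite add1n !coefX /= mul1r in cN sN; rewrite add1n !coefX /= mul1r in cM sM.
have z p : (size p <= d.+1)%N -> p`_d.+1 = 0 by move=> hp; rewrite nth_default.
pose U : {poly k} := N - 'X * M; pose V : {poly k} := N + 'X * M.
pose V' : {poly k} := a%:P * M + 'X * N; pose U' : {poly k} := 'X * N - a%:P * M.
have sU : (size U <= d.+2)%N by apply: topD; rewrite ?size_polyN //; apply: w.
have sV : (size V <= d.+2)%N by apply: topD => //; apply: w.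
have sV' : (size V' <= d.+2)%N by apply: topD => //; apply: topC; apply: w.
have sU' : (size U' <= d.+2)%N by apply: topD => //; rewrite size_polyN; apply: topC; apply: w.
have [cA sA] := coefM_top sU sU; have [cB sB] := coefM_top sV sV'.
have [cC sC] := coefM_top sU' sU'; have [cV sVM] := coefM_top sV hM.
have [cMM sMM] := coefM_top hM hM.
have bound p e : (size p <= e.+1)%N -> (e < d.+1 + d.+1)%N ->
    (size p <= (d.+1 + d.+1).+1)%N /\ p`_(d.+1 + d.+1)%N = 0.
  move=> hp he; split; first by apply: leq_trans hp _; lia.
  by rewrite nth_default //; apply: leq_trans hp _; lia.
have [|sV2 cV2] := bound _ _ sVM; first by lia.
have [|sM2 cM2] := bound _ _ sMM; first by lia.
have eC : polC N M = U' * U' + (- (4 * b))%:P * (V * M) by rewrite /polC /U' /V polyCN; ring.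
have eB : polB N M = 2%:P * (V * V' + (2 * b)%:P * (M * M)) by rewrite /polB /V /V'; ring.
have eA : polA N M = U * U by rewrite /polA /U; ring.
rewrite eA eB eC; split=> //.
- by apply/topC/topD => //; apply: topC.
- by apply: topD => //; apply: topC.
rewrite !(coefD, coefCM) cA cB cC cV2 cM2 !(coefD, coefN, coefCM) cN cM !z //.
rewrite !(mulr0, addr0, add0r, subr0).
by case/orP: n => n; rewrite ?(mulf_neq0 n n) ?orbT // mulNr mulrN opprK (mulf_neq0 n n).
Qed.

End PolyFacts.

(** * Multiplication by n on abscissas *)

Section Multiplication.
Variables (k : closedFieldType) (a b : k).
Hypotheses (two_neq0 : (2 : k) != 0) (disc_neq0 : 4 * a ^+ 3 + 27 * b ^+ 2 != 0).
Notation W := (Weierstrass 0 0 0 a b).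
Variables (A : zmodType) (co : A -> option (k * k)).
Hypotheses (co_on : forall P, on_curve W (co P)) (co0 : co 0 = None)
  (coN : forall P, co (- P) = raw_opp W (co P))
  (coD : forall P Q, co (P + Q) = raw_add W (co P) (co Q))
  (co_inj : injective co)
  (co_surj : forall R, on_curve W R -> exists P, co P = R).
Notation xis := (x_is co).

Lemma sqrt_ex (z : k) : exists y, y ^+ 2 = z.
Proof.
have [y] := solve_monicpoly (fun i => if i == 0%N then z else 0) (isT : 0 < 2)%N.
by rewrite big_ord_recr big_ord1 /= mulr1 mul0r addr0 => ?; exists y.
Qed.

Lemma point_above x : exists P y, co P = Some (x, y).
Proof.
have [y ey] := sqrt_ex (short a b x).
have [|P eP] := co_surj (R := Some (x, y)); first by rewrite on_short ey.
by exists P, y.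
Qed.

(** The abscissa of nP is (N(x) : M(x)) for every affine point P of abscissa x,
    those with nP = 0 included. *)
Definition mul_rep n (N M : {poly k}) :=
  coprimep N M /\ forall P x y, co P = Some (x, y) -> xis (P *+ n) N.[x] M.[x].

(** A common zero has x(nP) = x and is a root of x^3 + ax + b, which double_neq0
    excludes. *)
Lemma par_noroot N M x : coprimep N M ->
  (polA N M).[x] = 0 -> (polB a b N M).[x] = 0 -> (polC a b N M).[x] = 0 -> False.
Proof.
move=> cop; have [-> -> ->] := pol_eval a b N M x; rewrite /parA => /eqP.
rewrite expf_eq0 /= subr_eq0 => /eqP eN; rewrite /parB /parC eN => hB hC.
have M0 : M.[x] != 0.
  by apply/eqP => M0; apply: (coprimep_root2 cop _ M0); rewrite eN M0 mulr0.
have s0 : short a b x = 0.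
  have n4 : 4 * M.[x] ^+ 2 != 0.
    by rewrite (_ : (4 : k) = 2 * 2) ?mulf_neq0 ?expf_neq0 //; ring.
  by apply: (mulfI n4); rewrite mulr0 -[RHS]hB /short; ring.
have /eqP := double_neq0 disc_neq0 s0; apply; apply: (mulIf (expf_neq0 2 M0)).
by rewrite mul0r -[RHS]hC; ring.
Qed.

Lemma mul_rep1 : mul_rep 1 'X 1.
Proof.
split; first exact: coprimep1.
move=> P x y cP; rewrite /x_is mulr1n cP hornerX hornerC mulr1; split=> //.
exact: oner_neq0.
Qed.

Lemma height1 : height 1 ('X : {poly k}) 1.
Proof. by split; rewrite ?size_polyX ?size_polyC ?oner_neq0 // coefX oner_neq0. Qed.

(** For n = 1 the parallelogram law relates 2P and P - P = 0: the form polA is zero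
    and the abscissa of 2P is (polC : polB). *)
Lemma mul_rep2 : exists N M, mul_rep 2 N M /\ height 4 N M.
Proof.
have hev x := pol_eval a b 'X 1 x.
have A0 : polA ('X : {poly k}) 1 = 0 by rewrite /polA mulr1 subrr expr0n.
exists (polC a b 'X 1), (polB a b 'X 1); split; last first.
  have [_ hB hC] := pol_height a b two_neq0 height1.
  by rewrite A0 coef0 eqxx /= orbC => n; split.
split.
  apply: coprimep_noroot => x hC hB; apply: par_noroot hB hC; first exact: coprimep1.
  by rewrite A0 horner0.
move=> P x y cP; have [hA -> ->] := hev x; rewrite hornerX hornerC.
have [n [m h2]] := x_is_ex co (P + P).
have h1 : xis P x 1 by rewrite /x_is cP mulr1 oner_neq0.
have h0 : xis (P - P) 1 0 by rewrite /x_is subrr co0 oner_neq0.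
have [c c0 [_ /= -> ->]] := xpar two_neq0 disc_neq0 co_on co0 coN coD co_inj cP h1 h2 h0.
rewrite mulr2n; have := x_is_scale c0 h2.
by rewrite mulr0 add0r mul1r mulr1.
Qed.

(** (N : M) is a zero of the quadratic form with coefficients A0, B0, C0. *)
Lemma common_root (A0 B0 C0 N M : {poly k}) :
  (forall x, exists n m c, [/\ A0.[x] = c * (m * M.[x]),
      B0.[x] = c * (n * M.[x] + N.[x] * m) & C0.[x] = c * (n * N.[x])]) ->
  A0 * (N * N) - B0 * N * M + C0 * (M * M) = 0.
Proof.
move=> h; apply: poly_ext => x; have [n [m [c [e1 e2 e3]]]] := h x.
by rewrite !(hornerD, hornerN, hornerM, horner0) e1 e2 e3; ring.
Qed.

(** A binary quadratic form and one of its linear factors determine the other. *)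
Lemma cancel_form (c c' n m n1 m1 n2 m2 : k) : c != 0 -> ~ (n = 0 /\ m = 0) ->
  c * (m2 * m) = c' * (m1 * m) -> c * (n2 * m + n * m2) = c' * (n1 * m + n * m1) ->
  c * (n2 * n) = c' * (n1 * n) -> n2 = c' / c * n1 /\ m2 = c' / c * m1.
Proof.
move=> c0 nz f1 f2 f3.
have sol t u v : t != 0 -> c * (v * t) = c' * (u * t) -> v = c' / c * u.
  by move=> t0 e; apply: (mulfI c0); apply: (mulIf t0); rewrite -mulrA e; field.
case: (eqVneq m 0) => [m0|m0]; last first.
  have em := sol _ _ _ m0 f1; split=> //; apply: (sol _ _ _ m0).
  by rewrite em in f2; apply: (eq_of_diff f2); field.
have n0 : n != 0 by apply/eqP => n0; case: nz.
split; first exact: sol n0 f3.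
by apply: (sol _ _ _ n0); rewrite m0 in f2; apply: (eq_of_diff f2); ring.
Qed.

(** The parallelogram law for (n+1)P and P expresses (n+2)P by nP.  The products
    formed from the reduced pairs of nP and (n+2)P have no common zero, nor have
    polA, polB, polC, so the two triples agree up to a constant; this gives the
    validity at all points and the relation between the degrees. *)
Lemma mul_rep_step n d d' N M N' M' : (0 < d)%N -> (1 < d')%N ->
  mul_rep n N' M' -> height d N' M' -> mul_rep n.+1 N M -> height d' N M ->
  exists N2 M2, mul_rep n.+2 N2 M2 /\ forall e, height e N2 M2 -> (e + d = d'.+1 + d'.+1)%N.
Proof.
move=> d0 d1 [cop' r'] h' [cop r] h.
have M'0 : M' != 0.
  apply/eqP => M0; rewrite M0 coprimep0 -size_poly_eq1 in cop'.
  case: h' => _ _; rewrite M0 coef0 eqxx orbF nth_default ?eqxx // (eqP cop').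
  exact: d0.
have A0 : polA N M != 0.
  rewrite expf_neq0 // subr_eq0; apply/eqP => eN.
  have dM : M %| N by rewrite eN dvdp_mull.
  have sM : size M == 1%N.
    move: cop; rewrite -dvdp1 coprimep_def size_poly_eq1 => /eqp_dvdr <-.
    by rewrite dvdp_gcd dM dvdpp.
  move/eqP: sM => sM.
  have sN : (size N <= 2)%N by rewrite eN; apply: leq_trans (size_polyMleq _ _) _; rewrite size_polyX sM.
  case: h => _ _; rewrite !nth_default ?eqxx ?sM //; first exact: ltnW.
  exact: leq_trans sN _.
(* the sum of the two abscissas is B / A, so x((n+2)P) = B / A - N' / M' *)
pose num := polB a b N M * M' - polA N M * N'; pose den := polA N M * M'.
have den0 : den != 0 by rewrite mulf_neq0.
pose g := gcdp num den; pose N2 := num %/ g; pose M2 := den %/ g.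
have g0 : g != 0 by rewrite gcdp_eq0 negb_and den0 orbT.
have eN : N2 * g = num by rewrite divpK ?dvdp_gcdl.
have eM : M2 * g = den by rewrite divpK ?dvdp_gcdr.
have cop2 : coprimep N2 M2 by apply: coprimep_div_gcd; rewrite den0 orbT.
have pt x0 : exists P y np mp c, [/\ co P = Some (x0, y), c != 0,
    xis (P *+ n.+2) np mp &
  [/\ (polA N M).[x0] = c * (mp * M'.[x0]),
      (polB a b N M).[x0] = c * (np * M'.[x0] + N'.[x0] * mp) &
      (polC a b N M).[x0] = c * (np * N'.[x0])]].
  have [P [y cP]] := point_above x0; have [np [mp hp]] := x_is_ex co (P *+ n.+2).
  have hm := r' P x0 y cP; have hn := r P x0 y cP.
  have hp2 : xis (P *+ n.+1 + P) np mp by rewrite -mulrSr.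
  have hm2 : xis (P *+ n.+1 - P) N'.[x0] M'.[x0] by rewrite mulrSr addrK.
  have [c c0 e] := xpar two_neq0 disc_neq0 co_on co0 coN coD co_inj cP hn hp2 hm2.
  exists P, y, np, mp, c; split=> //.
  by have [-> -> ->] := pol_eval a b N M x0.
have eAS : polA N M * (N2 * M' + N' * M2) = polB a b N M * (M2 * M').
  apply: (mulIf g0).
  have -> : polA N M * (N2 * M' + N' * M2) * g
     = polA N M * ((N2 * g) * M' + N' * (M2 * g)) by ring.
  have -> : polB a b N M * (M2 * M') * g = polB a b N M * ((M2 * g) * M') by ring.
  by rewrite eN eM /num /den; ring.
have key : polA N M * (N' * N') - polB a b N M * N' * M' + polC a b N M * (M' * M') = 0.
  apply: common_root => x0; have [P [y [np [mp [c [_ _ _ h2]]]]]] := pt x0.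
  by exists np, mp, c.
have eAT : polA N M * (N2 * N') = polC a b N M * (M2 * M').
  apply: (mulIf g0).
  have -> : polA N M * (N2 * N') * g = polA N M * ((N2 * g) * N') by ring.
  have -> : polC a b N M * (M2 * M') * g = polC a b N M * ((M2 * g) * M') by ring.
  rewrite eN eM /num /den; apply: (eq_of_diff (congr1 ( *%R (- polA N M)) key)); ring.
have nR x : (M2 * M').[x] = 0 -> (N2 * M' + N' * M2).[x] = 0 -> (N2 * N').[x] = 0 -> False.
  rewrite !hornerE => h1 h2 h3.
  have c1 := coprimep_root2 cop2; have c2 := coprimep_root2 cop'.
  move/eqP: h1; rewrite mulf_eq0 => /orP[] /eqP h1; move: h2; rewrite h1 !(mulr0, addr0, add0r).
    move/eqP; rewrite mulf_eq0 => /orP[] /eqP h2; first exact: (c1 x).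
    have N0 : N'.[x] != 0 by apply/eqP => N0; apply: (c2 x).
    by move/eqP: h3; rewrite mulf_eq0 (negbTE N0) orbF => /eqP h3; apply: (c1 x).
  move/eqP; rewrite mulf_eq0 => /orP[] /eqP h2; first exact: (c2 x).
  have N0 : N2.[x] != 0 by apply/eqP => N0; apply: (c1 x).
  by move/eqP: h3; rewrite mulf_eq0 (negbTE N0) => /eqP h3; apply: (c2 x).
have [c c0 [eA eB eC]] := proportional_poly A0 eAS eAT (fun x => par_noroot cop) nR.
exists N2, M2; split; last first.
  move=> e he; have [h1 h2 h3 h4] := height_mul he h'.
  have [g1 g2 g3 g4] := pol_height a b two_neq0 h.
  by rewrite -(height_uniq c0 eA eB eC g1 g2 g3 g4 h1 h2 h3 h4).
split=> // P x y cP; have [np [mp hp]] := x_is_ex co (P *+ n.+2).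
have hm := r' P x y cP; have hn := r P x y cP.
have hp2 : xis (P *+ n.+1 + P) np mp by rewrite -mulrSr.
have hm2 : xis (P *+ n.+1 - P) N'.[x] M'.[x] by rewrite mulrSr addrK.
have [c' c'0] := xpar two_neq0 disc_neq0 co_on co0 coN coD co_inj cP hn hp2 hm2.
rewrite /=; have [<- <- <-] := pol_eval a b N M x.
rewrite eA eB eC !(hornerZ, hornerD, hornerM) => -[f1 f2 f3].
have e0 : c' / c != 0 by rewrite mulf_neq0 ?invr_neq0.
have [-> ->] := cancel_form c0 (x_is_neq0 hm) f1 f2 f3.
exact: x_is_scale e0 hp.
Qed.

Lemma height_ex (N M : {poly k}) : coprimep N M -> exists d, height d N M.
Proof.
move=> cop; have nz : (0 < maxn (size N) (size M))%N.
  rewrite leq_max !size_poly_gt0; apply: contraT; rewrite negb_or !negbK => /andP[/eqP N0 /eqP M0].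
  by move: cop; rewrite N0 M0 coprimep0 eqp01.
exists (maxn (size N) (size M)).-1; split; rewrite ?prednK ?leq_maxl ?leq_maxr //.
case: (leqP (size N) (size M)) nz => [h|/ltnW h] nz.
  by apply/orP; right; rewrite -lead_coefE lead_coef_eq0 -size_poly_gt0.
by apply/orP; left; rewrite -lead_coefE lead_coef_eq0 -size_poly_gt0.
Qed.

(** d(n+2) = 2 d(n+1) + 2 - d(n) with d(1) = 1 and d(2) = 4 has solution n^2. *)
Lemma mul_rep_ex n : (0 < n)%N -> exists N M, mul_rep n N M /\ height (n ^ 2) N M.
Proof.
case: n => // n _.
suff [] : (exists N M, mul_rep n.+1 N M /\ height (n.+1 ^ 2) N M) /\
          (exists N M, mul_rep n.+2 N M /\ height (n.+2 ^ 2) N M) by [].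
elim: n => [|n [[N' [M' [r' h']]] [N [M [r h]]]]].
  by split; [exists 'X, 1; split; [apply: mul_rep1 | apply: height1] | exact: mul_rep2].
split; first by exists N, M.
have [||N2 [M2 [r2 e2]]] := mul_rep_step _ _ r' h' r h; rewrite ?expn_gt0 //.
exists N2, M2; split=> //; have [e he] := height_ex r2.1.
suff -> : (n.+3 ^ 2)%N = e by [].
by move: (e2 _ he); rewrite -!mulnn; lia.
Qed.

End Multiplication.

(** * Torsion points *)

Section CharZero.
Variables (k : closedFieldType).
Hypothesis char0 : [pchar k] =i pred0.

Lemma natr_neq0 n : (n.+1%:R : k) != 0.
Proof. by rewrite ((pcharf0P k).1 char0). Qed.

Lemma deriv0_const (p : {poly k}) : p^`() = 0 -> (size p <= 1)%N.
Proof.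
move=> h; apply/leq_sizeP => -[//|i] _.
have := congr1 (fun q : {poly k} => q`_i) h; rewrite coef_deriv coef0 => /eqP.
by rewrite -mulr_natl mulf_eq0 (negbTE (natr_neq0 _)) => /eqP.
Qed.

Lemma ex_notin (s : seq k) : exists t, t \notin s.
Proof.
have : \prod_(z <- s) ('X - z%:P) != 0 by apply: monic_neq0; apply: monic_prod_XsubC.
by move=> /closed_nonrootP[t]; rewrite root_prod_XsubC; exists t.
Qed.

Lemma dvdp_deriv (p q : {poly k}) : coprimep p q -> p %| q * p^`() -> (size p <= 1)%N.
Proof.
move=> cop; rewrite Gauss_dvdpr // => d; case: (eqVneq p^`() 0) => [/deriv0_const //|n].
have p0 : p != 0 by apply: contraNneq n => ->; rewrite deriv0.
have := dvdp_leq n d; rewrite leqNgt => /negP[]; exact: lt_size_deriv.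
Qed.

(** In characteristic 0 a nonconstant rational function has nonzero derivative: from
    N prime times M = N times M prime, each of N and M divides its own
    derivative. *)
Lemma wronskian_neq0 d (N M : {poly k}) : (0 < d)%N -> coprimep N M -> height d N M ->
  N^`() * M - N * M^`() != 0.
Proof.
move=> d0 cop [_ _]; apply: contraTneq => /eqP; rewrite subr_eq0 => /eqP e.
have sN : (size N <= 1)%N by apply: (dvdp_deriv cop); rewrite mulrC e dvdp_mulr.
have sM : (size M <= 1)%N.
  by apply: (@dvdp_deriv _ N); rewrite 1?coprimep_sym // -e dvdp_mull.
by rewrite !nth_default ?eqxx //; apply: leq_trans d0.
Qed.

(** A multiple root of N - t M is a zero of the Wronskian, so t is one of finitely
    many critical values. *)
Lemma generic_fibre d (N M : {poly k}) (bad : seq k) :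
  (0 < d)%N -> coprimep N M -> height d N M ->
  exists t (rt : seq k), [/\ t \notin bad, uniq rt, size rt = d &
    forall x, (x \in rt) = (N.[x] == t * M.[x])].
Proof.
move=> d0 cop h; have w0 := wronskian_neq0 d0 cop h.
have [rs ers] := closed_field_poly_normal (N^`() * M - N * M^`()).
(* excluded values of t: the one lowering the degree of N - t M, the bad ones,
   and the critical values of N / M *)
have [t] := ex_notin (N`_d / M`_d :: bad ++ [seq N.[r] / M.[r] | r <- rs]).
rewrite in_cons mem_cat !negb_or => /and3P[nt ntb ntr].
pose p := N - t *: M.
have [hN hM n] := h.
have pd : p`_d != 0.
  rewrite coefB coefZ subr_eq0; apply: contra nt => /eqP e.
  case: (eqVneq M`_d 0) n => [m0|m0 _]; last by rewrite e mulfK.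
  by rewrite e m0 mulr0 eqxx.
have sp : size p = d.+1.
  apply/eqP; rewrite eqn_leq; apply/andP; split; last first.
    by rewrite ltnNge; apply: contra pd => hp; rewrite nth_default.
  apply: leq_trans (size_polyD _ _) _; rewrite size_polyN geq_max hN.
  exact: leq_trans (size_scale_leq _ _) hM.
have p0 : p != 0 by rewrite -size_poly_gt0 sp.
have [rt ert] := closed_field_poly_normal p.
have l0 : lead_coef p != 0 by rewrite lead_coef_eq0.
have cpp : coprimep p p^`().
  apply: coprimep_noroot => x; rewrite /p derivB derivZ !(hornerD, hornerN, hornerZ).
  move=> /eqP; rewrite subr_eq0 => /eqP e1 /eqP; rewrite subr_eq0 => /eqP e2.
  have M0 : M.[x] != 0.
    by apply/eqP => M0; apply: (coprimep_root2 cop _ M0); rewrite e1 M0 mulr0.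
  have : x \in rs.
    rewrite -root_prod_XsubC -(rootZ _ _ (a := lead_coef (N^`() * M - N * M^`()))).
      by rewrite -ers /root !(hornerD, hornerN, hornerM) e1 e2; apply/eqP; ring.
    by rewrite lead_coef_eq0.
  by move=> xrs; case/mapP: ntr; exists x => //; rewrite e1 mulfK.
exists t, rt; split=> //.
- rewrite -separable_prod_XsubC unlock; move: cpp; rewrite {1 2}ert derivZ.
  by rewrite coprimepZl // coprimepZr.
- by apply: succn_inj; rewrite -sp ert size_scale // size_prod_XsubC.
- move=> x; rewrite -root_prod_XsubC -(rootZ _ _ l0) -ert /root /p.
  by rewrite hornerD hornerN hornerZ subr_eq0.
Qed.

End CharZero.

Section Torsion.
Variables (k : closedFieldType) (a b : k).
Hypothesis char0 : [pchar k] =i pred0.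
Hypotheses (two_neq0 : (2 : k) != 0) (disc_neq0 : 4 * a ^+ 3 + 27 * b ^+ 2 != 0).
Notation W := (Weierstrass 0 0 0 a b).
Variables (A : zmodType) (co : A -> option (k * k)).
Hypotheses (co_on : forall P, on_curve W (co P)) (co0 : co 0 = None)
  (coN : forall P, co (- P) = raw_opp W (co P))
  (coD : forall P Q, co (P + Q) = raw_add W (co P) (co Q))
  (co_inj : injective co)
  (co_surj : forall R, on_curve W R -> exists P, co P = R).
Notation xis := (x_is co).
Notation rep := (mul_rep co).

Lemma same_x P Q x y y' : co P = Some (x, y) -> co Q = Some (x, y') -> P = Q \/ P = - Q.
Proof.
move=> cP cQ; have := co_on P; have := co_on Q; rewrite cP cQ !on_short => /eqP e1 /eqP e2.
have : y ^+ 2 == y' ^+ 2 by rewrite e1 e2.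
rewrite eqf_sqr => /orP[] /eqP ey; [left|right]; apply: co_inj.
  by rewrite cP cQ ey.
by rewrite coN cQ short_opp cP ey.
Qed.

(** Over a generic abscissa t = x(Q) there are n^2 abscissas x with N(x) = t M(x);
    above each of them exactly one of P and - P is sent to Q rather than to - Q. *)
Lemma torsion_count n : (0 < n)%N -> exists s : seq A,
  [/\ uniq s, size s = (n ^ 2)%N & forall P, (P \in s) = (P *+ n == 0)].
Proof.
move=> n0; have [N [M [[cop r] h]]] :=
  mul_rep_ex two_neq0 disc_neq0 co_on co0 coN coD co_inj co_surj n0.
pose D : {poly k} := 'X^3 + a *: 'X + b%:P.
have D0 : D != 0.
  apply/eqP => /(congr1 (fun q : {poly k} => q`_3)) /eqP.
  by rewrite !coefD coefXn coefZ coefX coefC coef0 /= mulr0 !addr0 oner_eq0.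
have [rD eD] := closed_field_poly_normal D.
have d0 : (0 < n ^ 2)%N by rewrite expn_gt0 n0.
(* avoiding the roots of x^3 + ax + b keeps Q away from the 2-torsion: Q <> - Q *)
have [t [rt [nt urt srt mrt]]] := generic_fibre char0 rD d0 cop h.
have [Q [s cQ]] := point_above co_surj t.
have s0 : s != 0.
  apply: contra nt => /eqP s0; have := co_on Q; rewrite cQ on_short s0 expr0n /= => /eqP e.
  rewrite -root_prod_XsubC -(rootZ _ _ (a := lead_coef D)) ?lead_coef_eq0 //.
  by rewrite -eD /root !(hornerD, hornerZ, hornerX, hornerXn, hornerC) -[_ + _]/(short a b t) -e.
have nQ : Q <> - Q.
  move/(congr1 co); rewrite coN cQ short_opp => -[] /eqP.
  by rewrite -subr_eq0 opprK -mulr2n -mulr_natl mulf_eq0 (negbTE two_neq0) (negbTE s0).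
have /choice[f hf] : forall x, exists P, x \in rt -> P *+ n = Q /\ exists y, co P = Some (x, y).
  move=> x; case: (boolP (x \in rt)) => [xrt|]; last by exists 0.
  have [P [y cP]] := point_above co_surj x; have := r P x y cP; rewrite mrt in xrt.
  rewrite (eqP xrt) /x_is; case cnP: (co (P *+ n)) => [[x' y']|]; last first.
    by move=> [M0]; rewrite M0 mulr0 eqxx.
  move=> [M0 /(mulIf M0) ex]; rewrite -ex in cnP.
  case: (same_x cnP cQ) => e; [exists P | exists (- P)] => _; split=> //; first by exists y.
    by rewrite mulNrn e opprK.
  by exists (- y); rewrite coN cP short_opp.
have mF P : (P \in [seq f x | x <- rt]) = (P *+ n == Q).
  apply/mapP/eqP => [[x xrt ->]|e]; first by case: (hf x xrt).
  case cP: (co P) => [[x y]|]; last first.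
    by case: nQ; rewrite -e (co_none co0 co_inj cP) mul0rn oppr0.
  have := r P x y cP; rewrite e /x_is cQ => -[M0 eN].
  have xrt : x \in rt by rewrite mrt eN.
  exists x => //; have [e1 [y' cf]] := hf x xrt.
  by case: (same_x cP cf) => // eP; case: nQ; rewrite -{1}e eP mulNrn e1.
case: rt urt srt mrt hf mF => [|x0 rt] urt srt mrt hf mF; first by rewrite -srt in d0.
(* the fibre of [n] over Q is a translate of its kernel *)
exists [seq P - f x0 | P <- [seq f x | x <- x0 :: rt]]; split.
- rewrite map_inj_uniq; last exact: addIr.
  rewrite map_inj_in_uniq // => x x' xrt xrt' e.
  have [_ [y cx]] := hf x xrt; have [_ [y' cx']] := hf x' xrt'.
  by rewrite -e cx in cx'; case: cx'.
- by rewrite !size_map.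
move=> P; rewrite -{1}[P](addrK (f x0)) (mem_map (f := fun R => R - f x0)); last exact: addIr.
rewrite mF mulrnDl; have [-> _] := hf x0 (mem_head _ _).
by rewrite -subr_eq0 addrK.
Qed.

(** At most two points share an abscissa. *)
Lemma torsion_x_bound p (q : {poly k}) : (0 < p)%N -> q != 0 ->
  (forall P x y, P *+ p = 0 -> co P = Some (x, y) -> root q x) ->
  (p ^ 2 <= (size q).-1.*2.+1)%N.
Proof.
move=> p0 q0 hq; have [s [us ss ms]] := torsion_count p0.
pose xc P := if co P is Some (x, _) then x else 0.
pose xs := undup [seq xc P | P <- s & P != 0].
have sx : (size xs < size q)%N.
  apply: max_poly_roots => //; last exact: undup_uniq.
  apply/allP => x; rewrite mem_undup => /mapP[P]; rewrite mem_filter ms => /andP[P0 /eqP Pp] ->.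
  rewrite /xc; case cP: (co P) => [[x' y]|]; first exact: hq cP.
  by rewrite (co_none co0 co_inj cP) eqxx in P0.
have /choice[f hf] : forall x, exists P, exists y, co P = Some (x, y) by exact: (point_above co_surj).
have /(uniq_leq_size us) : {subset s <= 0 :: [seq f x | x <- xs] ++ [seq - f x | x <- xs]}.
  move=> P Ps; rewrite in_cons mem_cat; case: eqVneq => //= P0.
  case cP: (co P) => [[x y]|]; last by rewrite (co_none co0 co_inj cP) eqxx in P0.
  have xxs : x \in xs.
    rewrite mem_undup; apply/mapP; exists P; first by rewrite mem_filter P0.
    by rewrite /xc cP.
  have [y' cf] := hf x; apply/orP.
  by case: (same_x cP cf) => ->; [left|right]; apply: map_f.
rewrite ss /= size_cat !size_map => le; apply: leq_trans le _.
by rewrite addnn ltnS leq_double -ltnS prednK //; apply: leq_ltn_trans sx.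
Qed.

(** If x(eP) = u x(P) on the p-torsion, then the abscissas of the p-torsion are
    roots of N - u x M, of degree at most e^2 + 1; with e <= p/2 this allows fewer
    than p^2 points.  For e = 1 the equation is (1 - u) x = 0. *)
Lemma mul_not_scaling p c (u : k) : prime p -> ~~ (p %| c)%N -> u != 1 ->
  ~ (forall P x y, P *+ p = 0 -> co P = Some (x, y) ->
       exists y', co (P *+ c) = Some (u * x, y')).
Proof.
move=> pp npc u1 h; have p0 := prime_gt0 pp; have p1 := prime_gt1 pp.
pose r := (c %% p)%N; have r0 : (0 < r)%N by rewrite lt0n.
have rp : (r < p)%N by rewrite ltn_mod.
(* as x(-P) = x(P), c may be replaced by e = min (c mod p, p - c mod p) <= p/2 *)
have [e [e0 e2 he]] : exists e, [/\ (0 < e)%N, (e.*2 <= p)%N &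
    forall P x y, P *+ p = 0 -> co P = Some (x, y) ->
       exists y', co (P *+ e) = Some (u * x, y')].
  have hr (P : A) : P *+ p = 0 -> P *+ c = P *+ r.
    move=> Pp; have -> : P *+ c = P *+ (p * (c %/ p) + r) by rewrite mulnC -divn_eq.
    by rewrite mulrnDr mulrnA Pp mul0rn add0r.
  case: (leqP r.*2 p) => [h2|h2].
    by exists r; split=> // P x y Pp cP; rewrite -hr //; apply: h cP.
  exists (p - r)%N; split; [lia | lia | move=> P x y Pp cP].
  have [y' cc] := h P x y Pp cP; exists (- y').
  by rewrite mulrnBr ?(ltnW rp) // Pp sub0r -hr // coN cc short_opp.
have bound N M : rep e N M -> N - u *: ('X * M) != 0 ->
    (p ^ 2 <= (size (N - u *: ('X * M))%R).-1.*2.+1)%N.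
  move=> [_ rNM] q0; apply: torsion_x_bound => // P x y Pp cP.
  have := rNM P x y cP; have [y' cc] := he P x y Pp cP; rewrite /x_is cc => -[_ eN].
  by rewrite /root !(hornerD, hornerN, hornerZ, hornerM, hornerX) eN; apply/eqP; ring.
case: (eqVneq e 1%N) => [e1|e1].
  have eX : 'X - u *: ('X * 1) = (1 - u) *: 'X by rewrite mulr1 scalerBl scale1r.
  have n1 : 1 - u != 0 by rewrite subr_eq0 eq_sym.
  have := bound 'X 1; rewrite e1 eX => /(_ (mul_rep1 co)).
  rewrite size_scale // size_polyX scaler_eq0 (negbTE n1) polyX_eq0 => /(_ isT).
  by rewrite -mulnn; case: p p1 {pp npc h rp r r0 p0 e2 he bound} => [|[|p]] //; lia.
have [N [M [[cop r'] [hN hM hd]]]] :=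
  mul_rep_ex two_neq0 disc_neq0 co_on co0 coN coD co_inj co_surj e0.
have q0 : N - u *: ('X * M) != 0.
  rewrite subr_eq0; apply/eqP => eN.
  have M1 : size M = 1%N.
    apply/eqP; move: cop; rewrite -dvdp1 coprimep_def size_poly_eq1 => /eqp_dvdr <-.
    by rewrite dvdp_gcd dvdpp andbT eN -mul_polyC !dvdp_mull.
  have N2 : (size N <= 2)%N.
    rewrite eN; apply: leq_trans (size_scale_leq _ _) _.
    by apply: leq_trans (size_polyMleq _ _) _; rewrite size_polyX M1.
  have e4 : (2 <= e ^ 2)%N by rewrite -mulnn; move: e0 e1; nia.
  by move: hd; rewrite !nth_default ?eqxx ?M1 ?(leq_trans N2) //; apply: leq_trans e4.
have := bound N M (conj cop r') q0.
have : (size (N - u *: ('X * M))%R <= (e ^ 2).+2)%N.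
  apply: leq_trans (size_polyD _ _) _; rewrite geq_max (leq_trans hN) // size_polyN.
  apply: leq_trans (size_scale_leq _ _) _; apply: leq_trans (size_polyMleq _ _) _.
  by rewrite size_polyX.
rewrite -!mulnn; nia.
Qed.

End Torsion.

(** * Functions on the affine curve and their poles *)

Section CoordinateRing.
Variables (k : closedFieldType) (a b : k).

(** A polynomial function on the affine curve is e(X) + f(X) Y in a unique way
    (ev_inj). *)
Definition ev (e f : {poly k}) (X Y : k) := e.[X] + f.[X] * Y.
Definition on_aff (X Y : k) := Y ^+ 2 = short a b X.
Definition short_poly : {poly k} := 'X^3 + (a *: 'X + b%:P).
Implicit Types (e f g : {poly k}) (u v : k -> k -> k).

Lemma short_polyE X : short_poly.[X] = short a b X.
Proof. by rewrite /short_poly !(hornerD, hornerZ, hornerX, hornerXn, hornerC) addrA. Qed.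

Lemma size_short_poly : size short_poly = 4%N.
Proof.
rewrite size_polyDl ?size_polyXn // ltnS; apply: leq_trans (size_polyD _ _) _.
rewrite geq_max (leq_trans (size_scale_leq _ _)) ?size_polyX //.
by rewrite (leq_trans (size_polyC_leq1 _)).
Qed.

Lemma ev_mul e f e' f' X Y : on_aff X Y ->
  ev e f X Y * ev e' f' X Y = ev (e * e' + f * f' * short_poly) (e * f' + f * e') X Y.
Proof.
move=> onP; rewrite /ev !(short_polyE, hornerD, hornerM) -onP; ring.
Qed.

Lemma ev_add e f e' f' X Y : ev e f X Y + ev e' f' X Y = ev (e + e') (f + f') X Y.
Proof. by rewrite /ev !hornerD; ring. Qed.

(** The norm of e + f Y over the polynomials in X; its degree is the order of the
    pole of e + f Y at infinity. *)
Definition norm_poly e f := e ^+ 2 - f ^+ 2 * short_poly.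

(** The two terms of the norm have degrees of different parity, so they never
    cancel. *)
Lemma size_norm_poly e f : size (norm_poly e f)
  = maxn (size e).*2.-1 (if f == 0 then 0%N else (size f).*2.+2).
Proof.
have sq (p : {poly k}) : size (p ^+ 2) = (size p).*2.-1.
  by rewrite expr2; case: (eqVneq p 0) => [->|p0]; rewrite ?mulr0 ?size_poly0 // size_mul // addnn.
rewrite /norm_poly; case: eqVneq => [->|f0]; first by rewrite expr0n mul0r subr0 sq maxn0.
have sf : size (f ^+ 2 * short_poly) = (size f).*2.+2.
  rewrite size_mul ?expf_neq0 // ?sq ?size_short_poly; last by rewrite -size_poly_gt0 size_short_poly.
  by have := size_poly_gt0 f; rewrite f0; lia.
case: (ltngtP (size (e ^+ 2)) (size (f ^+ 2 * short_poly))) => h.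
- rewrite addrC size_polyDl size_polyN //; rewrite sf sq in h *; lia.
- rewrite size_polyDl ?size_polyN //; rewrite sf sq in h *; lia.
- by rewrite sq sf in h; lia.
Qed.

Lemma norm_poly0 : norm_poly 0 0 = 0.
Proof. by rewrite /norm_poly expr0n mul0r subr0. Qed.

Lemma norm_poly_eq0 e f : norm_poly e f = 0 -> e = 0 /\ f = 0.
Proof.
move=> /(congr1 (fun p : {poly k} => size p)); rewrite size_norm_poly size_poly0.
case: (eqVneq f 0) => [->|_]; last by lia.
by rewrite maxn0 => h; split=> //; apply/eqP; rewrite -size_poly_leq0; lia.
Qed.

(** In particular u is nonzero; pole_le also allows zero. *)
Definition has_pole u n := exists e f,
  (forall X Y, on_aff X Y -> u X Y = ev e f X Y) /\ size (norm_poly e f) = n.+1.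

Definition pole_le u n := exists e f,
  (forall X Y, on_aff X Y -> u X Y = ev e f X Y) /\ (size (norm_poly e f) <= n.+1)%N.

Lemma has_pole_ext u v n : (forall X Y, on_aff X Y -> u X Y = v X Y) ->
  has_pole u n -> has_pole v n.
Proof.
by move=> E [e [f [h s]]]; exists e, f; split=> // X Y onP; rewrite -E // h.
Qed.

Lemma norm_poly_mul e f e' f' :
  norm_poly (e * e' + f * f' * short_poly) (e * f' + f * e') = norm_poly e f * norm_poly e' f'.
Proof. by rewrite /norm_poly; ring. Qed.

Lemma has_poleM u v n m : has_pole u n -> has_pole v m ->
  has_pole (fun X Y => u X Y * v X Y) (n + m).
Proof.
move=> [e [f [h1 s1]]] [e' [f' [h2 s2]]].
exists (e * e' + f * f' * short_poly), (e * f' + f * e'); split.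
  by move=> X Y onP; rewrite h1 // h2 // ev_mul.
rewrite norm_poly_mul size_mul -1?size_poly_gt0 ?s1 ?s2 //.
by rewrite addnS.
Qed.

Lemma max_weight (d e e' f f' : nat) : (d <= maxn e e')%N -> (e' <= e)%N ->
  (maxn e.*2.-1 f.*2.+2 < maxn e'.*2.-1 f'.*2.+2)%N -> (f < f')%N ->
  maxn d.*2.-1 f'.*2.+2 = maxn e'.*2.-1 f'.*2.+2.
Proof. lia. Qed.

Lemma max_weight' (d e e' f f' : nat) : (d <= maxn f f')%N -> (e < e')%N ->
  (maxn e.*2.-1 f.*2.+2 < maxn e'.*2.-1 f'.*2.+2)%N -> (f' <= f)%N ->
  maxn e'.*2.-1 d.*2.+2 = maxn e'.*2.-1 f'.*2.+2
  /\ maxn e'.*2.-1 0 = maxn e'.*2.-1 f'.*2.+2.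
Proof. lia. Qed.

Lemma has_poleD u v n m : (n < m)%N -> pole_le u n -> has_pole v m ->
  has_pole (fun X Y => u X Y + v X Y) m.
Proof.
move=> nm [e [f [h1 s1]]] [e' [f' [h2 s2]]]; exists (e + e'), (f + f'); split.
  by move=> X Y onP; rewrite h1 // h2 // ev_add.
have {nm s1} : (size (norm_poly e f) < size (norm_poly e' f'))%N by rewrite s2 ltnS (leq_trans s1).
rewrite -s2 !size_norm_poly.
case: (eqVneq f' 0) => [->|f'0]; case: (eqVneq f 0) => [->|f0];
 rewrite ?addr0 ?add0r ?eqxx ?(negbTE f0) ?(negbTE f'0).
- rewrite !maxn0 => lt; congr (_.*2.-1); rewrite addrC size_polyDl //; lia.
- rewrite ?maxn0 => lt; rewrite addrC size_polyDl; lia.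
- case: (ltnP (size e) (size e')) => hs lt; first by rewrite addrC size_polyDl.
  have := size_polyD e e'; lia.
have p f1 : f1 != 0 -> (0 < size f1)%N by rewrite size_poly_gt0.
have p1 := p _ f0; have p2 := p _ f'0.
have se : (size (e + e')%R <= maxn (size e) (size e'))%N := size_polyD e e'.
have sf : (size (f + f')%R <= maxn (size f) (size f'))%N := size_polyD f f'.
case: (ltnP (size e) (size e')) => he; case: (ltnP (size f) (size f')) => hf lt.
- have e1 : size (f + f') = size f' by rewrite addrC size_polyDl.
  have e2 : size (e + e') = size e' by rewrite addrC size_polyDl.
  by rewrite -size_poly_eq0 e1 e2 -[size f' == 0%N]negbK -lt0n p2.
- have e2 : size (e + e') = size e' by rewrite addrC size_polyDl.
  by have [h1' h2'] := max_weight' sf he lt hf; rewrite e2; case: ifP.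
- have e1 : size (f + f') = size f' by rewrite addrC size_polyDl.
  rewrite -size_poly_eq0 e1 -[size f' == 0%N]negbK -lt0n p2 /=.
  exact: max_weight se he lt hf.
- by lia.
Qed.

Lemma has_pole_le u n m : (n <= m)%N -> has_pole u n -> pole_le u m.
Proof. by move=> nm [e [f [h s]]]; exists e, f; rewrite s. Qed.

Lemma pole_const (c : k) : pole_le (fun _ _ => c) 0.
Proof.
exists c%:P, 0; split; first by move=> X Y _; rewrite /ev hornerC horner0 mul0r addr0.
by rewrite size_norm_poly eqxx maxn0; have := size_polyC_leq1 c; lia.
Qed.

Lemma has_pole_const (c : k) : c != 0 -> has_pole (fun _ _ => c) 0.
Proof.
move=> c0; exists c%:P, 0; split; first by move=> X Y _; rewrite /ev hornerC horner0 mul0r addr0.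
by rewrite size_norm_poly eqxx maxn0 size_polyC c0.
Qed.

(** By Horner evaluation, as each step multiplies by u and adds a constant. *)
Lemma has_pole_poly u n (s : {poly k}) : (0 < n)%N -> has_pole u n -> s != 0 ->
  has_pole (fun X Y => s.[u X Y]) (n * (size s).-1).
Proof.
move=> n0 hu; elim/poly_ind: s => [|s c IH]; first by rewrite eqxx.
case: (eqVneq s 0) => [->|s0] nz.
  rewrite mul0r add0r in nz *; rewrite size_polyC; have c0 : c != 0 by rewrite polyC_eq0 in nz.
  rewrite c0 muln0; apply: has_pole_ext (has_pole_const c0).
  by move=> X Y _; rewrite hornerC.
have es : (size (s * 'X + c%:P)).-1 = (size s).-1.+1.
  by rewrite size_MXaddC (negbTE s0) /= prednK // size_poly_gt0.
rewrite es mulnS addnC.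
apply: (@has_pole_ext (fun X Y => c + s.[u X Y] * u X Y)).
  by move=> X Y _; rewrite hornerMXaddC addrC.
apply: (has_poleD _ (pole_const c)); last exact: has_poleM (IH s0) hu.
by rewrite addn_gt0 n0 orbT.
Qed.

Hypothesis two_neq0 : (2 : k) != 0.

(** Both points (X, Y) and (X, - Y) above a generic X are on the curve, so e(X) and
    f(X) vanish for almost all X. *)
Lemma ev_eq0 e f x0 : (forall X Y, on_aff X Y -> X != x0 -> ev e f X Y = 0) ->
  e = 0 /\ f = 0.
Proof.
move=> h; have D0 : short_poly * ('X - x0%:P) != 0.
  by rewrite mulf_neq0 ?polyXsubC_eq0 // -size_poly_gt0 size_short_poly.
suff [h1 h2] : e * (short_poly * ('X - x0%:P)) = 0 /\ f * (short_poly * ('X - x0%:P)) = 0.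
  by split; apply: (mulIf D0); rewrite mul0r.
suff h' X : short_poly.[X] != 0 -> X != x0 -> e.[X] = 0 /\ f.[X] = 0.
  split; apply: poly_ext => X; rewrite !hornerM hornerXsubC horner0;
    case: (eqVneq short_poly.[X] 0) => [->|D]; rewrite ?mul0r ?mulr0 //;
    (case: (eqVneq X x0) => [->|n]; first by rewrite subrr !mulr0);
    by have [h1 h2] := h' X D n; rewrite ?h1 ?h2 mul0r.
move=> D nX; have [Y eY] := sqrt_ex short_poly.[X]; rewrite short_polyE in eY.
have h1 := h X Y eY nX; have h2 : ev e f X (- Y) = 0 by apply: h; rewrite // /on_aff sqrrN.
rewrite /ev in h1 h2.
have Y0 : Y != 0.
  by apply: contraNneq D => Y0; rewrite short_polyE -eY Y0 expr0n.
split.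
  apply: (mulfI two_neq0); rewrite mulr0; apply: (eq_of_diff (congr2 +%R h1 h2)); ring.
apply: (mulIf Y0); apply: (mulfI two_neq0); rewrite mul0r mulr0.
by apply: (eq_of_diff (congr2 (fun x y => x - y) h1 h2)); ring.
Qed.

Lemma ev_inj e f e' f' x0 :
  (forall X Y, on_aff X Y -> X != x0 -> ev e f X Y = ev e' f' X Y) -> e = e' /\ f = f'.
Proof.
move=> h; have [|/eqP h1 /eqP h2] := @ev_eq0 (e - e') (f - f') x0.
  move=> X Y onP n; have := h X Y onP n; rewrite /ev !(hornerD, hornerN) => E.
  by apply: (eq_of_diff E); ring.
by move: h1 h2; rewrite !subr_eq0 => /eqP -> /eqP ->.
Qed.

Lemma has_pole_uniq u n m : has_pole u n -> has_pole u m -> n = m.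
Proof.
move=> [e [f [h1 s1]]] [e' [f' [h2 s2]]]; apply: succn_inj; rewrite -s1 -s2.
have [|-> ->] // := @ev_inj e f e' f' 0.
by move=> X Y onP _; rewrite -h1 // h2.
Qed.

(** u is near each point a quotient of polynomial functions. *)
Definition regular u := forall X Y, on_aff X Y -> exists g0 g1 h0 h1,
  ev h0 h1 X Y != 0 /\
  forall X' Y', on_aff X' Y' -> u X' Y' * ev h0 h1 X' Y' = ev g0 g1 X' Y'.

(** A function regular at every affine point is a polynomial function.  Take a
    denominator n(X) of u; above a root of n the numerator e + f Y vanishes at both
    points, or at the ramified one to second order, because u is regular there.
    So e and f are divisible by the same linear factor and the degree of n drops. *)
Lemma regular_poly u : regular u ->
  exists e f, forall X Y, on_aff X Y -> u X Y = ev e f X Y.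
Proof.
move=> reg.
suff H m : forall (n : {poly k}) e f, (size n <= m)%N -> n != 0 ->
    (forall X Y, on_aff X Y -> n.[X] * u X Y = ev e f X Y) ->
    exists e f, forall X Y, on_aff X Y -> u X Y = ev e f X Y.
  (* a first common denominator in X alone: the norm of a local one *)
  have [Y0 onP] := sqrt_ex (short a b 0).
  have [g0 [g1 [h0 [h1 [nz hg]]]]] := reg 0 Y0 onP.
  have n0 : norm_poly h0 h1 != 0.
    by apply: contraNneq nz => /norm_poly_eq0[-> ->]; rewrite /ev !horner0 mul0r addr0.
  apply: (H _ (norm_poly h0 h1) (g0 * h0 + g1 * (- h1) * short_poly) (g0 * (- h1) + g1 * h0) (leqnn _) n0).
  move=> X Y onXY; rewrite -ev_mul // -hg // -mulrA ev_mul // mulrC; congr (_ * _).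
  rewrite /ev /norm_poly !(hornerD, hornerN, hornerM, horner_exp); ring.
elim: m => [|m IH] n e f; first by rewrite leqn0 size_poly_eq0 => /eqP ->; rewrite eqxx.
move=> sn n0 hn; case: (boolP (size n == 1%N)) => [/size_poly1P[c c0 en]|].
  exists (c^-1 *: e), (c^-1 *: f) => X Y onP; apply: (mulfI c0).
  have := hn X Y onP; rewrite en hornerC => ->; rewrite /ev !hornerZ.
  by field.
move=> /closed_rootP[x0 rx0].
have [y0 onP] := sqrt_ex (short a b x0).
have fact (p : {poly k}) : root p x0 -> exists p', p = p' * ('X - x0%:P) by move/factor_theorem.
(* the numerator vanishes at both points above the root x0 *)
have van Y : on_aff x0 Y -> e.[x0] + f.[x0] * Y = 0.
  by move=> onY; rewrite -[LHS](hn _ _ onY) (rootP rx0) mul0r.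
have e0 : root e x0.
  apply/rootP; apply: (mulfI two_neq0); rewrite mulr0.
  have onN : on_aff x0 (- y0) by rewrite /on_aff sqrrN.
  by apply: (eq_of_diff (congr2 +%R (van _ onP) (van _ onN))); ring.
have f0 : root f x0.
  apply/rootP; case: (eqVneq y0 0) => [y00|ny]; last first.
    by apply: (mulIf ny); rewrite mul0r -[RHS](van _ onP) (rootP e0) add0r.
  have [g0 [g1 [h0 [h1 [nz hg]]]]] := reg x0 y0 onP.
  have [_ h2] : n * g0 = e * h0 + f * h1 * short_poly /\ n * g1 = e * h1 + f * h0.
    apply: (@ev_inj _ _ _ _ x0) => X Y onXY _; rewrite -ev_mul // -hn // -mulrA hg //.
    by rewrite /ev !hornerM; ring.
  move/(congr1 (fun p : {poly k} => p.[x0])): h2.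
  rewrite !(hornerD, hornerM) (rootP rx0) (rootP e0) !mul0r add0r.
  move: nz; rewrite /ev y00 mulr0 addr0 => nz h2; apply: (mulIf nz).
  by rewrite mul0r -h2.
have [n' en] := fact _ rx0; have [e' ee] := fact _ e0; have [f' ef] := fact _ f0.
have gen X Y : on_aff X Y -> X != x0 -> n'.[X] * u X Y = ev e' f' X Y.
  move=> onXY nX; have nz : X - x0 != 0 by rewrite subr_eq0.
  apply: (mulIf nz); have := hn X Y onXY; rewrite en ee ef /ev !hornerM !hornerXsubC => E.
  by apply: (eq_of_diff E); ring.
have n'0 : n' != 0 by apply: contraNneq n0 => E; rewrite en E mul0r.
(* n' has smaller degree; at X = x0 the local expression of u takes over *)
apply: (IH n' e' f') => //.
  by move: sn; rewrite en size_mul ?polyXsubC_eq0 // size_XsubC addn2.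
move=> X Y onXY; have [g0 [g1 [h0 [h1 [nz hg]]]]] := reg X Y onXY.
have [h1' h2'] : n' * g0 = e' * h0 + f' * h1 * short_poly /\ n' * g1 = e' * h1 + f' * h0.
  apply: (@ev_inj _ _ _ _ x0) => X' Y' onXY' nX'; rewrite -ev_mul // -gen // -mulrA hg //.
  by rewrite /ev !hornerM; ring.
apply: (mulIf nz); rewrite -mulrA hg // ev_mul // -h1' -h2'.
by rewrite /ev !hornerM; ring.
Qed.

End CoordinateRing.

(** * Automorphisms fixing the origin *)

Section Rigidity.
Variables (k : closedFieldType) (a b : k).
Hypotheses (two_neq0 : (2 : k) != 0) (three_neq0 : (3 : k) != 0).
Notation on_aff := (on_aff a b).
Notation Dp := (short_poly a b).
Notation has_pole := (has_pole a b).
Notation pole_le := (pole_le a b).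
Notation norm_poly := (norm_poly a b).
Variables (u v : k -> k -> k) (u0 u1 v0 v1 s0 s1 t0 t1 : {poly k}).
Hypotheses (uE : forall X Y, on_aff X Y -> u X Y = ev u0 u1 X Y)
  (vE : forall X Y, on_aff X Y -> v X Y = ev v0 v1 X Y)
  (uv_on : forall X Y, on_aff X Y -> on_aff (u X Y) (v X Y))
  (sE : forall X Y, on_aff X Y -> ev s0 s1 (u X Y) (v X Y) = X)
  (tE : forall X Y, on_aff X Y -> ev t0 t1 (u X Y) (v X Y) = Y).

Lemma pole_zero w e f : (forall X Y, on_aff X Y -> w X Y = ev e f X Y) ->
  (forall X Y, on_aff X Y -> w X Y = 0) \/ exists n, has_pole w n.
Proof.
move=> h; have [/norm_poly_eq0[e0 f0]|n0] := eqVneq (norm_poly e f) 0; [left|right].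
  by move=> X Y onP; rewrite h // e0 f0 /ev !horner0 mul0r addr0.
exists (size (norm_poly e f)).-1, e, f; split=> //.
by rewrite prednK // size_poly_gt0.
Qed.

Lemma pole_zero_const w e f : (forall X Y, on_aff X Y -> w X Y = ev e f X Y) ->
  (exists c, forall X Y, on_aff X Y -> w X Y = c) \/ exists2 n, (0 < n)%N & has_pole w n.
Proof.
move=> h; case: (pole_zero h) => [h0|[[|n] hn]]; [by left; exists 0 | left | by right; exists n.+1].
case: hn => e' [f' [h' s]]; exists e'`_0 => X Y onP; rewrite h' //.
move: s; rewrite size_norm_poly; case: (eqVneq f' 0) => [->|nf]; last by lia.
rewrite maxn0 => s; rewrite /ev horner0 mul0r addr0.
have {}s : (size e' <= 1)%N by lia.
by rewrite {1}(size1_polyC s) hornerC.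
Qed.

Lemma not_const_X c : ~ forall X Y, on_aff X Y -> X = c.
Proof.
move=> h; have [y e] := sqrt_ex (short a b (c + 1)).
by have /eqP := h _ _ e; rewrite -subr_eq0 addrAC subrr add0r oner_eq0.
Qed.

(** v^2 = u^3 + au + b makes the pole orders of u and v proportional to 2 and 3. *)
Lemma u_pole : exists2 m, (0 < m)%N & has_pole u (2 * m) /\ has_pole v (3 * m).
Proof.
have v2E X Y : on_aff X Y -> v X Y * v X Y = u X Y ^+ 3 + a * u X Y + b.
  by move=> onP; rewrite -expr2; apply: uv_on.
case: (pole_zero_const uE) => [[c hc]|[n n0 hn]].
  have [d hd] : exists d, forall X Y, on_aff X Y -> v X Y = d.
    case: (pole_zero_const vE) => // -[q q0 hq].
    have h2 := has_poleM hq hq; set w := short a b c.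
    have h3 : has_pole (fun _ _ => w) (q + q).
      by apply: has_pole_ext h2 => X Y onP; rewrite v2E // hc.
    case: (eqVneq w 0) => w0.
      case: h3 => e [f [h3 s]]; have [|e0 f0] := @ev_eq0 _ a b two_neq0 e f 0.
        by move=> X Y onP _; rewrite -h3.
      by move: s; rewrite e0 f0 norm_poly0 size_poly0.
    have := has_pole_uniq two_neq0 h3 (has_pole_const a b w0); lia.
  by case: (@not_const_X (ev s0 s1 c d)) => X Y onP; rewrite -[LHS](sE onP) hc // hd.
have pX : pole_le (fun X Y => a * u X Y + b) n.
  case: (eqVneq a 0) => [a0|na].
    have [e [f [h s]]] := pole_const a b b; exists e, f; split; last exact: leq_trans s _.
    by move=> X Y onP; rewrite a0 mul0r add0r; apply: h.
  apply: (has_pole_le (leqnn n)).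
  apply: (has_pole_ext _ (has_poleD n0 (pole_const a b b) (has_poleM (has_pole_const a b na) hn))).
  by move=> X Y _; rewrite addrC.
have p3 : has_pole (fun X Y => v X Y * v X Y) (n + (n + n)).
  have := has_poleD (_ : n < n + (n + n))%N pX (has_poleM hn (has_poleM hn hn)).
  move=> /(_ _) hh; apply: has_pole_ext (hh _); last by lia.
  by move=> X Y onP; rewrite v2E //; ring.
case: (pole_zero vE) => [hv|[q hq]].
  have [e [f [h s]]] := p3; have [|e0 f0] := @ev_eq0 _ a b two_neq0 e f 0.
    by move=> X Y onP _; rewrite -h // hv ?mul0r.
  by move: s; rewrite e0 f0 norm_poly0 size_poly0.
have e := has_pole_uniq two_neq0 p3 (has_poleM hq hq).
exists (q - n)%N; first by lia.
by split; [move: hn | move: hq]; congr has_pole; lia.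
Qed.

(** The nonzero functions in the ring generated by u and v have pole orders divisible by m. *)
Lemma image_pole m s t n : (0 < m)%N -> has_pole u (2 * m) -> has_pole v (3 * m) ->
  has_pole (fun X Y => ev s t (u X Y) (v X Y)) n -> exists c, n = (m * c)%N.
Proof.
move=> m0 hu hv hn; have m2 : (0 < 2 * m)%N by rewrite muln_gt0.
case: (eqVneq t 0) => [tz|nt].
  case: (eqVneq s 0) => [z0|ns].
    have [e [f [h s']]] := hn; have [|e0 f0] := @ev_eq0 _ a b two_neq0 e f 0.
      by move=> X Y onP _; rewrite -h // tz z0 /ev !horner0 mul0r addr0.
    by move: s'; rewrite e0 f0 norm_poly0 size_poly0.
  have hs := has_pole_poly m2 hu ns.
  exists (2 * (size s).-1)%N; apply: (has_pole_uniq two_neq0 hn).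
  rewrite (mulnC m) mulnAC; apply: has_pole_ext hs => X Y onP.
  by rewrite tz /ev horner0 mul0r addr0.
have ht := has_poleM (has_pole_poly m2 hu nt) hv.
case: (eqVneq s 0) => [z0|ns].
  exists (2 * (size t).-1 + 3)%N; apply: (has_pole_uniq two_neq0 hn).
  have -> : (m * (2 * (size t).-1 + 3) = 2 * m * (size t).-1 + 3 * m)%N by ring.
  apply: has_pole_ext ht => X Y onP.
  by rewrite z0 /ev horner0 add0r.
have hs := has_pole_poly m2 hu ns.
set i := (size s).-1 in hs; set j := (size t).-1 in ht.
(* s(u) has even and t(u) v odd order in units of m, so the larger one wins *)
case: (ltngtP (2 * m * i) (2 * m * j + 3 * m))%N => c.
- exists (2 * j + 3)%N; apply: (has_pole_uniq two_neq0 hn).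
  have -> : (m * (2 * j + 3) = 2 * m * j + 3 * m)%N by ring.
  exact: has_poleD c (has_pole_le (leqnn _) hs) ht.
- exists (2 * i)%N; apply: (has_pole_uniq two_neq0 hn).
  have -> : (m * (2 * i) = 2 * m * i)%N by ring.
  apply: has_pole_ext (has_poleD c (has_pole_le (leqnn _) ht) hs).
  by move=> X Y onP; rewrite addrC.
have : (m * (2 * i) = m * (2 * j + 3))%N by lia.
by move/eqP; rewrite eqn_mul2l; lia.
Qed.

Lemma has_pole_X : has_pole (fun X _ => X) 2.
Proof.
exists 'X, 0; split; last by rewrite size_norm_poly eqxx size_polyX.
by move=> X Y _; rewrite /ev hornerX horner0 mul0r addr0.
Qed.

Lemma has_pole_Y : has_pole (fun _ Y => Y) 3.
Proof.
exists 0, 1; split; last by rewrite size_norm_poly oner_eq0 size_poly1 size_poly0.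
by move=> X Y _; rewrite /ev horner0 hornerC mul1r add0r.
Qed.

(** u and v have pole orders 2m and 3m (u_pole).  The functions X and Y, of pole
    orders 2 and 3, lie in the ring generated by u and v, so m divides 2 and 3 and
    is 1 (image_pole).  The
    equation of the curve then fixes the coefficients; w is the quotient of the
    leading coefficients of v and u. *)
Lemma rigid : exists w : k, [/\ w != 0, a * w ^+ 4 = a, b * w ^+ 6 = b &
  forall X Y, on_aff X Y -> u X Y = w ^+ 2 * X /\ v X Y = w ^+ 3 * Y].
Proof.
have [m m0 [hu hv]] := u_pole.
have hX : has_pole (fun X Y => ev s0 s1 (u X Y) (v X Y)) 2.
  by apply: has_pole_ext has_pole_X => X Y /sE ->.
have hY : has_pole (fun X Y => ev t0 t1 (u X Y) (v X Y)) 3.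
  by apply: has_pole_ext has_pole_Y => X Y /tE ->.
have [c ec] := image_pole m0 hu hv hX; have [d ed] := image_pole m0 hu hv hY.
have m1 : m = 1%N.
  have d2 : (m %| 2)%N by rewrite ec dvdn_mulr.
  have d3 : (m %| 3)%N by rewrite ed dvdn_mulr.
  by apply/eqP; rewrite -dvdn1 (_ : 1%N = gcdn 2 3) // dvdn_gcd d2.
rewrite m1 !muln1 in hu hv.
(* pole orders 2 and 3 leave u = al X + be and v = e' + g Y, deg e' <= 1 *)
have [e [f [hef sef]]] := hu; have [e' [f' [hef' sef']]] := hv.
move: sef sef'; rewrite !size_norm_poly.
case: (eqVneq f 0) => [f0|nf]; last by have := nf; rewrite -size_poly_gt0; lia.
case: (eqVneq f' 0) => [f0'|nf']; first by lia.
rewrite maxn0 => se se'.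
have pf' : (0 < size f')%N by rewrite size_poly_gt0.
have {}se : (size e <= 2)%N by lia.
have sf' : (size f' <= 1)%N by lia.
pose al := e`_1; pose be := e`_0; pose g := f'`_0.
have ee : e = al *: 'X + be%:P.
  apply/polyP => i; rewrite coefD coefZ coefX coefC.
  case: i => [|[|i]] /=; rewrite ?mulr0 ?add0r ?mulr1 ?addr0 //.
  by rewrite nth_default // (leq_trans se).
have ef' : f' = g%:P by apply: size1_polyC.
have g0 : g != 0 by move: nf'; rewrite ef' polyC_eq0.
(* the two components, along 1 and Y, of the equation v^2 = u^3 + a u + b *)
have [h1 h2] : e' * e' + f' * f' * Dp = e ^+ 3 + a *: e + b%:P /\ e' * f' + f' * e' = 0.
  apply: (@ev_inj _ a b two_neq0 _ _ _ _ 0) => X Y onP _; rewrite -ev_mul // -hef' //.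
  rewrite -expr2 (uv_on onP) /short hef // f0 /ev !horner0 mul0r addr0.
  by rewrite !(hornerD, hornerZ, hornerC, horner_exp); ring.
have e'0 : e' = 0.
  have ng : 2 * g != 0 by rewrite mulf_neq0.
  have : (2 * g) *: e' = 0.
    by rewrite -[RHS]h2 ef' -mul_polyC polyCM polyC_natr; ring.
  by move/eqP; rewrite scaler_eq0 (negbTE ng) => /eqP.
rewrite e'0 mul0r add0r ef' ee in h1.
have h3 : (g ^+ 2)%:P * Dp = (al ^+ 3) *: 'X^3 + (3 * al ^+ 2 * be) *: 'X^2
   + (3 * al * be ^+ 2 + a * al) *: 'X + (be ^+ 3 + a * be + b)%:P.
  transitivity (g%:P * g%:P * Dp); first by rewrite polyCM; ring.
  rewrite h1 -!mul_polyC !(polyCD, polyCM, polyC_exp, polyC_natr); ring.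
have cf i := congr1 (fun p : {poly k} => p`_i) h3.
have c3 := cf 3; have c2 := cf 2; have c1 := cf 1%N; have c0 := cf 0%N.
rewrite /short_poly !(mul_polyC, coefD, coefZ, coefXn, coefX, coefC) /= in c0 c1 c2 c3.
have eg : g ^+ 2 = al ^+ 3 by apply: (eq_of_diff c3); ring.
have al0 : al != 0.
  by apply: contraNneq (expf_neq0 2 g0) => al0; rewrite eg al0 expr0n.
have be0 : be = 0.
  have n3 : 3 * al ^+ 2 != 0 by rewrite mulf_neq0 ?expf_neq0.
  by apply: (mulfI n3); rewrite mulr0; apply: (eq_of_diff (esym c2)); ring.
have w2 : (g / al) ^+ 2 = al.
  by rewrite expr_div_n eg; field.
have w3 : (g / al) ^+ 3 = g by rewrite exprS w2 divfK.
exists (g / al); split.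
- by rewrite mulf_neq0 ?invr_neq0.
- rewrite (_ : (g / al) ^+ 4 = al ^+ 2); last by rewrite -[4%N]/(2 * 2)%N exprM w2.
  apply: (mulIf al0); rewrite be0 in c1; rewrite eg in c1; apply: (eq_of_diff c1); ring.
- rewrite (_ : (g / al) ^+ 6 = g ^+ 2); last by rewrite -[6%N]/(3 * 2)%N exprM w3.
  by rewrite be0 in c0; apply: (eq_of_diff c0); ring.
move=> X Y onP; rewrite w2 w3 hef // hef' // f0 ee ef' e'0 be0 /ev.
by rewrite !(hornerD, hornerZ, hornerX, hornerC, horner0); split; ring.
Qed.

End Rigidity.

Section Automorphisms.
Variables (k : closedFieldType) (W : weierstrass k).
Hypotheses (two_neq0 : (2 : k) != 0) (three_neq0 : (3 : k) != 0).
Notation a := (short_a W).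
Notation b := (short_b W).
Notation on_aff := (on_aff a b).

Definition coord_fun (h : k -> k -> k) :=
  exists e f, forall X Y, on_aff X Y -> h X Y = ev e f X Y.

Lemma coord_fun_const c : coord_fun (fun _ _ => c).
Proof. by exists c%:P, 0 => X Y _; rewrite /ev hornerC horner0 mul0r addr0. Qed.

Lemma coord_funX : coord_fun (fun X _ => X).
Proof. by exists 'X, 0 => X Y _; rewrite /ev hornerX horner0 mul0r addr0. Qed.

Lemma coord_funY : coord_fun (fun _ Y => Y).
Proof. by exists 0, 1 => X Y _; rewrite /ev horner0 hornerC mul1r add0r. Qed.

Lemma coord_funD g h : coord_fun g -> coord_fun h -> coord_fun (fun X Y => g X Y + h X Y).
Proof.
move=> [e [f E]] [e' [f' E']]; exists (e + e'), (f + f') => X Y onP.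
by rewrite E // E' // ev_add.
Qed.

Lemma coord_funM g h : coord_fun g -> coord_fun h -> coord_fun (fun X Y => g X Y * h X Y).
Proof.
move=> [e [f E]] [e' [f' E']].
exists (e * e' + f * f' * short_poly a b), (e * f' + f * e') => X Y onP.
by rewrite E // E' // (ev_mul (a := a) (b := b)).
Qed.

Lemma coord_fun_ext g h : (forall X Y, g X Y = h X Y) -> coord_fun g -> coord_fun h.
Proof. by move=> gh [e [f E]]; exists e, f => X Y onP; rewrite -gh E. Qed.

Lemma coord_fun_sum (I : Type) (r : seq I) (F : I -> k -> k -> k) :
  (forall i, coord_fun (F i)) -> coord_fun (fun X Y => \sum_(i <- r) F i X Y).
Proof.
move=> h; elim: r => [|i r IH].
  by apply: (coord_fun_ext _ (coord_fun_const 0)) => X Y; rewrite big_nil.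
by apply: (coord_fun_ext _ (coord_funD (h i) IH)) => X Y; rewrite big_cons.
Qed.

Lemma coord_fun_prod (I : Type) (r : seq I) (F : I -> k -> k -> k) :
  (forall i, coord_fun (F i)) -> coord_fun (fun X Y => \prod_(i <- r) F i X Y).
Proof.
move=> h; elim: r => [|i r IH].
  by apply: (coord_fun_ext _ (coord_fun_const 1)) => X Y; rewrite big_nil.
by apply: (coord_fun_ext _ (coord_funM (h i) IH)) => X Y; rewrite big_cons.
Qed.

Lemma coord_fun_exp g n : coord_fun g -> coord_fun (fun X Y => g X Y ^+ n).
Proof.
move=> h; elim: n => [|n IH].
  by apply: (coord_fun_ext _ (coord_fun_const 1)) => X Y; rewrite expr0.
by apply: (coord_fun_ext _ (coord_funM h IH)) => X Y; rewrite exprS.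
Qed.

(** The origin serves as a default value off the curve. *)
Definition affine_pt X Y : points W := insubd (origin W) (of_short W (Some (X, Y))).

Lemma val_affine_pt X Y : on_aff X Y -> val (affine_pt X Y) = of_short W (Some (X, Y)).
Proof.
move=> onP; apply: insubdK.
suff : on_curve W (of_short W (Some (X, Y))) by [].
by rewrite -on_to_short // of_shortK on_short; apply/eqP.
Qed.

Lemma short_affine_pt X Y : on_aff X Y -> short_pt (affine_pt X Y) = Some (X, Y).
Proof. by move=> onP; rewrite /short_pt val_affine_pt // of_shortK. Qed.

Lemma affine_pt_eq P X Y : short_pt P = Some (X, Y) -> P = affine_pt X Y.
Proof.
move=> e; apply: short_pt_inj; rewrite e short_affine_pt //.
by have := short_pt_on two_neq0 three_neq0 P; rewrite e on_short => /eqP.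
Qed.

Lemma meval_coord_fun (F : {mpoly k[3]}) : coord_fun (fun X Y => F.@[hcoord (val (affine_pt X Y))]).
Proof.
suff h : coord_fun (fun X Y => F.@[hcoord (of_short W (Some (X, Y)))]).
  by have [e [f E]] := h; exists e, f => X Y onP; rewrite val_affine_pt // E.
apply: (coord_fun_ext (fun X Y => esym (mevalE _ _))).
apply: coord_fun_sum => m; apply: coord_funM; first exact: coord_fun_const.
apply: coord_fun_prod => i; apply: coord_fun_exp.
case: i => [[|[|[|//]]] ?] /=.
- apply: (@coord_fun_ext (fun X _ => X + (- shift_x W))).
    by move=> X Y; rewrite (tnth_nth 0).
  by apply: coord_funD; [apply: coord_funX | apply: coord_fun_const].
- apply: (@coord_fun_ext (fun X Y => Y + (- ((a3 W - a1 W * shift_x W) / 2) + (- (a1 W / 2)) * X))).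
    by move=> X Y; rewrite (tnth_nth 0) /=; ring.
  apply: coord_funD; first exact: coord_funY.
  apply: coord_funD; first exact: coord_fun_const.
  by apply: coord_funM; [apply: coord_fun_const | apply: coord_funX].
- apply: (@coord_fun_ext (fun _ _ => 1)); last exact: coord_fun_const.
  by move=> X Y; rewrite (tnth_nth 0).
Qed.

Section Components.
Variable f : points W -> points W.
Hypotheses (f_mor : morphism f) (f_inj : injective f) (f_orig : f (origin W) = origin W).

Definition fX X Y := if short_pt (f (affine_pt X Y)) is Some (x, _) then x else 0.
Definition fY X Y := if short_pt (f (affine_pt X Y)) is Some (_, y) then y else 0.

(** Only the origin is sent to the origin. *)
Lemma f_affine X Y : on_aff X Y -> short_pt (f (affine_pt X Y)) = Some (fX X Y, fY X Y).
Proof.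
move=> onP; rewrite /fX /fY; case e: (short_pt _) => [[x y]|] //.
have : f (affine_pt X Y) = f (origin W) by rewrite f_orig; apply: short_pt_inj; rewrite e.
by move/f_inj => e2; have := short_affine_pt onP; rewrite e2.
Qed.

Lemma f_onaff X Y : on_aff X Y -> on_aff (fX X Y) (fY X Y).
Proof.
move=> onP; have := short_pt_on two_neq0 three_neq0 (f (affine_pt X Y)).
by rewrite f_affine // on_short => /eqP.
Qed.

Lemma f_val X Y : on_aff X Y -> val (f (affine_pt X Y)) = of_short W (Some (fX X Y, fY X Y)).
Proof. by move=> onP; rewrite -f_affine // /short_pt to_shortK. Qed.

(** The forms F describing f near a point also satisfy these equations where they
    all vanish, so the equations hold on the whole affine curve. *)
Lemma components_local X Y : on_aff X Y -> exists F : 'I_3 -> {mpoly k[3]},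
  (F (@Ordinal 3 2 isT)).@[hcoord (val (affine_pt X Y))] != 0 /\
  forall X' Y', on_aff X' Y' -> let v i := (F i).@[hcoord (val (affine_pt X' Y'))] in
  [/\ v (@Ordinal 3 0 isT) = (fX X' Y' - shift_x W) * v (@Ordinal 3 2 isT) &
      v (@Ordinal 3 1 isT) = (fY X' Y' - (a1 W * (fX X' Y' - shift_x W) + a3 W) / 2)
        * v (@Ordinal 3 2 isT)].
Proof.
move=> onP; have [d [F [_ nz H]]] := f_mor (affine_pt X Y); exists F.
have e2 X' Y' : on_aff X' Y' -> hcoord (val (f (affine_pt X' Y'))) (@Ordinal 3 2 isT) = 1.
  by move=> onQ; rewrite f_val //= (tnth_nth 0).
split; first by have [c c0 ->] := H _ nz; rewrite e2 // mulr1.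
move=> X' Y' onQ v.
case: (pselect (exists i, (F i).@[hcoord (val (affine_pt X' Y'))] != 0)) => [nz'|z].
  have [c c0 E] := H _ nz'; rewrite /v !E e2 // f_val //= !(tnth_nth 0) /=.
  by split; ring.
have v0 i : v i = 0 by apply/eqP; case: (boolP (v i == 0)) => // n; case: z; exists i.
by rewrite !v0 !mulr0.
Qed.

Lemma fX_regular : regular a b fX.
Proof.
move=> X Y onP; have [F [nz H]] := components_local onP.
have [h0 [h1 hE]] := meval_coord_fun (F (@Ordinal 3 2 isT)).
have [g0 [g1 gE]] := coord_funD (meval_coord_fun (F (@Ordinal 3 0 isT)))
  (coord_funM (coord_fun_const (shift_x W)) (meval_coord_fun (F (@Ordinal 3 2 isT)))).
exists g0, g1, h0, h1; split; first by rewrite -hE.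
move=> X' Y' onQ; rewrite -hE // -gE //; have [-> _] := H _ _ onQ; ring.
Qed.

Lemma fY_regular : regular a b fY.
Proof.
move=> X Y onP; have [F [nz H]] := components_local onP.
have [h0 [h1 hE]] := meval_coord_fun (F (@Ordinal 3 2 isT)).
have [g0 [g1 gE]] := coord_funD (meval_coord_fun (F (@Ordinal 3 1 isT)))
  (coord_funD (coord_funM (coord_fun_const (a1 W / 2)) (meval_coord_fun (F (@Ordinal 3 0 isT))))
     (coord_funM (coord_fun_const (a3 W / 2)) (meval_coord_fun (F (@Ordinal 3 2 isT))))).
exists g0, g1, h0, h1; split; first by rewrite -hE.
move=> X' Y' onQ; rewrite -hE // -gE //; have [-> ->] := H _ _ onQ; ring.
Qed.

End Components.

(** The coordinates of xi and of its inverse are polynomial functions, each in terms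
    of the other: the situation of rigid. *)
Lemma automorphism_scaling (xi : points W -> points W) :
  automorphism xi -> xi (origin W) = origin W ->
  exists w : k, [/\ w != 0, a * w ^+ 4 = a, b * w ^+ 6 = b &
  forall P X Y, short_pt P = Some (X, Y) ->
    short_pt (xi P) = Some (w ^+ 2 * X, w ^+ 3 * Y)].
Proof.
move=> [mxi [eta [meta xiK etaK]]] oxi.
have oeta : eta (origin W) = origin W by rewrite -{1}oxi xiK.
have ixi := can_inj xiK; have ieta := can_inj etaK.
have [u0 [u1 uE]] := regular_poly two_neq0 (fX_regular mxi ixi oxi).
have [v0 [v1 vE]] := regular_poly two_neq0 (fY_regular mxi ixi oxi).
have [s0 [s1 sE]] := regular_poly two_neq0 (fX_regular meta ieta oeta).
have [t0 [t1 tE]] := regular_poly two_neq0 (fY_regular meta ieta oeta).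
have inv X Y : on_aff X Y -> short_pt (eta (affine_pt (fX xi X Y) (fY xi X Y))) = Some (X, Y).
  move=> onP; rewrite -(affine_pt_eq (f_affine ixi oxi onP)) xiK.
  exact: short_affine_pt.
have [|||w [w0 wa wb wE]] := @rigid _ a b two_neq0 three_neq0 (fX xi) (fY xi)
  u0 u1 v0 v1 s0 s1 t0 t1 uE vE.
- by move=> X Y; apply: f_onaff.
- move=> X Y onP; rewrite -sE; last exact: f_onaff.
  by rewrite /fX inv.
- move=> X Y onP; rewrite -tE; last exact: f_onaff.
  by rewrite {1}/fY inv.
exists w; split=> // P X Y eP.
have onP : on_aff X Y.
  by have := short_pt_on two_neq0 three_neq0 P; rewrite eP on_short => /eqP.
by rewrite (affine_pt_eq eP) f_affine //; have [-> ->] := wE _ _ onP.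
Qed.

End Automorphisms.

(** * Stable subgroups of a finite abelian group *)

Section Quad.
Local Open Scope nat_scope.

Definition quad (e c : nat) : nat := (c * c + e * c + 1)%N.

(** 4 (c^2 + e c + 1) = (2c + e)^2 + (4 - e^2). *)
Lemma disc_quad e c p : (e <= 1)%N -> (p %| quad e c)%N -> (p %| 2 * c + e)%N ->
  (p %| 4 - e * e)%N.
Proof.
move=> e1 d1 d2; have E : (4 * quad e c = (2 * c + e) * (2 * c + e) + (4 - e * e))%N.
  by rewrite /quad; case: e e1 {d1 d2} => [|[|//]] _; nia.
by rewrite -(dvdn_addr _ (dvdn_mulr (2 * c + e)%N d2)) -E dvdn_mull.
Qed.

(** (c - d)(c + d + e) is divisible by p^k, and p cannot divide both factors, since
    it would then divide the discriminant 4 - e^2. *)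
Lemma quad_roots e p k c d : prime p -> (e <= 1)%N -> ~~ (p %| 4 - e * e)%N -> (0 < k)%N ->
  (p ^ k %| quad e c)%N -> (p ^ k %| quad e d)%N ->
  c = d %[mod p ^ k] \/ (p ^ k %| c + d + e)%N.
Proof.
move=> pp e1 np k0; wlog le_dc : c d / (d <= c)%N => [H hc hd|].
  case: (leqP d c) => [/H|/ltnW/H]; first exact.
  by case/(_ hd hc) => h; [left | right; rewrite (addnC c)].
move=> hc hd.
have pk : (p %| p ^ k)%N by rewrite -{1}(expn1 p) dvdn_exp2l.
have E : ((c - d) * (c + d + e) = quad e c - quad e d)%N.
  suff -> : (quad e c = quad e d + (c - d) * (c + d + e))%N by rewrite addKn.
  by rewrite /quad; move: (subnKC le_dc) => <-; rewrite addKn; ring.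
have dv : (p ^ k %| (c - d) * (c + d + e))%N by rewrite E dvdn_sub.
case: (boolP (p %| c + d + e)%N) => h1.
  right; suff cop : coprime (p ^ k) (c - d) by rewrite Gauss_dvdr in dv.
  rewrite coprimeXl // prime_coprime //; apply: contra np => h2.
  apply: (disc_quad e1 (dvdn_trans pk hd)).
  rewrite -(dvdn_addr _ h2); have -> // : (c - d + (2 * d + e) = c + d + e)%N by clear -le_dc; lia.
left; apply/eqP; rewrite eqn_mod_dvd //.
by rewrite -(@Gauss_dvdl _ _ (c + d + e)) // coprimeXl // prime_coprime.
Qed.

End Quad.

Section StableSubgroups.
Local Open Scope group_scope.
Variables (gT : finGroupType) (t : gT -> gT).
Hypotheses (mulC : forall x y : gT, x * y = y * x)
  (tM : {morph t : x y / x * y}) (tI : injective t).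
Implicit Types (G H : {group gT}) (x y : gT).

Lemma all_abelian G : abelian G.
Proof. by apply/centsP => x _ y _; apply: mulC. Qed.

Lemma all_normal G H : H \subset G -> H <| G.
Proof. by move=> sHG; rewrite -sub_abelian_normal // all_abelian. Qed.

Lemma expMgC x y n : (x * y) ^+ n = x ^+ n * y ^+ n.
Proof. by rewrite expgMn //; apply: mulC. Qed.

Lemma mulACA (x y z w : gT) : x * y * (z * w) = x * z * (y * w).
Proof. by rewrite !mulgA -(mulgA x y) (mulC y) mulgA. Qed.

Definition tmor := @Morphism gT gT [set: gT] t (fun x y _ _ => tM x y).

Lemma tmorE (A : {set gT}) : tmor @* A = t @: A.
Proof. by rewrite /morphim /= setTI. Qed.

Lemma t_exp x n : t (x ^+ n) = t x ^+ n.
Proof. exact: (morphX tmor n (in_setT x)). Qed.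

Lemma t_one : t 1 = 1.
Proof. exact: (morph1 tmor). Qed.

Lemma tmor_inj : 'injm tmor.
Proof. by apply/injmP => x y _ _ /tI. Qed.

Definition tstable (A : {set gT}) := t @: A == A.

Lemma tstableP (A : {set gT}) : reflect (forall x, x \in A -> t x \in A) (tstable A).
Proof.
apply: (iffP eqP) => [E x xA|h]; first by rewrite -E imset_f.
apply/eqP; rewrite eqEcard card_imset // leqnn andbT.
by apply/subsetP => _ /imsetP[x xA ->]; apply: h.
Qed.

Definition stable_count m := #|[set H : {group gT} | (#|H| == m) && tstable H]|.
Definition cyclic_count m := #|[set H : {group gT} | [&& #|H| == m, tstable H & cyclic H]]|.

(** A group of order ab is the product of its parts of order a and b, which are
    characteristic and so stable with it. *)
Lemma stable_count_mul a b : (0 < a)%N -> (0 < b)%N -> coprime a b -> stable_count (a * b)%N = (stable_count a * stable_count b)%N.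
Proof.
move=> a0 b0 cab; pose pi : nat_pred := \pi(a).
have pa : pi.-nat a by apply: pnat_pi.
have pb : pi^'.-nat b by rewrite -coprime_pi'.
have pa' : ((pi^')^')%N.-nat a by rewrite (eq_pnat _ (negnK pi)).
have part : ((a * b)`_pi = a /\ (a * b)`_pi^' = b)%N.
  rewrite !partnM // (part_pnat_id pa) (part_p'nat pb) (part_pnat_id pb) muln1.
  by rewrite (part_p'nat pa') mul1n.
pose A m := [set H : {group gT} | (#|H| == m) && tstable H].
rewrite /stable_count -/(A a) -/(A b) -cardsX.
pose f (u : {group gT} * {group gT}) := (u.1 <*> u.2)%G.
have cop (H K : {group gT}) : #|H| = a -> #|K| = b ->
   [/\ #|H <*> K| = (a * b)%N, 'O_pi(H <*> K) = H & 'O_pi^'(H <*> K) = K].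
  move=> cH cK; have cHK : #|H <*> K| = (a * b)%N.
    rewrite comm_joingE; last by apply: centC; apply/centsP => x _ y _; apply: mulC.
    by rewrite coprime_cardMg ?cH ?cK.
  have [p1 p2] := part.
  by split=> //; apply: normal_Hall_pcore; rewrite ?pHallE ?all_normal ?joing_subl ?joing_subr //
      cHK ?p1 ?p2 ?cH ?cK eqxx.
rewrite -(card_in_imset (f := f)); last first.
  move=> [H K] [H' K']; rewrite !inE /= => /andP[/andP[/eqP cH _] /andP[/eqP cK _]].
  move=> /andP[/andP[/eqP cH' _] /andP[/eqP cK' _]] /(congr1 val) /= E.
  have [_ e1 e2] := cop _ _ cH cK; have [_ e3 e4] := cop _ _ cH' cK'.
  have eH : H = H' by apply: val_inj; rewrite /= -e1 E e3.
  have eK : K = K' by apply: val_inj; rewrite /= -e2 E e4.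
  by rewrite eH eK.
apply: eq_card => G; apply/idP/imsetP; last first.
  move=> [[H K]]; rewrite !inE /= => /andP[/andP[/eqP cH sH] /andP[/eqP cK sK]] ->.
  have [-> _ _] := cop _ _ cH cK; rewrite eqxx /= /tstable -tmorE morphimY ?subsetT //.
  by rewrite !tmorE (eqP sH) (eqP sK).
rewrite inE => /andP[/eqP cG sG]; exists ('O_pi(G), 'O_pi^'(G))%G; last first.
  apply: val_inj => /=; have /dprodP[_ E _ _] := nilpotent_pcoreC pi (abelian_nil (all_abelian G)).
  rewrite comm_joingE; first exact: esym E.
  by apply: centC; apply/centsP => x _ y _; apply: mulC.
have hall q := nilpotent_pcore_Hall q (abelian_nil (all_abelian G)).
have st q : tstable 'O_q(G).
  by rewrite /tstable -tmorE injm_pcore ?subsetT ?tmor_inj // tmorE (eqP sG).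
have [p1 p2] := part.
by rewrite !inE /= !st !andbT !(card_Hall (hall _)) cG p1 p2 !eqxx.
Qed.

Lemma stable_count1 : stable_count 1%N = 1%N.
Proof.
rewrite /stable_count -[RHS](cards1 (1%G : {group gT})); apply: eq_card => H; rewrite !inE.
apply/andP/eqP => [[/eqP cH _]|->].
  by apply: val_inj; rewrite /= (card1_trivg cH).
by rewrite cards1; split=> //; rewrite /tstable imset_set1 t_one.
Qed.

Lemma stable_count_prime p : prime p -> stable_count p = cyclic_count p.
Proof.
move=> pp; apply: eq_card => H; rewrite !inE.
case: eqP => //= cH; rewrite prime_cyclic ?andbT //; by rewrite cH.
Qed.

(** Each cyclic group of order m has totient m generators. *)
Lemma sum_generators m : (0 < m)%N ->
  (#|[set H : {group gT} | (#|H| == m) && cyclic H]| * totient m)%N = #|[set x : gT | #[x] == m]|.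
Proof.
move=> m0; set C := [set H : {group gT} | _].
rewrite -[RHS]sum1_card (partition_big (fun x => <[x]>%G) (mem C)) /=; last first.
  by move=> x; rewrite !inE cycle_cyclic andbT.
rewrite -sum_nat_const; apply: eq_bigr => H; rewrite inE => /andP[/eqP cH /cyclicP[x eH]].
rewrite sum1dep_card -cH eH -/#[x] totient_gen; apply: eq_card => y; rewrite !inE.
have -> : (<[y]>%G == H) = (<[x]> == <[y]>) by rewrite -val_eqE /= eH eq_sym.
by rewrite /generator; case: eqP => [E|]; rewrite ?andbF // /order -E eqxx.
Qed.

Lemma stable_cycle x : tstable <[x]> = (t x \in <[x]>).
Proof.
apply/tstableP/idP => [h|h y /cycleP[i ->]]; first by apply: h; apply: cycle_id.
by rewrite t_exp groupX.
Qed.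

Section PrimePower.
Variables (p K : nat).
Hypotheses (p_pr : prime p)
  (tors : forall k, (k <= K)%N -> #|[set x : gT | x ^+ (p ^ k)%N == 1]| = (p ^ k * p ^ k)%N).

Definition pw (x : gT) := x ^+ p.
Lemma pwM : {in setT &, {morph pw : x y / x * y}}.
Proof. by move=> x y _ _; apply: expMgC. Qed.
Definition pmor := Morphism pwM.

Lemma tors_group d : group_set [set x : gT | x ^+ d == 1].
Proof.
apply/group_setP; split; first by rewrite inE expg1n.
by move=> x y; rewrite !inE expMgC => /eqP -> /eqP ->; rewrite mulg1.
Qed.
Definition tors_gr d : {group gT} := Group (tors_group d).

Lemma mem_tors d x : (x \in tors_gr d) = (x ^+ d == 1).
Proof. by rewrite inE. Qed.

Lemma card_tors k : (k <= K)%N -> #|tors_gr (p ^ k)%N| = (p ^ k * p ^ k)%N.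
Proof. exact: tors. Qed.

Lemma card_tors_p : (0 < K)%N -> #|tors_gr p| = (p ^ 2)%N.
Proof. by move/card_tors; rewrite expn1 mulnn. Qed.

Lemma order_sub_tors d H : (#|H| %| d)%N -> H \subset tors_gr d.
Proof.
move=> dH; apply/subsetP => x xH; rewrite mem_tors -order_dvdn.
exact: dvdn_trans (order_dvdG xH) dH.
Qed.

(** An abelian p-group is cyclic exactly when it has at most p elements killed by
    p; here there are p^2 in the whole group. *)
Lemma noncyclicE k H : (0 < K)%N -> #|H| = (p ^ k)%N -> ~~ cyclic H = (tors_gr p \subset H).
Proof.
move=> K0 cH; have pH : p.-group H by rewrite /pgroup cH pnatX pnat_id.
have cT := card_tors_p K0.
rewrite abelian_rank1_cyclic ?all_abelian // (rank_pgroup pH) p_rank_abelian ?all_abelian //.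
rewrite (OhmEabelian pH) ?all_abelian // expn1 -ltnNge.
have -> : 'Ldiv_p(H) = H :&: tors_gr p by apply/setP => x; rewrite !inE.
have sI : H :&: tors_gr p \subset tors_gr p by apply: subsetIr.
have /(dvdn_pfactor _ _ p_pr)[j j2 cI] : (#|H :&: tors_gr p| %| p ^ 2)%N.
  by rewrite -cT; apply: (cardSg (H := (H :&: tors_gr p)%G)).
rewrite cI pfactorK //; apply/idP/idP => [j1|sT].
  have ej : j = 2 by apply/eqP; rewrite eqn_leq j2.
  have /eqP <- : H :&: tors_gr p == tors_gr p by rewrite eqEcard sI cT cI ej leqnn.
  exact: subsetIl.
have := cI; rewrite (setIidPr sT) cT => /eqP.
by rewrite eqn_exp2l ?(prime_gt1 p_pr) // => /eqP <-.
Qed.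

Lemma ker_pmor : 'ker pmor = tors_gr p.
Proof. by apply/setP => x; rewrite !inE. Qed.

(** By counting, multiplication by p maps the p^(k+1)-torsion onto the
    p^k-torsion. *)
Lemma pmor_im k G : (k < K)%N -> #|G| = (p ^ k)%N -> G \subset pmor @* setT.
Proof.
move=> kK cG; have p0 := prime_gt0 p_pr.
have E : pmor @* tors_gr (p ^ k.+1)%N = tors_gr (p ^ k)%N.
  apply/eqP; rewrite eqEcard; apply/andP; split.
    apply/subsetP => _ /morphimP[x _ xT ->] /=; move: xT; rewrite !mem_tors /pw -expgM.
    by rewrite expnS.
  have sk : tors_gr p \subset tors_gr (p ^ k.+1)%N.
    by apply/subsetP => x; rewrite !mem_tors -!order_dvdn => /dvdn_trans; apply; rewrite expnS dvdn_mulr.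
  rewrite card_morphim setTI ker_pmor -divgS // (card_tors kK) (card_tors (ltnW kK)).
  rewrite card_tors_p; last by apply: leq_ltn_trans kK.
  by rewrite [(p ^ k.+1)%N]expnS mulnACA mulnn mulKn ?muln_gt0 ?p0.
apply: subset_trans (order_sub_tors (_ : (#|G| %| p ^ k)%N)) _; first by rewrite cG.
by rewrite -E morphimS ?subsetT.
Qed.

(** The noncyclic subgroups are those containing the p-torsion, that is, the
    preimages under the p-th power map of the subgroups of order p^k. *)
Lemma stable_count_rec k : (k.+1 < K)%N -> stable_count (p ^ k.+2)%N = (stable_count (p ^ k)%N + cyclic_count (p ^ k.+2)%N)%N.
Proof.
move=> kK; have K0 : (0 < K)%N by apply: leq_ltn_trans kK.
have p0 := prime_gt0 p_pr.
have cT := card_tors_p K0.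
rewrite /stable_count -(cardsID [set H : {group gT} | cyclic H]) addnC; congr (_ + _)%N; last first.
  by apply: eq_card => H; rewrite !inE andbA.
pose g G := (pmor @*^-1 G)%G.
have im G : #|G| == (p ^ k)%N -> G \subset pmor @* setT by move/eqP/pmor_im; apply; apply: ltnW.
symmetry; rewrite -(card_in_imset (f := g)); last first.
  move=> G G'; rewrite !inE => /andP[/im sG _] /andP[/im sG' _] /(congr1 val) /= E.
  by apply: val_inj; rewrite /= -(morphpreK sG) E morphpreK.
symmetry; apply: eq_card => H; rewrite !inE; apply/andP/imsetP.
  move=> [ncH /andP[/eqP cH sH]]; have := ncH; rewrite (noncyclicE K0 cH) => sT.
  exists (pmor @* H)%G.
    rewrite inE /= card_morphim setTI ker_pmor -divgS // cH cT; apply/andP; split.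
      by rewrite -[k.+2]addn2 expnD mulnK // expn_gt0 p0.
    apply/tstableP => _ /morphimP[x _ xH ->]; rewrite /= /pw t_exp.
    by apply/morphimP; exists (t x); rewrite ?inE //; apply: (tstableP _ sH).
  by apply: val_inj; rewrite /= morphimGK ?ker_pmor ?subsetT.
move=> [G]; rewrite inE => /andP[cG sG] ->; have sI := im _ cG.
have cg : #|g G| = (p ^ k.+2)%N.
  by rewrite card_morphpre // ker_pmor cT (eqP cG) -expnD.
split; first by rewrite (noncyclicE K0 cg) -ker_pmor; apply: morphpreS; apply: sub1G.
rewrite cg eqxx /=; apply/tstableP => x; rewrite !inE /= => xG.
by rewrite /pw -t_exp; apply: (tstableP _ sG).
Qed.

Lemma stable_count_step (f : nat -> nat) : f 0%N = 1%N -> ((0 < K)%N -> f 1%N = cyclic_count p) ->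
  (forall k, (k.+1 < K)%N -> f k.+2 = (f k + cyclic_count (p ^ k.+2)%N)%N) ->
  forall k, (k <= K)%N -> stable_count (p ^ k)%N = f k.
Proof.
move=> f0 f1 fr k; suff [] : ((k <= K)%N -> stable_count (p ^ k)%N = f k) /\
   ((k.+1 <= K)%N -> stable_count (p ^ k.+1)%N = f k.+1) by [].
elim: k => [|k [IH1 IH2]].
  split=> [_|K0]; first by rewrite expn0 stable_count1.
  by rewrite f1 // expn1 stable_count_prime.
split=> // kK; rewrite stable_count_rec // fr // IH1 //; lia.
Qed.

Lemma cyclic_count_all : (forall H : {group gT}, tstable H) -> forall k, (k < K)%N ->
  cyclic_count (p ^ k.+1)%N = (p ^ k.+1 + p ^ k)%N.
Proof.
move=> st k kK; have p0 := prime_gt0 p_pr; have p1 := prime_gt1 p_pr.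
(* there are p^(2k+2) - p^2k elements of order p^(k+1) *)
have tg : (0 < totient (p ^ k.+1))%N by rewrite totient_gt0 expn_gt0 p0.
apply/eqP; rewrite -(eqn_pmul2r tg).
have -> : cyclic_count (p ^ k.+1)%N = #|[set H : {group gT} | (#|H| == (p ^ k.+1)%N) && cyclic H]|.
  by apply: eq_card => H; rewrite !inE st.
rewrite sum_generators ?expn_gt0 ?p0 //.
have -> : [set x : gT | #[x] == (p ^ k.+1)%N] = tors_gr (p ^ k.+1)%N :\: tors_gr (p ^ k)%N.
  apply/setP => x; rewrite !inE -!order_dvdn; apply/eqP/andP => [->|[n /(dvdn_pfactor _ _ p_pr)[j jk E]]].
    by rewrite dvdnn dvdn_Pexp2l // ltnn.
  move: n; rewrite E dvdn_Pexp2l // -ltnNge => kj; congr (p ^ _)%N.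
  by apply/eqP; rewrite eqn_leq jk.
rewrite cardsD (setIidPr _); last first.
  by apply/subsetP => x; rewrite !mem_tors -!order_dvdn => /dvdn_trans; apply; rewrite dvdn_Pexp2l.
rewrite (card_tors kK) (card_tors (ltnW kK)) totient_pfactor //= expnS.
by case: p p1 => // q _; rewrite /=; apply/eqP; move: (q.+1 ^ k)%N => z; nia.
Qed.

Lemma stable_count_all : (forall H : {group gT}, tstable H) ->
  forall k, (k <= K)%N -> stable_count (p ^ k)%N = (\sum_(i < k.+1) p ^ i)%N.
Proof.
move=> st; apply: (stable_count_step (f := fun k => (\sum_(i < k.+1) p ^ i)%N)).
- by rewrite big_ord1.
- by move=> K0; rewrite -[p in cyclic_count p]expn1 cyclic_count_all // !big_ord_recr big_ord0 /= addnC.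
move=> k kK; rewrite cyclic_count_all // (big_ord_recr k.+2) (big_ord_recr k.+1) /=.
by rewrite -addnA (addnC (p ^ k.+1)%N).
Qed.

Variable e : nat.
Hypotheses (rel : forall x, t (t x) * t x ^+ e * x = 1)
  (ns : forall c, (p %| quad e c)%N -> exists2 x, x ^+ p = 1 & t x <> x ^+ c).

(** t multiplies a generator by some c, and the quadratic relation makes c a root. *)
Lemma stable_gen x : tstable <[x]> -> exists2 c, t x = x ^+ c & (#[x] %| quad e c)%N.
Proof.
rewrite stable_cycle // => /cycleP[c E]; exists c => //.
by have := rel x; rewrite E t_exp // E -!expgM -expgD -expgSr order_dvdn mulnC /quad addn1 => ->.
Qed.

Lemma cyclic_count0 m : (forall c, ~~ (m %| quad e c)%N) -> cyclic_count m = 0%N.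
Proof.
move=> h; apply/eqP; rewrite cards_eq0 -subset0; apply/subsetP => H.
rewrite !inE => /and3P[/eqP cH sH /cyclicP[x E]]; rewrite E in sH.
have [c _] := stable_gen sH; rewrite -/#[x] /order -E cH.
by rewrite (negbTE (h c)).
Qed.

Lemma eigen_group c m : group_set [set x in tors_gr m | t x == x ^+ c].
Proof.
apply/group_setP; split; first by rewrite inE group1 t_one // expg1n eqxx.
move=> x y; rewrite !(inE, mem_tors) => /andP[/eqP hx /eqP ex] /andP[/eqP hy /eqP ey].
by rewrite expMgC // hx hy mulg1 eqxx tM ex ey -expMgC // eqxx.
Qed.
Definition eigen c m : {group gT} := Group (eigen_group c m).

Lemma mem_eigen c m x : (x \in eigen c m) = (x ^+ m == 1) && (t x == x ^+ c).
Proof. by rewrite !inE. Qed.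

Lemma eigen_stable c m : tstable (eigen c m).
Proof.
apply/tstableP => x; rewrite !mem_eigen => /andP[/eqP h /eqP tx].
by rewrite tx t_exp // tx -!expgM (mulnC c m) expgM h expg1n !eqxx.
Qed.

(** c and d being the two roots modulo m, t - c maps the m-torsion into the
    eigengroup of d, with the eigengroup of c as kernel. *)
Lemma eigen_card c d m : (m %| c + d + e)%N -> c * d = 1 %[mod m] ->
  (#|tors_gr m| <= #|eigen c m| * #|eigen d m|)%N.
Proof.
move=> sum prod.
have fM : {in tors_gr m &, {morph (fun x => t x * x ^- c) : x y / x * y}}.
  by move=> x y _ _ /=; rewrite tM expMgC // invMg (mulC (y ^- c)) mulACA.
pose f := Morphism fM.
have kerE : 'ker f = eigen c m.
  by apply/setP => x; rewrite !inE -eq_mulgV1.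
have imE : f @* tors_gr m \subset eigen d m.
  apply/subsetP => _ /morphimP[x _ xT ->]; rewrite mem_tors in xT.
  have txm : t x ^+ m = 1 by rewrite -t_exp // (eqP xT) t_one.
  rewrite mem_eigen /=; apply/andP; split.
    by rewrite expMgC // expgVn -expgM mulnC expgM (eqP xT) expg1n invg1 mulg1 txm.
  rewrite expMgC // tM // (_ : t (x ^- c) = t x ^- c); last first.
    by rewrite -t_exp //; apply: (morphV tmor); rewrite inE.
  have -> : t (t x) = (t x ^+ e * x)^-1.
    by apply: (mulIg (t x ^+ e * x)); rewrite mulVg mulgA rel.
  have e1 : x ^+ (c * d) = x by rewrite -(expg_mod _ (eqP xT)) prod expg_mod ?expg1 ?(eqP xT).
  rewrite expgVn -expgM e1.
  have e2 : t x ^+ d * t x ^+ c * t x ^+ e = 1.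
    by rewrite -!expgD (addnC d); case/dvdnP: sum => q ->; rewrite mulnC expgM txm expg1n.
  apply/eqP; rewrite mulC -invMg; apply: (mulIg (t x ^+ e * x * t x ^+ c)).
  rewrite mulVg; have -> : t x ^+ e * x * t x ^+ c = x * (t x ^+ c * t x ^+ e).
    by rewrite -mulgA mulC -mulgA.
  by rewrite -mulgA mulKg mulgA e2.
have := card_morphim f (tors_gr m); rewrite setIid kerE => cim.
rewrite -(Lagrange (_ : eigen c m \subset tors_gr m)); last first.
  by apply/subsetP => x; rewrite mem_eigen mem_tors => /andP[].
by rewrite leq_mul2l -cim subset_leq_card // orbT.
Qed.

Lemma eigen_sub c m : eigen c m \subset tors_gr m.
Proof. by apply/subsetP => x; rewrite mem_eigen mem_tors => /andP[]. Qed.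

Lemma eigen_order c k : (k <= K)%N -> exists j, #|eigen c (p ^ k)%N| = (p ^ j)%N.
Proof.
move=> kK; have := cardSg (eigen_sub c (p ^ k)%N); rewrite card_tors // -expnD.
by case/(dvdn_pfactor _ _ p_pr) => j _ ->; exists j.
Qed.

Lemma eigen_not_full c m : (p %| quad e c)%N -> (p %| m)%N -> ~~ (tors_gr p \subset eigen c m).
Proof.
move=> pc pm; have [x xp nx] := ns pc; apply/subsetPn; exists x.
  by rewrite mem_tors xp.
by rewrite mem_eigen negb_and orbC; apply/orP; left; apply/eqP.
Qed.

(** Modulo a ramified prime the only root is 1, so a stable subgroup of order p is
    fixed pointwise; the group of fixed points in the p-torsion has order p. *)
Lemma cyclic_count_ramified : (0 < K)%N -> (p %| e + 2)%N ->
  (forall c, (p %| quad e c)%N -> c = 1 %[mod p]) -> cyclic_count p = 1%N.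
Proof.
move=> K0 pe h; have cT := card_tors_p K0; have p1 := prime_gt1 p_pr.
(* t - 1 maps the p-torsion into its own kernel, the group of fixed points *)
have [j cE] : exists j, #|eigen 1 p| = (p ^ j)%N by have := eigen_order 1 K0; rewrite expn1.
have le2 : (#|tors_gr p| <= #|eigen 1 p| * #|eigen 1 p|)%N.
  by apply: eigen_card; rewrite ?muln1 // addnC (_ : (1 + 1 = 2)%N).
have q1 : (p %| quad e 1)%N by rewrite /quad !muln1 (_ : (1 + e + 1 = e + 2)%N) //; lia.
have := eigen_not_full q1 (dvdnn p); have := subset_leq_card (eigen_sub 1 p).
rewrite cT cE leq_exp2l // => j2 nT; rewrite cT cE -expnD leq_exp2l // in le2.
have {nT}j1 : j <> 2.
  move=> j2'; case/negP: nT; have /eqP -> // : eigen 1 p == tors_gr p :> {set gT}.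
  by rewrite eqEcard eigen_sub cT cE j2' leqnn.
have {j1 j2 le2}ej : j = 1%N by lia.
rewrite ej expn1 in cE.
rewrite /cyclic_count -(cards1 (eigen 1 p)); apply: eq_card => H; rewrite !inE.
apply/and3P/eqP => [[/eqP cH sH /cyclicP[x eH]]|->]; last first.
  by split; rewrite ?cE ?eigen_stable ?prime_cyclic ?cE.
apply: val_inj; apply/eqP; rewrite eqEcard cE cH leqnn andbT.
suff : H \subset eigen 1 p by [].
rewrite eH cycle_subG mem_eigen; rewrite eH in sH; have [c tx oc] := stable_gen sH.
have ox : #[x] = p by rewrite /order -eH cH.
rewrite ox in oc; have xp : x ^+ p = 1 by rewrite -ox expg_order.
by rewrite xp eqxx tx -(expg_mod _ xp) (h c oc) (expg_mod _ xp) eqxx.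
Qed.

(** The eigengroups of the two roots c and d are the stable cyclic subgroups of order
    p^k.  Neither contains the p-torsion, where t is not a power map. *)
Lemma cyclic_count_split k : (0 < k)%N -> (k <= K)%N -> (e <= 1)%N -> ~~ (p %| 4 - e * e)%N ->
  (exists c, (p ^ k %| quad e c)%N) -> cyclic_count (p ^ k)%N = 2.
Proof.
move=> k0 kK e1 np [c qc]; have p1 := prime_gt1 p_pr; have p0 := prime_gt0 p_pr.
have K0 : (0 < K)%N by apply: leq_trans kK.
have pk : (p %| p ^ k)%N by rewrite -{1}(expn1 p) dvdn_exp2l.
(* the second root of c^2 + e c + 1 is the class of - e - c *)
pose d := ((c + e) * (p ^ k - 1))%N.
have sum : (c + d + e = (c + e) * p ^ k)%N.
  have : (0 < p ^ k)%N by rewrite expn_gt0 p0.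
  by rewrite /d; case: (p ^ k)%N => // m _; rewrite subn1 /= mulnS; lia.
have dsum : (p ^ k %| c + d + e)%N by rewrite sum dvdn_mull.
have prod : c * d = 1 %[mod p ^ k].
  have : (c * d + quad e c = c * (c + d + e) + 1)%N by rewrite /quad; ring.
  move/(congr1 (fun n => n %% p ^ k)%N); rewrite sum mulnA -modnDmr (eqP qc) addn0.
  by rewrite modnMDl.
have qd : (p ^ k %| quad e d)%N.
  have E1 : (c * d + quad e d = d * (c + d + e) + 1)%N by rewrite /quad; ring.
  have : (c * d + quad e d == c * d + 0 %[mod p ^ k])%N.
    by rewrite E1 sum mulnA modnMDl addn0 prod.
  by rewrite eqn_modDl mod0n.
have cyc i : (p %| quad e i)%N -> cyclic (eigen i (p ^ k)%N).
  move=> qi; have [j cj] := eigen_order i kK.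
  by apply: contraNT (eigen_not_full qi pk); rewrite (noncyclicE K0 cj).
have bound i : (p %| quad e i)%N -> (#|eigen i (p ^ k)%N| <= p ^ k)%N.
  move/cyc/cyclicP=> [x Ex]; have : x \in eigen i (p ^ k)%N by rewrite Ex cycle_id.
  rewrite mem_eigen -order_dvdn => /andP[/dvdn_leq + _]; rewrite /order -Ex; apply.
  by rewrite expn_gt0 p0.
have pc := dvdn_trans pk qc; have pd := dvdn_trans pk qd.
have [bc bd] := (bound _ pc, bound _ pd).
have := eigen_card dsum prod; rewrite card_tors // => le2.
have q0 : (0 < p ^ k)%N by rewrite expn_gt0 p0.
(* both eigengroups are cyclic of exponent p^k, and their orders multiply to at
   least p^2k *)
have cc : #|eigen c (p ^ k)%N| = (p ^ k)%N.
  apply/eqP; rewrite eqn_leq bc /= -(leq_pmul2r q0); apply: leq_trans le2 _.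
  by rewrite leq_mul2l bd orbT.
have cd : #|eigen d (p ^ k)%N| = (p ^ k)%N.
  apply/eqP; rewrite eqn_leq bd /= -(leq_pmul2l q0); apply: leq_trans le2 _.
  by rewrite leq_mul2r bc orbT.
have neq : eigen c (p ^ k)%N != eigen d (p ^ k)%N.
  apply: contra np => /eqP EE; have /cyclicP[x Ex] := cyc _ pc.
  have ox : #[x] = (p ^ k)%N by rewrite /order -Ex cc.
  have : x \in eigen c (p ^ k)%N by rewrite Ex cycle_id.
  have : x \in eigen d (p ^ k)%N by rewrite -EE Ex cycle_id.
  rewrite !mem_eigen => /andP[_ /eqP ->] /andP[_]; rewrite eq_expg_mod_order ox => /eqP dc.
  apply: (disc_quad e1 pc); apply: dvdn_trans pk _.
  rewrite mul2n -addnn /dvdn -addnA -modnDml -dc modnDml addnA.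
  by rewrite (addnC d c); exact: dsum.
transitivity #|[set eigen c (p ^ k)%N; eigen d (p ^ k)%N]|; last by rewrite cards2 neq.
apply: eq_card => H; rewrite !inE; apply/and3P/orP; last first.
  by case=> /eqP ->; rewrite ?cc ?cd ?eqxx eigen_stable cyc.
move=> [/eqP cH sH /cyclicP[x eH]]; rewrite eH in sH.
have [i tx oi] := stable_gen sH; have ox : #[x] = (p ^ k)%N by rewrite /order -eH cH.
rewrite ox in oi; have xp : x ^+ (p ^ k)%N = 1 by rewrite -ox expg_order.
have full j : i = j %[mod p ^ k] -> #|eigen j (p ^ k)%N| = (p ^ k)%N -> H == eigen j (p ^ k)%N.
  move=> ij cj; rewrite -val_eqE eqEcard cj cH leqnn andbT.
  suff : H \subset eigen j (p ^ k)%N by [].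
  by rewrite eH cycle_subG mem_eigen xp eqxx tx eq_expg_mod_order ox ij eqxx.
case: (quad_roots p_pr e1 np k0 oi qc) => [ic|ic]; [left|right]; apply: full => //.
apply/eqP; rewrite -(eqn_modDr (c + e)) addnA; move: ic dsum.
by rewrite /dvdn (addnC c) addnA => /eqP -> /eqP ->.
Qed.

Lemma stable_count_inert : (forall c, ~~ (p %| quad e c)%N) ->
  forall k, (k <= K)%N -> stable_count (p ^ k)%N = ~~ odd k.
Proof.
move=> h; have z k : cyclic_count (p ^ k.+1)%N = 0%N.
  apply: cyclic_count0 => c; apply: contra (h c); apply: dvdn_trans.
  by rewrite expnS dvdn_mulr.
apply: (stable_count_step (f := fun k => (~~ odd k : nat))) => //.
  by rewrite -[p in cyclic_count p]expn1 z.
by move=> k _; rewrite z addn0 /= negbK.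
Qed.

Lemma stable_count_ramified : (p %| e + 2)%N -> (forall c, (p %| quad e c)%N -> c = 1 %[mod p]) ->
  (forall c, ~~ (p ^ 2 %| quad e c)%N) -> forall k, (k <= K)%N -> stable_count (p ^ k)%N = 1%N.
Proof.
move=> pe h1 h2; apply: (stable_count_step (f := fun _ => 1%N)) => //.
  by move=> K0; rewrite cyclic_count_ramified.
move=> k _; rewrite cyclic_count0 // => c; apply: contra (h2 c); apply: dvdn_trans.
by rewrite dvdn_exp2l.
Qed.

Lemma stable_count_split : (e <= 1)%N -> ~~ (p %| 4 - e * e)%N ->
  (forall k, exists c, (p ^ k %| quad e c)%N) ->
  forall k, (k <= K)%N -> stable_count (p ^ k)%N = k.+1.
Proof.
move=> e1 np h; apply: (stable_count_step (f := S)) => //.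
  by move=> K0; rewrite -[p in cyclic_count p]expn1 cyclic_count_split.
by move=> k kK; rewrite cyclic_count_split // addn2.
Qed.

End PrimePower.
End StableSubgroups.

(** * Roots of c^2 + ec + 1 modulo prime powers, and divisor sums *)

Section Arithmetic.
Local Open Scope nat_scope.

Lemma cube_quad c m : m %| quad 1 c -> c ^ 3 = 1 %[mod m].
Proof.
move=> h; have E : c ^ 3 + quad 1 c = c * quad 1 c + 1.
  by rewrite /quad !expnS expn0; ring.
apply/eqP; rewrite -(eqn_modDr (quad 1 c)) E -modnDml -[X in _ == X]modnDmr (eqP h).
by rewrite -modnMmr (eqP h) muln0 mod0n.
Qed.

Lemma fourth_quad c m : m %| quad 0 c -> c ^ 4 = 1 %[mod m].
Proof.
move=> h; have E : c ^ 4 + quad 0 c = c ^ 2 * quad 0 c + 1.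
  by rewrite /quad !expnS expn0; ring.
apply/eqP; rewrite -(eqn_modDr (quad 0 c)) E -modnDml -[X in _ == X]modnDmr (eqP h).
by rewrite -modnMmr (eqP h) muln0 mod0n.
Qed.

Lemma quad_coprime e c p : prime p -> p %| quad e c -> coprime c p.
Proof.
move=> pp h; rewrite coprime_sym prime_coprime //; apply/negP => pc.
move: h; rewrite /quad dvdn_addr; first by rewrite Euclid_dvd1.
by rewrite dvdn_add // dvdn_mull.
Qed.

Lemma expn_mod1 c m q r : c ^ m = 1 %[mod q] -> c ^ (m * r) = 1 %[mod q].
Proof. by move=> h; rewrite expnM -modnXm h modnXm exp1n. Qed.

Lemma fermat c p : prime p -> coprime c p -> c ^ p.-1 = 1 %[mod p].
Proof. by move=> pp h; rewrite -(Euler_exp_totient h) totient_prime. Qed.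

(** c^3 = 1 and c^(p-1) = 1 with p - 1 = 1 modulo 3 give c = 1, and then p divides
    3. *)
Lemma inert3 p c : prime p -> p = 2 %[mod 3] -> ~~ (p %| quad 1 c).
Proof.
move=> pp p2; apply/negP => h; have c3 := cube_quad h.
have := fermat pp (quad_coprime pp h).
have -> : p.-1 = 3 * (p %/ 3) + 1 by move: p2 (prime_gt0 pp); lia.
rewrite expnD -modnMml (expn_mod1 _ c3) modnMml mul1n expn1 => c1.
have : p %| quad 1 1.
  by move: h; rewrite /quad /dvdn !mul1n -modnDml -(modnDm (c * c)) -modnMm c1 modnMm modnDm modnDml.
rewrite (_ : quad 1 1 = 3) // dvdn_prime2 // => /eqP p3.
by rewrite p3 in p2.
Qed.

(** c^4 = 1 and c^(p-1) = 1 with p - 1 = 2 modulo 4 give c^2 = 1, and then p divides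
    2. *)
Lemma inert4 p c : prime p -> p = 3 %[mod 4] -> ~~ (p %| quad 0 c).
Proof.
move=> pp p2; apply/negP => h; have c4 := fourth_quad h.
have := fermat pp (quad_coprime pp h).
have -> : p.-1 = 4 * (p %/ 4) + 2 by move: p2 (prime_gt0 pp); lia.
rewrite expnD -modnMml (expn_mod1 _ c4) modnMml mul1n => c1.
have : p %| 2.
  by move: h; rewrite /quad /dvdn mul0n addn0 mulnn -modnDml c1 modnDml.
rewrite dvdn_prime2 // => /eqP p3.
by rewrite p3 in p2.
Qed.

Lemma ramified3 c : 3 %| quad 1 c -> c = 1 %[mod 3].
Proof.
rewrite /quad /dvdn mul1n -modnDml -(modnDm (c * c)) -(modnMm c c).
have : c %% 3 < 3 by rewrite ltn_mod.
by case: (c %% 3) => [|[|[|]]].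
Qed.

Lemma ramified3_sq c : ~~ (3 ^ 2 %| quad 1 c).
Proof.
rewrite /quad /dvdn mul1n -modnDml -(modnDm (c * c)) -(modnMm c c) (_ : 3 ^ 2 = 9) //.
have : c %% 9 < 9 by rewrite ltn_mod.
by case: (c %% 9) => [|[|[|[|[|[|[|[|[|]]]]]]]]].
Qed.

Lemma ramified4 c : 2 %| quad 0 c -> c = 1 %[mod 2].
Proof.
rewrite /quad /dvdn mul0n addn0 -modnDml -(modnMm c c).
have : c %% 2 < 2 by rewrite ltn_mod.
by case: (c %% 2) => [|[|]].
Qed.

Lemma ramified4_sq c : ~~ (2 ^ 2 %| quad 0 c).
Proof.
rewrite /quad /dvdn mul0n addn0 -modnDml -(modnMm c c) (_ : 2 ^ 2 = 4) //.
have : c %% 4 < 4 by rewrite ltn_mod.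
by case: (c %% 4) => [|[|[|[|]]]].
Qed.

(** X^n - 1 has at most n roots in the field with p elements. *)
Lemma ex_nonpower p n : prime p -> 0 < n < p.-1 ->
  exists2 g, coprime g p & g ^ n <> 1 %[mod p].
Proof.
move=> pp /andP[n0 np].
case: (pickP (fun x : 'F_p => (x != 0%R) && (x ^+ n != 1)%R)) => [x /andP[x0 xn]|none].
  have gx : ((x : nat)%:R = x :> 'F_p)%R by rewrite natr_Zp.
  exists x.
    rewrite coprime_sym prime_coprime //; apply: contra x0 => px.
    by rewrite -gx -(Fp_nat_mod pp) (eqP px).
  move=> h; case/eqP: xn; rewrite -gx -natrX -(Fp_nat_mod pp) h.
  by rewrite Fp_nat_mod.
have : (size (enum [pred x : 'F_p | x != 0%R]) <= n)%N.
  apply: max_unity_roots => //; last exact: enum_uniq.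
  apply/allP => x; rewrite mem_enum inE => x0.
  by have := none x; rewrite x0 /= => /negbFE; rewrite unity_rootE.
rewrite -cardE (cardC1 (0%R : 'F_p)) card_Fp // leqNgt => /negP; case.
exact: np.
Qed.

Lemma exp_pow_prime h p j : prime p -> coprime h p -> h ^ (p ^ j) = h %[mod p].
Proof.
move=> pp cop; elim: j => [|j IH]; first by rewrite expn0 expn1.
rewrite expnSr expnM -modnXm IH modnXm -{1}(prednK (prime_gt0 pp)) expnS.
by rewrite -modnMmr (fermat pp cop) modnMmr muln1.
Qed.

(** For g with g^(nr) different from 1 modulo p, take c = g^(n p^(k-1)): c^d is 1 by
    the theorem of Euler, and c = g^n modulo p. *)
Lemma ex_root p k d n r : prime p -> p.-1 = d * n -> 0 < r < d -> exists c,
  c ^ d = 1 %[mod p ^ k] /\ c ^ r <> 1 %[mod p].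
Proof.
move=> pp E /andP[r0 rd]; have p1 := prime_gt1 pp.
have n0 : 0 < n by move: E p1; case: n => //; lia.
have [|g cg ng] := @ex_nonpower p (n * r) pp.
  by rewrite muln_gt0 n0 r0 E mulnC ltn_pmul2r.
exists ((g ^ n) ^ (p ^ k.-1)); split.
  case: k => [|k]; first by rewrite expn0 !modn1.
  rewrite -!expnM /= (_ : (n * ((p ^ k) * d))%N = totient (p ^ k.+1)).
    by apply: Euler_exp_totient; rewrite coprimeXr.
  by rewrite totient_pfactor //= E; ring.
move=> h; apply: ng; rewrite -h -!expnM [p ^ _ * r]mulnC mulnA [in RHS]expnM.
by apply/esym/exp_pow_prime => //; rewrite coprimeXl.
Qed.

(** p does not divide the factor c^r - 1 of c^d - 1, so p^k divides the other one. *)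
Lemma root_cofactor p k e c d r : prime p -> (0 < r)%N -> (0 < d)%N ->
  c ^ d = 1 %[mod p ^ k] -> c ^ r <> 1 %[mod p] ->
  (0 < c -> (c ^ r - 1) * quad e c = c ^ d - 1) -> exists c, p ^ k %| quad e c.
Proof.
move=> pp r0 d0 hd hr id; case: (posnP c) => [c0|c0].
  exists 0; move/eqP: hd; rewrite c0 exp0n // eq_sym eqn_mod_dvd // subn0.
  by move/dvdn_trans; apply; rewrite dvd1n.
exists c; rewrite -(@Gauss_dvdr _ (c ^ r - 1)).
  by rewrite id // -eqn_mod_dvd ?expn_gt0 ?c0 //; apply/eqP.
case: k hd => [|k] hd; first by rewrite expn0 coprime1n.
rewrite coprimeXl // prime_coprime //; apply/negP => h; apply: hr; apply/eqP.
by rewrite eqn_mod_dvd ?expn_gt0 ?c0.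
Qed.

Lemma split3 p k : prime p -> p = 1 %[mod 3] -> exists c, p ^ k %| quad 1 c.
Proof.
move=> pp p3; have E : p.-1 = 3 * (p.-1 %/ 3) by move: p3 (prime_gt0 pp); lia.
have [c [c3 c1]] := ex_root k pp E (isT : 0 < 1 < 3).
apply: (root_cofactor pp _ _ c3 c1) => // c0.
apply/eqP; rewrite -(eqn_add2r 1) subnK ?expn_gt0 ?c0 // expn1 /quad.
by case: c c0 {c1 c3} => // c _; rewrite subn1 /= !expnS expn0; apply/eqP; ring.
Qed.

Lemma split4 p k : prime p -> p = 1 %[mod 4] -> exists c, p ^ k %| quad 0 c.
Proof.
move=> pp p4; have E : p.-1 = 4 * (p.-1 %/ 4) by move: p4 (prime_gt0 pp); lia.
have [c [c4 c2]] := ex_root k pp E (isT : 0 < 2 < 4).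
apply: (root_cofactor pp _ _ c4 c2) => // c0.
rewrite /quad mul0n addn0 mulnn -[4]/(2 * 2) expnM; move: (c ^ 2) => z.
by rewrite mulnBl !mul1n mulnDr muln1 mulnn addnC subnDl.
Qed.

Definition sigma m := \sum_(d <- divisors m) d.

(** Divisors of ab are the products of a divisor of a and one of b, recovered as
    gcds. *)
Lemma sigma_mul a b : 0 < a -> 0 < b -> coprime a b -> sigma (a * b) = sigma a * sigma b.
Proof.
move=> a0 b0 cop; have ab0 : 0 < a * b by rewrite muln_gt0 a0.
have P : perm_eq (divisors (a * b)) [seq x * y | x <- divisors a, y <- divisors b].
  have key x y : x %| a -> y %| b -> gcdn (x * y) a = x.
    move=> xa yb; rewrite gcdnC Gauss_gcdl ?(gcdn_idPr xa) //.
    exact: coprime_dvdr yb cop.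
  have key2 x y : x %| a -> y %| b -> gcdn (x * y) b = y.
    move=> xa yb; rewrite gcdnC Gauss_gcdr ?(gcdn_idPr yb) //.
    by rewrite coprime_sym (coprime_dvdl xa).
  apply: uniq_perm; first exact: divisors_uniq.
    apply: allpairs_uniq; rewrite ?divisors_uniq // => -[x y] [x' y'].
    move=> /allpairsP[[u v] /= [ua vb [-> ->]]] /allpairsP[[u' v'] /= [ua' vb' [-> ->]]] E.
    rewrite -!dvdn_divisors // in ua vb ua' vb'.
    by rewrite -(key u v) // E key // -{1}(key2 u v) // E key2.
  move=> d; rewrite -dvdn_divisors //; apply/idP/allpairsP => [dab|[[x y] /= [xa yb ->]]].
    exists (gcdn d a, gcdn d b); rewrite -!dvdn_divisors //= !dvdn_gcdr; split=> //.
    apply/eqP; rewrite eqn_dvd; apply/andP; split.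
      rewrite muln_gcdr dvdn_gcd dvdn_mull //= muln_gcdl dvdn_gcd dvdn_mulr //=.
    rewrite Gauss_dvd ?dvdn_gcdl //.
    by apply: (coprime_dvdl (dvdn_gcdr _ _)); apply: coprime_dvdr (dvdn_gcdr _ _) cop.
  by rewrite -!dvdn_divisors // in xa yb; apply: dvdn_mul.
rewrite /sigma (perm_big _ P) big_allpairs_dep big_distrl /=.
by apply: eq_bigr => x _; rewrite big_distrr.
Qed.

Lemma sigma_pow p k : prime p -> sigma (p ^ k) = \sum_(i < k.+1) p ^ i.
Proof.
move=> pp; have p1 := prime_gt1 pp; have pk0 : 0 < p ^ k by rewrite expn_gt0 prime_gt0.
rewrite /sigma (perm_big [seq p ^ i | i <- iota 0 k.+1]).
  by rewrite big_map -(big_mkord xpredT (expn p)) /index_iota subn0.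
apply: uniq_perm; first exact: divisors_uniq.
  by rewrite map_inj_uniq ?iota_uniq //; apply: expnI.
move=> d; rewrite -dvdn_divisors //; apply/(dvdn_pfactor _ _ pp)/mapP => [[i ik ->]|[i + ->]].
  by exists i; rewrite // mem_iota.
by rewrite mem_iota => ik; exists i.
Qed.

(** Multiplicative functions are determined by their values at prime powers. *)
Lemma eq_mult (f g : nat -> nat) : f 1 = g 1 ->
  (forall a b, 0 < a -> 0 < b -> coprime a b -> f (a * b) = f a * f b) ->
  (forall a b, 0 < a -> 0 < b -> coprime a b -> g (a * b) = g a * g b) ->
  (forall p k, prime p -> 0 < k -> f (p ^ k) = g (p ^ k)) ->
  forall m, 0 < m -> f m = g m.
Proof.
move=> fg1 fM gM fgp; elim/ltn_ind => m IH m0.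
case: (leqP m 1) => [m1|m1]; first by have -> : m = 1 by lia.
have pp := pdiv_prime m1; set p := pdiv m in pp.
have cop : coprime m`_p m`_p^' by apply: coprime_partC.
rewrite -(partnC p m0) fM ?gM ?part_gt0 //; congr (_ * _).
  rewrite p_part; apply: fgp => //.
  by rewrite logn_gt0 mem_primes pp m0 pdiv_dvd.
apply: IH; last by rewrite part_gt0.
rewrite -[X in _ < X](partnC p m0) -{1}(mul1n m`_p^') ltn_pmul2r ?part_gt0 //.
by rewrite p_part_gt1 mem_primes pp m0 pdiv_dvd.
Qed.

End Arithmetic.

(** * Torsion subgroups as finite groups *)

Section TorsionGroup.
Variables (A : zmodType) (n : nat) (s : seq A).
Hypothesis ms : forall P, (P \in s) = (P *+ n == 0).

(** The n-torsion of A, listed by s, as a type on which a finite group structure can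
    be declared. *)
Definition tgroup of (forall P : A, (P \in s) = (P *+ n == 0)) : Type := seq_sub s.
Notation G := (tgroup ms).
HB.instance Definition _ := Finite.on G.
HB.instance Definition _ := SubType.on G.

Lemma tgroup_zero : (0 : A) \in s. Proof. by rewrite ms mul0rn. Qed.
Lemma tgroup_add (x y : G) : val x + val y \in s.
Proof.
by have := valP x; have := valP y; rewrite /= !ms mulrnDl => /eqP -> /eqP ->; rewrite addr0.
Qed.
Lemma tgroup_opp (x : G) : - val x \in s.
Proof. by have := valP x; rewrite /= !ms mulNrn => /eqP ->; rewrite oppr0. Qed.

Definition tg1 : G := SeqSub tgroup_zero.
Definition tgM (x y : G) : G := SeqSub (tgroup_add x y).
Definition tgV (x : G) : G := SeqSub (tgroup_opp x).

Lemma tgA : associative tgM. Proof. by move=> x y z; apply: val_inj; rewrite /= addrA. Qed.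
Lemma tg1M : left_id tg1 tgM. Proof. by move=> x; apply: val_inj; rewrite /= add0r. Qed.
Lemma tgVM : left_inverse tg1 tgV tgM.
Proof. by move=> x; apply: val_inj; rewrite /= addNr. Qed.
HB.instance Definition _ := Finite_isGroup.Build G tgA tg1M tgVM.

Lemma tgroup_valM (x y : G) : val (x * y)%g = val x + val y. Proof. by []. Qed.
Lemma tgroup_val1 : val (1%g : G) = 0. Proof. by []. Qed.
Lemma tgroup_valX (x : G) d : val (x ^+ d)%g = val x *+ d.
Proof.
by elim: d => [|d IH]; rewrite ?expg0 ?mulr0n // expgS tgroup_valM IH mulrS.
Qed.
Lemma tgroup_mulC (x y : G) : (x * y = y * x)%g.
Proof. by apply: val_inj; rewrite !tgroup_valM addrC. Qed.

End TorsionGroup.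

Local Open Scope classical_set_scope.
Local Open Scope ring_scope.

Lemma card_set_of (T : finType) (S : {set T}) : ([set` S] #= `I_#|S|)%card.
Proof.
have e : [set` S] = enum_val @` [set: 'I_#|S|].
  apply/seteqP; split=> [x xS|_ [i _ <-]]; last exact: enum_valP.
  by exists (enum_rank_in xS x) => //; apply: enum_rankK_in.
rewrite e; apply: card_eq_trans (inj_card_eq _) _; last by rewrite card_eq_sym card_II.
by move=> i j _ _; apply: enum_val_inj.
Qed.

Section StableSets.
Variables (A : zmodType) (tau : A -> A).
Hypotheses (tauD : {morph tau : P Q / P + Q}) (tauI : injective tau).
Hypothesis tors : forall n, (0 < n)%N -> exists s : seq A,
  [/\ uniq s, size s = (n ^ 2)%N & forall P, (P \in s) = (P *+ n == 0)].

(** For A the points of an elliptic curve, zsub, zstable and zpsi unfold to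
    subgroup, stable_subgroups and psi. *)
Definition zsub (H : set A) :=
  [/\ H 0, forall P, H P -> H (- P) & forall P Q, H P -> H Q -> H (P + Q)].
Definition zstable (m : nat) : set (set A) :=
  [set H | [/\ zsub H, (H #= `I_m)%card & tau @` H = H]].
Definition zpsi m := #|` fset_set (zstable m)|.

Lemma tau0 : tau 0 = 0.
Proof. by apply: (addrI (tau 0)); rewrite -tauD !addr0. Qed.

Lemma tauX P d : tau (P *+ d) = tau P *+ d.
Proof. by elim: d => [|d IH]; rewrite ?mulr0n ?tau0 // !mulrS tauD IH. Qed.

(** Lagrange for finite subgroups of an arbitrary abelian group. *)
Lemma zsub_torsion H m P : zsub H -> (H #= `I_m)%card -> H P -> P *+ m = 0.
Proof.
move=> [H0 HN HD] cH HP.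
have /finite_fsetP[X eX] : finite_set H by apply/finite_setP; exists m.
have memX Q : (Q \in X) <-> H Q by rewrite eX.
have szX : #|` X| = m by apply/card_eq_fsetP; rewrite -eX.
(* Lagrange: summing the translates Q + P over the subgroup gives S = S + m P *)
have perm : perm_eq [seq Q + P | Q <- X] X.
  apply: uniq_perm; rewrite ?fset_uniq ?(map_inj_uniq (addIr P)) ?fset_uniq // => Q.
  apply/mapP/idP => [[R /memX HR ->]|/memX HQ]; first exact/memX/HD.
  by exists (Q - P); rewrite ?subrK //; apply/memX/HD/HN.
have := perm_big _ perm (op := +%R) (x := 0) (P := xpredT) (F := id).
rewrite big_map /= big_split /= big_const_seq count_predT iter_addr_0 => /eqP.
by rewrite -subr_eq0 addrAC subrr add0r szX => /eqP.
Qed.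

Section Level.
Variables (n : nat) (s : seq A).
Hypotheses (n0 : (0 < n)%N) (ms : forall P, (P \in s) = (P *+ n == 0)).
Notation G := (tgroup ms).

Lemma tau_tors (x : G) : tau (val x) \in s.
Proof. by rewrite ms -tauX; have := valP x; rewrite /= ms => /eqP ->; rewrite tau0. Qed.

Definition tgroup_tau (x : G) : G := SeqSub (tau_tors x).

Lemma tgroup_tauM : {morph tgroup_tau : x y / (x * y)%g}.
Proof. by move=> x y; apply: val_inj; rewrite /= tauD. Qed.

Lemma tgroup_tauI : injective tgroup_tau.
Proof. by move=> x y /(congr1 val) /= /tauI/val_inj. Qed.

Definition lift_set (K : {group G}) : set A := [set val x | x in [set` K]].

Lemma lift_inj : injective lift_set.
Proof.
have sub K K' : lift_set K = lift_set K' -> K \subset K'.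
  move=> e; apply/fintype.subsetP => x xK; have : lift_set K (val x) by exists x.
  by rewrite e => -[y yK' /val_inj <-].
by move=> K K' e; apply/eqP; rewrite -val_eqE finset.eqEsubset !sub.
Qed.

Lemma lift_card K : (lift_set K #= `I_#|K|)%card.
Proof.
apply: card_eq_trans (inj_card_eq _) (card_set_of K).
by move=> x y _ _; apply: val_inj.
Qed.

Lemma card_eq_ord (T : choiceType) (H : set T) i j : (H #= `I_i)%card -> (H #= `I_j)%card -> i = j.
Proof. by move=> /card_fset_set <- /card_fset_set <-. Qed.

Lemma zstable_lift m : (m %| n)%N ->
  zstable m = lift_set @` [set` [set K : {group G} | (#|K| == m) && tstable tgroup_tau K]%SET].
Proof.
move=> mn; apply/seteqP; split=> [H [zH cH sH]|H [K]]; last first.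
  rewrite /= inE => /andP[/eqP cK sK] <-; split.
  - split; first by exists 1%g; [apply: group1 | apply: tgroup_val1].
      by move=> _ [x xK <-]; exists (x^-1)%g => //; apply: groupVr.
    by move=> _ _ [x xK <-] [y yK <-]; exists (x * y)%g => //; apply: groupM.
  - by rewrite -cK; apply: lift_card.
  apply/seteqP; split=> [_ [_ [x xK <-] <-]|_ [x xK <-]].
    by exists (tgroup_tau x) => //; apply: (tstableP tgroup_tauI K sK).
  have : x \in tgroup_tau @: K by rewrite (eqP sK).
  by case/imsetP=> y yK ->; exists (val y) => //; exists y.
have [H0 HN HD] := zH.
have Hs P : H P -> P \in s.
  move=> HP; rewrite ms; case/dvdnP: mn => q ->.
  by rewrite mulnC mulrnA (zsub_torsion zH cH HP) mul0rn.
pose KS := [set x : G | `[< H (val x) >]]%SET.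
have memK x : (x \in KS) <-> H (val x) by rewrite inE; split=> /asboolP.
have gK : group_set KS.
  apply/group_setP; split; first exact/memK.
  by move=> x y /memK Hx /memK Hy; apply/memK; apply: HD.
pose K := Group gK.
have eH : lift_set K = H.
  apply/seteqP; split=> [_ [x /memK Hx <-] //|P HP].
  by exists (SeqSub (Hs P HP) : G) => //; apply/memK.
exists K => //=; rewrite inE; apply/andP; split.
  by apply/eqP; apply: (card_eq_ord (lift_card K)); rewrite eH.
apply/(tstableP tgroup_tauI) => x /memK Hx; apply/memK.
by rewrite -sH; exists (val x).
Qed.

(** A subgroup of order m lies in the n-torsion as soon as m divides n, so it can be
    counted there. *)
Lemma zpsi_stable_count m : (m %| n)%N ->
  finite_set (zstable m) /\ zpsi m = stable_count tgroup_tau m.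
Proof.
move=> mn; have c : (zstable m #= `I_(stable_count tgroup_tau m))%card.
  rewrite (zstable_lift mn) /stable_count; set S := [set K : {group G} | _]%SET.
  have injS : {in [set` S] &, injective lift_set} by move=> K K' _ _; apply: lift_inj.
  exact: card_eq_trans (inj_card_eq injS) (card_set_of S).
by split; [apply/finite_setP; exists (stable_count tgroup_tau m) | apply: card_fset_set].
Qed.

Lemma tgroup_tors d : (d %| n)%N -> #|[set x : G | (x ^+ d == 1)%g]%SET| = (d * d)%N.
Proof.
move=> dn; have d0 : (0 < d)%N by apply: dvdn_gt0 dn.
have [sd [us ss hs]] := tors d0.
rewrite mulnn -ss cardE -(size_map val); apply: perm_size; apply: uniq_perm => //.
  by rewrite (map_inj_uniq val_inj) enum_uniq.
move=> P; rewrite hs; apply/mapP/eqP => [[x]|hP].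
  by rewrite mem_enum inE => /eqP hx ->; rewrite -tgroup_valX hx.
have Ps : P \in s by rewrite ms; case/dvdnP: dn => q ->; rewrite mulnC mulrnA hP mul0rn.
exists (SeqSub Ps : G) => //; rewrite mem_enum inE; apply/eqP/val_inj.
by rewrite tgroup_valX.
Qed.

End Level.

Lemma zstable_finite m : (0 < m)%N -> finite_set (zstable m).
Proof. by move=> m0; have [s [_ _ ms]] := tors m0; case: (zpsi_stable_count ms (dvdnn m)). Qed.

Lemma zpsi_mul a b : (0 < a)%N -> (0 < b)%N -> coprime a b ->
  zpsi (a * b) = (zpsi a * zpsi b)%N.
Proof.
move=> a0 b0 cab; have ab0 : (0 < a * b)%N by rewrite muln_gt0 a0.
have [s [_ _ ms]] := tors ab0.
rewrite (zpsi_stable_count ms (dvdnn _)).2 (zpsi_stable_count ms (dvdn_mulr b (dvdnn a))).2.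
rewrite (zpsi_stable_count ms (dvdn_mull a (dvdnn b))).2.
by apply: stable_count_mul => //; [apply: tgroup_mulC | apply: tgroup_tauM | apply: tgroup_tauI].
Qed.

Section PrimePower.
Variables (p : nat) (k : nat).
Hypothesis p_pr : prime p.

Lemma pk_gt0 : (0 < p ^ k)%N. Proof. by rewrite expn_gt0 prime_gt0. Qed.

Lemma zpsi_all : (forall P, tau P = - P) -> zpsi (p ^ k) = (\sum_(i < k.+1) p ^ i)%N.
Proof.
move=> tauN; have [s [_ _ ms]] := tors pk_gt0.
rewrite (zpsi_stable_count ms (dvdnn _)).2.
apply: (@stable_count_all _ _ (@tgroup_mulC _ _ _ ms) (@tgroup_tauM _ _ ms) (@tgroup_tauI _ _ ms) p k p_pr) => //.
  by move=> j jk; apply: (tgroup_tors pk_gt0); rewrite dvdn_exp2l.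
move=> K; apply/(tstableP (@tgroup_tauI _ _ ms)) => x xK.
suff -> : tgroup_tau x = (x^-1)%g by apply: groupVr.
by apply: val_inj; rewrite /= tauN.
Qed.

Variable e : nat.
Hypothesis rel : forall P, tau (tau P) + tau P *+ e + P = 0.
Hypothesis ns : forall c, (p %| quad e c)%N -> ~ forall P, P *+ p = 0 -> tau P = P *+ c.

Section Transfer.
Variable s : seq A.
Hypothesis ms : forall P, (P \in s) = (P *+ (p ^ k) == 0).
Notation G := (tgroup ms).
Notation t := (@tgroup_tau _ _ ms).

Lemma tgroup_rel (x : G) : (t (t x) * t x ^+ e * x = 1)%g.
Proof. by apply: val_inj; rewrite !tgroup_valM tgroup_valX /= rel. Qed.

Lemma tgroup_ns : (0 < k)%N -> forall c, (p %| quad e c)%N ->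
  exists2 x : G, (x ^+ p = 1)%g & t x <> (x ^+ c)%g.
Proof.
move=> k0 c pc; apply: contrapT => h; apply: (ns pc) => P Pp.
have Ps : P \in s by rewrite ms -(prednK k0) expnS mulrnA Pp mul0rn.
apply: contrapT => neq; apply: h; exists (SeqSub Ps : G).
  by apply: val_inj; rewrite tgroup_valX.
by move/(congr1 val); rewrite tgroup_valX.
Qed.

Lemma tgroup_tors_pow j : (j <= k)%N -> #|[set x : G | (x ^+ (p ^ j)%N == 1)%g]%SET| = (p ^ j * p ^ j)%N.
Proof. by move=> jk; apply: (tgroup_tors pk_gt0); rewrite dvdn_exp2l. Qed.
End Transfer.

Lemma zpsi_inert : (0 < k)%N -> (forall c, ~~ (p %| quad e c)%N) -> zpsi (p ^ k) = ~~ odd k.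
Proof.
move=> k0 h; have [s [_ _ ms]] := tors pk_gt0; rewrite (zpsi_stable_count ms (dvdnn _)).2.
by apply: (stable_count_inert (@tgroup_mulC _ _ _ ms) (@tgroup_tauM _ _ ms) (@tgroup_tauI _ _ ms) p_pr
  (@tgroup_tors_pow _ ms) (@tgroup_rel _ ms) h).
Qed.

Lemma zpsi_ramified : (0 < k)%N -> (p %| e + 2)%N ->
  (forall c, (p %| quad e c)%N -> c = 1 %[mod p]) ->
  (forall c, ~~ (p ^ 2 %| quad e c)%N) -> zpsi (p ^ k) = 1%N.
Proof.
move=> k0 h1 h2 h3; have [s [_ _ ms]] := tors pk_gt0; rewrite (zpsi_stable_count ms (dvdnn _)).2.
by apply: (stable_count_ramified (@tgroup_mulC _ _ _ ms) (@tgroup_tauM _ _ ms) (@tgroup_tauI _ _ ms) p_pr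
  (@tgroup_tors_pow _ ms) (@tgroup_rel _ ms) (tgroup_ns ms k0) h1 h2 h3).
Qed.

Lemma zpsi_split : (0 < k)%N -> (e <= 1)%N -> ~~ (p %| 4 - e * e)%N ->
  (forall j, exists c, (p ^ j %| quad e c)%N) -> zpsi (p ^ k) = k.+1.
Proof.
move=> k0 h1 h2 h3; have [s [_ _ ms]] := tors pk_gt0; rewrite (zpsi_stable_count ms (dvdnn _)).2.
by apply: (stable_count_split (@tgroup_mulC _ _ _ ms) (@tgroup_tauM _ _ ms) (@tgroup_tauI _ _ ms) p_pr
  (@tgroup_tors_pow _ ms) (@tgroup_rel _ ms) (tgroup_ns ms k0) h1 h2 h3).
Qed.

End PrimePower.

Lemma zpsi_sigma : (forall P, tau P = - P) -> forall m, (0 < m)%N -> zpsi m = sigma m.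
Proof.
move=> tauN; have one q : prime q -> zpsi 1 = 1%N.
  by move=> pq; rewrite -(expn0 q) zpsi_all // big_ord1.
apply: eq_mult => [|||p k pp k0]; first by rewrite (one 2) // /sigma big_seq1.
- exact: zpsi_mul.
- exact: sigma_mul.
by rewrite zpsi_all // sigma_pow.
Qed.

End StableSets.

(** * Stable subgroups of an elliptic curve *)

Section Scaling.
Variables (k : closedFieldType) (a b : k).
Hypothesis char0 : [pchar k] =i pred0.
Hypothesis disc_neq0 : 4 * a ^+ 3 + 27 * b ^+ 2 != 0.
Notation W := (Weierstrass 0 0 0 a b).
Variables (A : zmodType) (co : A -> option (k * k)).
Hypotheses (co_on : forall P, on_curve W (co P)) (co0 : co 0 = None)
  (coN : forall P, co (- P) = raw_opp W (co P))
  (coD : forall P Q, co (P + Q) = raw_add W (co P) (co Q))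
  (co_inj : injective co)
  (co_surj : forall R, on_curve W R -> exists P, co P = R).
Variables (tau : A -> A) (w : k).

(** Maps the curve to itself when a w^4 = a and b w^6 = b. *)
Definition scale (R : option (k * k)) :=
  if R is Some (x, y) then Some (w ^+ 2 * x, w ^+ 3 * y) else None.

Hypotheses (w_neq0 : w != 0) (wa : a * w ^+ 4 = a) (co_tau : forall P, co (tau P) = scale (co P)).

Let two_neq0 : (2 : k) != 0 := natr_neq0 char0 1.

(** Scaling by w multiplies the slope of a chord by w. *)
Lemma tau_add : {morph tau : P Q / P + Q}.
Proof.
move=> P Q; apply: co_inj; rewrite co_tau !coD !co_tau.
have onP := co_on P; have onQ := co_on Q.
have onP' := co_on (tau P); have onQ' := co_on (tau Q); rewrite !co_tau in onP' onQ'.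
case: (co P) onP onP' => [[x1 y1]|] // onP onP'.
case: (co Q) onQ onQ' => [[x2 y2]|] // onQ onQ'.
case: (pselect (Some (x1, y1) = raw_opp W (Some (x2, y2)))) => [e|ne].
  rewrite [in LHS]e addNP; rewrite short_opp in e; case: e => -> ->.
  by rewrite /scale mulrN -(short_opp a b) addNP.
have [l c] := chord_ex onP onQ ne.
rewrite (add_chord two_neq0 disc_neq0 onP onQ c).
rewrite (add_chord (l := w * l) two_neq0 disc_neq0 onP' onQ'); last first.
  case: c => c1 c2; split.
    by apply: (eq_of_diff (congr1 ( *%R (w ^+ 3)) c1)); ring.
  have := congr1 ( *%R (w ^+ 4)) c2; rewrite !mulrDr [w ^+ 4 * a]mulrC wa => E.
  by apply: (eq_of_diff E); ring.
by congr (Some (_, _)); ring.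
Qed.

Lemma tau_inj : injective tau.
Proof.
move=> P Q /(congr1 co); rewrite !co_tau => e; apply: co_inj.
case: (co P) (co Q) e => [[x1 y1]|] [[x2 y2]|] //= [/mulfI e1 /mulfI e2].
by rewrite e1 ?e2 ?expf_neq0.
Qed.

Lemma torsion n : (0 < n)%N -> exists s : seq A,
  [/\ uniq s, size s = (n ^ 2)%N & forall P, (P \in s) = (P *+ n == 0)].
Proof.
exact: (torsion_count char0 two_neq0 disc_neq0 co_on co0 coN coD co_inj co_surj).
Qed.

Lemma tau_not_scalar p c : w ^+ 2 != 1 -> prime p -> coprime c p ->
  ~ forall P, P *+ p = 0 -> tau P = P *+ c.
Proof.
move=> w2 pp cop h.
have npc : ~~ (p %| c)%N by rewrite -prime_coprime // coprime_sym.
apply: (mul_not_scaling char0 two_neq0 disc_neq0 co_on co0 coN coD co_inj co_surj pp npc w2).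
by move=> P x y Pp cP; exists (w ^+ 3 * y); rewrite -h // co_tau cP.
Qed.

(** A point on neither axis, at which the power of w is visible. *)
Lemma generic_point : exists P x y, [/\ co P = Some (x, y), x != 0 & y != 0].
Proof.
have [x] : exists x, ~~ root ('X * short_poly a b) x.
  by apply/closed_nonrootP; rewrite mulf_neq0 ?polyX_eq0 // -size_poly_gt0 size_short_poly.
rewrite rootM negb_or /root hornerX short_polyE => /andP[x0 s0].
have [y ey] := sqrt_ex (short a b x).
have [|P cP] := co_surj (R := Some (x, y)); first by rewrite on_short ey.
by exists P, x, y; split=> //; apply: contra_neq s0 => y0; rewrite -ey y0 expr0n.
Qed.

Lemma co_iter i P x y : co P = Some (x, y) ->
  co (iter i tau P) = Some ((w ^+ i) ^+ 2 * x, (w ^+ i) ^+ 3 * y).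
Proof.
move=> cP; elim: i => [|i IH] /=; first by rewrite cP expr0 !expr1n !mul1r.
by rewrite co_tau IH /= (exprS w i); congr (Some (_, _)); ring.
Qed.

Lemma iter_id i : iter i tau =1 id <-> w ^+ i = 1.
Proof.
split=> [h|h P]; last first.
  apply: co_inj; case cP: (co P) => [[x y]|].
    by rewrite (co_iter i cP) h !expr1n !mul1r.
  by elim: i {h} => //= i IH; rewrite co_tau IH.
have [P [x [y [cP x0 y0]]]] := generic_point.
have := co_iter i cP; rewrite h cP => -[e2 e3].
have h2 : (w ^+ i) ^+ 2 = 1 by apply: (mulIf x0); rewrite mul1r -e2.
have h3 : (w ^+ i) ^+ 3 = 1 by apply: (mulIf y0); rewrite mul1r -e3.
by move: h3; rewrite exprS h2 mulr1.
Qed.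

Lemma zpsi_order2 : w = -1 -> forall m, (0 < m)%N -> zpsi tau m = sigma m.
Proof.
move=> w1; apply: (zpsi_sigma tau_add tau_inj torsion) => P; apply: co_inj.
rewrite co_tau coN; case: (co P) => [[x y]|] //; rewrite short_opp /= w1.
by congr (Some (_, _)); ring.
Qed.

(** Here tau^2 = - 1. *)
Lemma zpsi_order4 : w ^+ 2 = -1 -> forall p alpha, prime p -> (0 < alpha)%N ->
  [/\ zpsi tau (2 ^ alpha) = 1%N,
      p = 1 %[mod 4] -> zpsi tau (p ^ alpha) = alpha.+1 &
      p = 3 %[mod 4] -> zpsi tau (p ^ alpha) = ~~ odd alpha].
Proof.
move=> w2 p al pp al0; have w21 : w ^+ 2 != 1.
  by rewrite w2 -subr_eq0 -opprD oppr_eq0.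
have rel P : tau (tau P) + tau P *+ 0 + P = 0.
  rewrite mulr0n addr0; apply/eqP; rewrite addr_eq0; apply/eqP/co_inj.
  rewrite !co_tau coN; case: (co P) => [[x y]|] //; rewrite short_opp /=.
  have w3 : w ^+ 3 = - w by rewrite exprS w2 mulrN1.
  rewrite w3 mulrA -expr2 w2 !mulNr mulrN mulrA -expr2 w2; congr (Some (_, _)); ring.
have ns q : prime q -> forall c, (q %| quad 0 c)%N -> ~ forall P, P *+ q = 0 -> tau P = P *+ c.
  by move=> pq c qc; apply: tau_not_scalar => //; apply: quad_coprime qc.
split=> [|p1|p3].
- apply: (zpsi_ramified tau_add tau_inj torsion _ rel (ns 2 isT)) => //.
    exact: ramified4.
  exact: ramified4_sq.
- apply: (zpsi_split tau_add tau_inj torsion pp rel (ns p pp)) => //.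
    rewrite muln0 subn0 (_ : 4 = 2 ^ 2)%N // Euclid_dvdX // andbT dvdn_prime2 //.
    by apply/eqP => p2; rewrite p2 in p1.
  by move=> j; apply: split4.
apply: (zpsi_inert tau_add tau_inj torsion pp rel) => //.
by move=> c; apply: inert4.
Qed.

(** Here a = 0, and P, tau P, tau^2 P lie on a horizontal line, so their sum is 0. *)
Lemma zpsi_order3 : w ^+ 3 = 1 -> w != 1 -> forall p alpha, prime p -> (0 < alpha)%N ->
  [/\ zpsi tau (3 ^ alpha) = 1%N,
      p = 1 %[mod 3] -> zpsi tau (p ^ alpha) = alpha.+1 &
      p = 2 %[mod 3] -> zpsi tau (p ^ alpha) = ~~ odd alpha].
Proof.
move=> w3 w1 p al pp al0; have w21 : w ^+ 2 != 1.
  by apply: contra_neq w1 => w2; rewrite -[RHS]w3 exprS w2 mulr1.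
have w1' : w - 1 != 0 by rewrite subr_eq0.
have wq : w ^+ 2 + w + 1 = 0.
  by apply: (mulfI w1'); rewrite mulr0; apply: (eq_of_diff w3); ring.
have a0 : a = 0.
  by apply: (mulIf w1'); rewrite mul0r; apply: (eq_of_diff wa); rewrite exprS w3; ring.
have rel P : tau (tau P) + tau P *+ 1 + P = 0.
  rewrite mulr1n -addrA; apply/eqP; rewrite addr_eq0; apply/eqP.
  apply: co_inj; rewrite coN coD !co_tau.
  have onP := co_on P; have onT := co_on (tau P); rewrite co_tau in onT.
  case: (co P) onP onT => [[x y]|] // onP onT.
  rewrite (add_chord (l := 0) two_neq0 disc_neq0 onT onP); last first.
    split; first by rewrite w3; ring.
    rewrite mul0r a0; have -> : (w ^+ 2 * x) ^+ 2 + w ^+ 2 * x * x + x ^+ 2 + 0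
       = x ^+ 2 * (w ^+ 3 * w + w ^+ 2 + 1) by ring.
    by rewrite w3 mul1r (addrC w) wq mulr0.
  rewrite short_opp /= w3 !mul1r mul0r !sub0r opprK; congr (Some (_, _)).
  have -> : w ^+ 2 * (w ^+ 2 * x) = w ^+ 3 * w * x by ring.
  rewrite w3 mul1r expr0n /=; apply: (eq_of_diff (congr1 ( *%R x) wq)); ring.
have ns q : prime q -> forall c, (q %| quad 1 c)%N -> ~ forall P, P *+ q = 0 -> tau P = P *+ c.
  by move=> pq c qc; apply: tau_not_scalar => //; apply: quad_coprime qc.
split=> [|p1|p2].
- apply: (zpsi_ramified tau_add tau_inj torsion _ rel (ns 3 isT)) => //.
    exact: ramified3.
  exact: ramified3_sq.
- apply: (zpsi_split tau_add tau_inj torsion pp rel (ns p pp)) => //.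
    by rewrite (_ : 4 - 1 * 1 = 3)%N // dvdn_prime2 //; apply/eqP => p3; rewrite p3 in p1.
  by move=> j; apply: split3.
apply: (zpsi_inert tau_add tau_inj torsion pp rel) => //.
by move=> c; apply: inert3.
Qed.

End Scaling.

(** A subgroup is closed under opposites. *)
Lemma zstable_opp (A : zmodType) (tau : A -> A) m :
  zstable (fun P => - tau P) m = zstable tau m.
Proof.
apply/seteqP; split=> H [zH cH sH]; split=> //; have [_ HN _] := zH.
  apply/seteqP; split=> [_ [P HP <-]|P HP].
    by rewrite -[tau P]opprK; apply: HN; rewrite -sH; exists P.
  by have := HN _ HP; rewrite -{1}sH => -[Q HQ /oppr_inj <-]; exists Q.
apply/seteqP; split=> [_ [P HP <-]|P HP].
  by apply: HN; rewrite -sH; exists P.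
by have := HN _ HP; rewrite -{1}sH => -[Q HQ e]; exists Q; rewrite // e opprK.
Qed.

Lemma pow3_mod4 p al : p = 3 %[mod 4] -> (p ^ al %% 4)%N = if odd al then 3%N else 1%N.
Proof.
move=> p3; elim: al => [//|al IH]; rewrite expnS -modnMm IH p3 /=.
by case: (odd al).
Qed.

Lemma pow_mod4 p al : (0 < al)%N -> p ^ al = 3 %[mod 4] -> p = 3 %[mod 4].
Proof.
case: al => // al _; rewrite -modnXm; have : (p %% 4 < 4)%N by rewrite ltn_mod.
case: (p %% 4)%N => [|[|[|[|//]]]] _ //; first by rewrite exp0n.
  by rewrite exp1n.
by rewrite expnS; move: (2 ^ al)%N => z; lia.
Qed.

Theorem theoremA1 (k : closedFieldType) (char0 : [pchar k] =i pred0)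
    (E : weierstrass k) (smoothE : smooth E)
    (l : nat) (hl : l \in [:: 2; 3; 4; 6]%N)
    (xi : points E -> points E) (xi_aut : automorphism xi)
    (xi_origin : xi (origin E) = origin E) (xi_order : has_order xi l) :
  (forall m : nat, (0 < m)%N -> finite_set (stable_subgroups xi m)) /\
  (forall a b : nat, (0 < a)%N -> (0 < b)%N -> coprime a b ->
     psi xi (a * b) = (psi xi a * psi xi b)%N) /\
  (l = 2%N -> forall m : nat, (0 < m)%N ->
     psi xi m = (\sum_(d <- divisors m) d)%N) /\
  (l \in [:: 3; 6]%N -> forall p alpha : nat, prime p -> (1 <= alpha)%N ->
     [/\ psi xi (3 ^ alpha) = 1%N,
         p = 1 %[mod 3] -> psi xi (p ^ alpha) = (alpha + 1)%N &
         p = 2 %[mod 3] ->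
           (psi xi (p ^ alpha))%:Z = 2 * (alpha %/ 2)%N%:Z - alpha%:Z + 1]) /\
  (l = 4%N -> forall p alpha : nat, prime p -> (1 <= alpha)%N ->
     [/\ psi xi (2 ^ alpha) = 1%N,
         p ^ alpha = 1 %[mod 4] -> p = 1 %[mod 4] ->
           psi xi (p ^ alpha) = (alpha + 1)%N,
         p ^ alpha = 1 %[mod 4] -> p = 3 %[mod 4] ->
           psi xi (p ^ alpha) = 1%N &
         p ^ alpha = 3 %[mod 4] -> psi xi (p ^ alpha) = 0%N]).
Proof.
have two_neq0 : (2 : k) != 0 := natr_neq0 char0 1.
have three_neq0 : (3 : k) != 0 := natr_neq0 char0 2.
have disc := smooth_disc two_neq0 three_neq0 smoothE.
pose A : zmodType := ec_group two_neq0 three_neq0 smoothE.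
pose co : A -> option (k * k) := @short_pt k E.
have co_on P : on_curve _ (co P) := short_pt_on two_neq0 three_neq0 P.
have co0 : co 0 = None by [].
have coN P : co (- P) = raw_opp _ (co P) := short_pt_opp two_neq0 P.
have coD P Q : co (P + Q) = raw_add _ (co P) (co Q) := short_pt_add two_neq0 three_neq0 P Q.
have co_inj : injective co := @short_pt_inj k E.
have co_surj R := @short_pt_surj k E two_neq0 three_neq0 R.
have [w [w0 wa wb ws]] := automorphism_scaling two_neq0 three_neq0 xi_aut xi_origin.
pose tau : A -> A := xi.
have co_tau P : co (tau P) = scale w (co P).
  case cP: (co P) => [[x y]|]; first exact: ws cP.
  rewrite (co_none co0 co_inj cP) -[tau 0]/(xi (origin E)) xi_origin.
  exact: co0.
have psiE m : psi xi m = zpsi tau m by [].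
have tauD := tau_add char0 disc co_on coD co_inj wa co_tau.
have tauI := tau_inj co_inj w0 co_tau.
have tors := torsion char0 disc co_on co0 coN coD co_inj co_surj.
have [_ /(iter_id co_inj co_surj co_tau) wl wi] := xi_order.
have {}wi i : (0 < i < l)%N -> w ^+ i != 1.
  by move=> il; apply/eqP => /(iter_id co_inj co_surj co_tau); apply: wi.
split; first exact: (zstable_finite tauD tauI tors).
split; first by move=> a b; rewrite !psiE; apply: (zpsi_mul tauD tauI tors).
split.
  move=> l2 m m0; rewrite l2 in wl wi; have := wi 1%N isT; rewrite expr1 => w1.
  rewrite psiE; apply: (zpsi_order2 char0 disc co_on co0 coN coD co_inj co_surj w0 wa co_tau) => //.
  by apply/eqP; move/eqP: wl; rewrite sqrf_eq1 (negbTE w1).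
split.
  have fin p al f : (f (3 ^ al) = 1 /\ (p = 1 %[mod 3] -> f (p ^ al) = al.+1) /\
       (p = 2 %[mod 3] -> f (p ^ al) = ~~ odd al))%N ->
    [/\ f (3 ^ al)%N = 1%N, p = 1 %[mod 3] -> f (p ^ al)%N = (al + 1)%N &
     p = 2 %[mod 3] -> (f (p ^ al)%N)%:Z = 2 * (al %/ 2)%N%:Z - al%:Z + 1].
    move=> [h1 [h2 h3]]; split=> // [/h2 ->|/h3 ->]; first by rewrite addn1.
    by rewrite divn2; have := odd_double_half al; case: (odd al) => /=; lia.
  rewrite !inE => l36 p al pp al0; apply: fin.
  case/orP: l36 => /eqP le; rewrite le in wl wi.
    have [|h1 h2 h3] := zpsi_order3 char0 disc co_on co0 coN coD co_inj co_surj w0 wa co_tau wl _ pp al0.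
      by have := wi 1%N isT; rewrite expr1.
    by [].
  (* for l = 6, - xi has order 3 and the same stable subgroups *)
  have co_tau' P : co (- tau P) = scale (- w) (co P).
    rewrite coN co_tau; case: (co P) => [[x y]|] //; rewrite short_opp /=.
    by congr (Some (_, _)); ring.
  have wa' : short_a E * (- w) ^+ 4 = short_a E by rewrite -[RHS]wa; ring.
  have w0' : - w != 0 by rewrite oppr_eq0.
  have w3 : (- w) ^+ 3 = 1.
    have /eqP : (w ^+ 3) ^+ 2 = 1 by rewrite -exprM.
    rewrite sqrf_eq1 (negbTE (wi 3 isT)) /= => /eqP e.
    by rewrite -[RHS]opprK -e; ring.
  have w1 : - w != 1.
    by apply: contra (wi 2 isT) => /eqP e; apply/eqP; rewrite -sqrrN e expr1n.
  have [h1 h2 h3] := zpsi_order3 char0 disc co_on co0 coN coD co_inj co_surj w0' wa' co_tau' w3 w1 pp al0.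
  have e m : psi xi m = zpsi (fun P => - tau P) m by rewrite psiE /zpsi zstable_opp.
  by rewrite !e.
move=> l4 p al pp al0; rewrite l4 in wl wi.
have w2 : w ^+ 2 = -1.
  have /eqP : (w ^+ 2) ^+ 2 = 1 by rewrite -exprM.
  by rewrite sqrf_eq1 (negbTE (wi 2 isT)) /= => /eqP.
have [h1 h2 h3] := zpsi_order4 char0 disc co_on co0 coN coD co_inj co_surj w0 wa co_tau w2 pp al0.
split=> [|_ p1|pa p3|pa]; first exact: h1.
- by rewrite psiE h2 // addn1.
- by rewrite psiE h3 //; move: pa; rewrite (pow3_mod4 al p3); case: (odd al).
have p3 : p = 3 %[mod 4] by apply: pow_mod4 pa.
by rewrite psiE h3 //; move: pa; rewrite (pow3_mod4 al p3); case: (odd al).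
Qed.
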